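(* Let $G=(V,E,\omega)$ be an undirected $n$-vertex graph with positive integer weights, minimal distance $1$ and diameter $\Lambda$; let $2\le\kappa\le(\log n)/4$, $1/2>\rho\ge1/\kappa$, $0<\epsilon\le1$ and $1\le t\le\log\Lambda$. There is a randomized streaming algorithm that computes a $(\beta,\epsilon)$-hopset with expected size $O(n^{1+1/\kappa}\log\Lambda)$, where $\beta=O\left(\frac{(\log\kappa+1/\rho)\log\Lambda}{\epsilon\cdot t}\right)^{\log\kappa+1/\rho}$, with resource usage either (1) expected space $O(t\cdot n^{1+\rho}/\rho+n^{1+1/\kappa}\log\Lambda)$ (respectively $O(t\cdot n^{1+\rho}/\rho+n^{1+1/\kappa}\cdot\beta\cdot2^t\cdot\log\Lambda)$ for a path-reporting hopset) and $O(\beta\log\Lambda\cdot 2^t)$ passes; or (2) assuming $\Lambda\le 2^{\mathrm{poly}(n)}$, expected space $O(n^{1+1/\kappa}\log\Lambda)$ (respectively $O(n^{1+1/\kappa}\cdot\beta\cdot2^t\cdot\log\Lambda)$ for path-reporting) and $O(n^\rho\cdot\beta\cdot\log n\cdot\log\Lambda\cdot 2^t)$ passes. Moreover, a single-scale hopset $H_k$ with expected size $O(n^{1+1/\kappa})$ can be computed within the stated space and pass complexities.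
   Context: $d^{(\beta)}_{G'}(u,v)$ is the minimum length of a $u$–$v$ path in $G'$ with at most $\beta$ edges. $H$ is a $(\beta,\epsilon)$-hopset if $d_G(u,v)\le d^{(\beta)}_{G\cup H}(u,v)\le(1+\epsilon)d_G(u,v)$ for all $u,v$; a single-scale hopset $H_k$ satisfies the lower bound for all pairs and the upper bound for pairs with $d_G(u,v)\in(2^k,2^{k+1}]$. Streaming model: the vertex set is known, the edges (with weights) arrive as a stream in arbitrary order; the algorithm may read the stream multiple times (passes) and its working memory (measured in words, each holding an identity or weight) is the space. A path-reporting hopset stores, for every hopset edge, a path (of edges of $G$ and lower-scale hopset edges) of weight equal to that edge's weight that implements it. *)

(* Defs.v *)
From HB Require Import structures.
From mathcomp Require Import all_boot all_order all_algebra.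
From mathcomp Require Import all_classical all_reals all_analysis.

Set Implicit Arguments.
Unset Strict Implicit.
Unset Printing Implicit Defensive.

Import Order.TTheory GRing.Theory Num.Theory.
Local Open Scope ring_scope.

Definition log2 (R : realType) (x : R) : R := ln x / ln 2.

Record wgraph (n : nat) := WGraph {
  adj : rel 'I_n;
  weight : 'I_n -> 'I_n -> nat;
  adj_sym : symmetric adj;
  adj_irr : irreflexive adj;
  weight_sym : forall u v, weight u v = weight v u;
  weight_gt0 : forall u v, adj u v -> (0 < weight u v)%N }.

(* (u, v, w): an undirected edge between u and v of weight w *)
Definition edge (n : nat) := ('I_n * 'I_n * nat)%type.

(* Weighted multigraphs, so that G and a hopset edge parallel to an edge of G
   can coexist: E u v w says that some edge of weight w joins u and v. *)
Definition mgraph (n : nat) := 'I_n -> 'I_n -> nat -> bool.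

Definition mgraph_of n (G : wgraph n) : mgraph n :=
  fun u v w => adj G u v && (w == weight G u v).

Definition mgraph_union n (E : mgraph n) (H : seq (edge n)) : mgraph n :=
  fun u v w => [|| E u v w, (u, v, w) \in H | (v, u, w) \in H].

(* A path from u is the sequence of its steps (next vertex, weight of the edge
   taken); the weight paired with the starting vertex is a dummy. *)
Definition is_path n (E : mgraph n) (u : 'I_n) (p : seq ('I_n * nat))
    (v : 'I_n) : bool :=
  [&& path [rel a b | E a.1 b.1 b.2] (u, 0%N) p,
      uniq (u :: map fst p) & last u (map fst p) == v].

Definition path_weight n (p : seq ('I_n * nat)) : nat := \sum_(x <- p) x.2.

(* Both distances are +oo when there is no admissible path. *)
Definition dist (R : realType) n (E : mgraph n) (u v : 'I_n) : \bar R :=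
  ereal_inf [set d | exists2 p, is_path E u p v & d = (path_weight p)%:R%:E]%classic.

Definition hop_dist (R : realType) n (E : mgraph n) (b : nat) (u v : 'I_n) :
    \bar R :=
  ereal_inf [set d | exists2 p, is_path E u p v /\ (size p <= b)%N &
                     d = (path_weight p)%:R%:E]%classic.

Definition min_distance (R : realType) n (G : wgraph n) : \bar R :=
  ereal_inf [set d | exists2 uv : 'I_n * 'I_n, uv.1 != uv.2 &
                     d = dist R (mgraph_of G) uv.1 uv.2]%classic.

Definition diameter (R : realType) n (G : wgraph n) : \bar R :=
  ereal_sup [set d | exists uv : 'I_n * 'I_n,
                     d = dist R (mgraph_of G) uv.1 uv.2]%classic.

Section Hopsets.
Variables (R : realType) (n : nat) (b : nat) (eps : R) (G : wgraph n).
Local Open Scope ereal_scope.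

Definition hopset_lower (H : seq (edge n)) (u v : 'I_n) : Prop :=
  dist R (mgraph_of G) u v <= hop_dist R (mgraph_union (mgraph_of G) H) b u v.

Definition hopset_upper (H : seq (edge n)) (u v : 'I_n) : Prop :=
  hop_dist R (mgraph_union (mgraph_of G) H) b u v
    <= (1 + eps)%:E * dist R (mgraph_of G) u v.

Definition is_hopset (H : seq (edge n)) : Prop :=
  forall u v, hopset_lower H u v /\ hopset_upper H u v.

Definition is_scale_hopset (k : nat) (H : seq (edge n)) : Prop :=
  forall u v, hopset_lower H u v /\
    ((2 ^ k)%:R%:E < dist R (mgraph_of G) u v <= (2 ^ k.+1)%:R%:E ->
     hopset_upper H u v).

End Hopsets.

(* (k, e, p): hopset edge e of scale k, stored with the path p implementing it *)
Definition pr_edge (n : nat) := (nat * edge n * seq ('I_n * nat))%type.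

Definition scale_of n (x : pr_edge n) : nat := x.1.1.
Definition hedge n (x : pr_edge n) : edge n := x.1.2.
Definition hpath n (x : pr_edge n) : seq ('I_n * nat) := x.2.

Definition edges_of n (H : seq (pr_edge n)) : seq (edge n) :=
  [seq hedge x | x <- H].

Definition at_scale n (k : nat) (H : seq (pr_edge n)) : seq (edge n) :=
  [seq hedge x | x <- H & scale_of x == k].

Definition below_scale n (k : nat) (H : seq (pr_edge n)) : seq (edge n) :=
  [seq hedge x | x <- H & (scale_of x < k)%N].

Definition implemented n (G : wgraph n) (H : seq (pr_edge n)) : bool :=
  all (fun x : pr_edge n =>
         is_path (mgraph_union (mgraph_of G) (below_scale (scale_of x) H))
                 (hedge x).1.1 (hpath x) (hedge x).1.2
         && (path_weight (hpath x) == (hedge x).2)) H.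

Definition is_pr_hopset (R : realType) n b (eps : R) (G : wgraph n)
    (H : seq (pr_edge n)) : Prop :=
  [/\ is_hopset b eps G (edges_of H),
      forall k, is_scale_hopset b eps G k (at_scale k H)
    & implemented G H].

(* The paths of the scale-k edges may use edges of the lower-scale hopsets,
   which are therefore part of the stored structure. *)
Definition is_pr_scale_hopset (R : realType) n b (eps : R) (k : nat)
    (G : wgraph n) (H : seq (pr_edge n)) : Prop :=
  [/\ all (fun x => scale_of x <= k)%N H,
      forall j, (j <= k)%N -> is_scale_hopset b eps G j (at_scale j H)
    & implemented G H].

(* Every edge of G occurs exactly once, in one of its two orientations, and
   nothing else occurs; the order is arbitrary. *)
Definition is_stream_of n (G : wgraph n) (s : seq (edge n)) : Prop :=
  forall u v w,
    (count_mem (u, v, w) s + count_mem (v, u, w) s = mgraph_of G u v w)%N.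

Inductive word (n : nat) := Ident of 'I_n | Weight of nat.
Arguments Weight {n} _.

Definition memory (n : nat) := seq (word n).

(* A word must not encode unboundedly much information: the only weights it may
   hold are those up to 2 * L, the largest value of (1 + eps) * d_G(u, v) for
   eps <= 1 and a graph of diameter L. *)
Definition word_fits n (L : nat) (x : word n) : bool :=
  if x is Weight w then (w <= 2 * L)%N else true.

(* On reading a token (Some e: an edge; None: the end of a pass) the algorithm
   draws a fresh coin and updates its memory. Past coins, the index of the pass
   and the position in the stream are available only if the memory holds them. *)
Record streaming_alg (R : realType) (n : nat) := StreamingAlg {
  coin : finType;
  law : coin -> R;
  law_ge0 : forall c, 0 <= law c;
  law_sum1 : \sum_(c : coin) law c = 1;
  step : coin -> memory n -> option (edge n) -> memory n }.

Section Runs.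
Variables (R : realType) (n : nat) (A : streaming_alg R n).
Variables (passes : nat) (s : seq (edge n)).

Definition tokens : seq (option (edge n)) :=
  flatten (nseq passes (rcons (map Some s) None)).

Definition outcome := ((size tokens).-tuple (coin A))%type.

Definition prob (o : outcome) : R := \prod_(c <- o) law c.

Definition expect (X : outcome -> nat) : R := \sum_(o : outcome) prob o * (X o)%:R.

(* The memory after each step; it is empty before the first one. *)
Definition run (o : outcome) : seq (memory n) :=
  scanl (fun m ct => step ct.1 m ct.2) [::] (zip (val o) tokens).

Definition final_memory (o : outcome) : memory n := last [::] (run o).

Definition peak_space (o : outcome) : nat := \max_(m <- run o) size m.

End Runs.

Definition words_of_edge n (e : edge n) : memory n :=
  [:: Ident e.1.1; Ident e.1.2; Weight e.2].

Definition words_of_hopset n (H : seq (edge n)) : memory n :=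
  flatten (map (@words_of_edge n) H).

(* Uniquely decodable: after its four header words an entry consists of pairs
   starting with an identity, while the next entry starts with a number. *)
Definition words_of_pr_edge n (x : pr_edge n) : memory n :=
  Weight (scale_of x) :: words_of_edge (hedge x)
    ++ flatten [seq [:: Ident y.1; Weight y.2] | y <- hpath x].

Definition words_of_pr_hopset n (H : seq (pr_edge n)) : memory n :=
  flatten (map (@words_of_pr_edge n) H).

(* There is an algorithm which, for every n-vertex graph of minimal distance 1
   and diameter L and every order of its edges, makes at most max_passes passes,
   ends with probability 1 holding exactly the words [enc] of a [good] object,
   and whose peak memory and output size have the given bounds in expectation. *)
Definition streamable (R : realType) (n L : nat) (O : Type)
    (enc : O -> memory n) (size_of : O -> nat) (good : wgraph n -> O -> Prop)
    (max_size max_space max_passes : R) : Prop :=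
  exists (A : streaming_alg R n) (p : nat),
    p%:R <= max_passes /\
    forall (G : wgraph n) (s : seq (edge n)),
      min_distance R G = 1%:E -> diameter R G = L%:R%:E -> is_stream_of G s ->
      exists out : outcome A p s -> O,
        [/\ forall o, 0 < prob o ->
              [/\ final_memory o = enc (out o),
                  good G (out o)
                & all (all (word_fits L)) (run o)],
            expect (fun o => size_of (out o)) <= max_size
          & expect (@peak_space R n A p s) <= max_space].

Section Computations.
Variables (R : realType) (n L : nat) (b : nat) (eps : R).

Definition streamable_hopset : R -> R -> R -> Prop :=
  streamable L (@words_of_hopset n) size (is_hopset b eps).

Definition streamable_pr_hopset : R -> R -> R -> Prop :=
  streamable L (@words_of_pr_hopset n) size (is_pr_hopset b eps).

Definition streamable_scale_hopset (k : nat) : R -> R -> R -> Prop :=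
  streamable L (@words_of_hopset n) size
    (fun G => is_scale_hopset b eps G k).

Definition streamable_pr_scale_hopset (k : nat) : R -> R -> R -> Prop :=
  streamable L (@words_of_pr_hopset n) (fun H => size (at_scale k H))
    (is_pr_scale_hopset b eps k).

End Computations.

(* Main.v *)
Require Import Defs.
From mathcomp Require Import all_boot all_order all_algebra.
From mathcomp Require Import all_classical all_reals all_analysis.
From mathcomp Require Import ring lra zify.

Set Implicit Arguments.
Unset Strict Implicit.
Unset Printing Implicit Defensive.

Import Order.TTheory GRing.Theory Num.Theory.
Local Open Scope ring_scope.

(** The hopset is built scale by scale. At scale [k] there are center sets [A_0] = all vertices,
    [A_1], ..., [A_T] = empty, with [T = floor(log kappa + 1/rho)], and radii [delta_i = 4 lambda_i]
    that grow by a factor [c] per level up to [2^k / 4]. A center of [A_i] that has a center of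
    [A_{i+1}] nearby gets one edge to such a center; any other one gets edges to all centers of
    [A_i] within [delta_i] ([level_ok]). Every vertex of a shortest path climbs through covering
    centers until it meets an uncovered one ([climb]). Two vertices whose climbs end at the same
    level [i] and that are at most [lambda_i] apart are joined by climbing up, one edge, and
    climbing down, with an error [O(lambda_i / c)]. Induction on the levels ([segment]), with the
    path cut greedily into short pieces ([chop]), turns this into a bounded number of hops and a
    small relative error ([scale_hw]).

    Distances needed at scale [k] are explored in [G] together with edges of lower scales, where few
    hops suffice. Scales are grouped by [floor(t)], and scale [k] only uses edges of earlier groups.
    The stretch error therefore grows once per group, [O(log L / t)] times, while the hops needed in
    an exploration grow by a factor [2^t] ([low_hw]).

    Explorations are Bellman-Ford computations with one relaxation round per pass. Each edge is
    charged [eta] besides its weight ([pval]), so a bound on the value of a walk bounds its number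
    of edges and hence the number of passes. Walks of value at most [delta] that end at an uncovered
    center avoid all vertices within [4 delta] of the next centers ([far_walk]); the explorations
    are confined to the remaining region, where few centers lie near each vertex.

    There are two ways to pick the next centers. A random sample of rate [1/(4 K_i)] is good with
    probability at least 3/8 ([prob_unlucky]); the [16 K_i n] table entries it may require are then
    produced in [16 K_i] blocks of source labels, each block within [2 n] entries ([runB_progress]).
    Deterministically, each vertex keeps at most [K_i] sources, and one representative is taken from
    each list of a maximal packing of disjoint full lists ([card_chosen], [chosen_ball]); this takes
    a constant number of explorations but tables of [n K_i] entries. A trial detects its own
    failure, so the output is always correct and its size bound holds in every run. For the first
    resource bound no random trial is made. For the second one, [4 ceil(log n)] trials precede the
    deterministic fallback, which is then so unlikely that it adds only [O(n log L)] to the expected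
    space ([fail_le]).

    With [K_i] about [n^min(2^i/kappa, rho)] the exponents sum to at least 1, so [A_T] is empty
    ([exponents_suffice]), and the edge counts of the levels decrease geometrically from
    [n^(1+1/kappa)] ([level_counts]). The algorithm is a program with one instruction per pass;
    [machine_outcome] and [machine_peak] transfer its invariants and its failure probability to the
    streaming model. If the hop bound is at least [n], the empty hopset works. *)

(** * Walks, simple paths and hop-bounded connections *)

Section Walks.
Variables (R : realType) (n : nat).
Implicit Types (E F : mgraph n) (x y z u v : 'I_n) (p q : seq ('I_n * nat)).

(** Unlike [is_path], vertices may repeat, so walks concatenate freely; [walk_simple] leads back to
    paths. *)
Definition walk E x p y : bool :=
  path [rel a b | E a.1 b.1 b.2] (x, 0%N) p && (last x (map fst p) == y).

Lemma path_mgraph E x w w' p :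
  path [rel a b : 'I_n * nat | E a.1 b.1 b.2] (x, w) p =
  path [rel a b : 'I_n * nat | E a.1 b.1 b.2] (x, w') p.
Proof. by case: p. Qed.

Lemma walk_nil E x y : walk E x [::] y = (x == y).
Proof. by []. Qed.

Lemma walk_cons E x y z w p :
  walk E x ((y, w) :: p) z = E x y w && walk E y p z.
Proof. by rewrite /walk /= (path_mgraph _ _ _ 0%N) andbA. Qed.

Lemma walk_cat E x p q y :
  walk E x (p ++ q) y = walk E x p (last x (map fst p))
                        && walk E (last x (map fst p)) q y.
Proof.
elim: p x => [|[z w] p IH] x /=; first by rewrite walk_nil eqxx.
by rewrite !walk_cons IH andbA.
Qed.

Lemma walk_catP E x p q y z : walk E x p y -> walk E y q z -> walk E x (p ++ q) z.
Proof.
move=> h1 h2; rewrite walk_cat.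
by have /andP[_ /eqP e] := h1; rewrite e h1.
Qed.

Lemma sub_walk E F x p y :
  (forall a b w, E a b w -> F a b w) -> walk E x p y -> walk F x p y.
Proof. by move=> EF /andP[h1 h2]; rewrite /walk h2 (sub_path _ h1) // => a b /EF. Qed.

Lemma is_path_walk E x p y : is_path E x p y = walk E x p y && uniq (x :: map fst p).
Proof. by rewrite /is_path /walk andbA andbAC. Qed.

Lemma path_weight_nil : path_weight ([::] : seq ('I_n * nat)) = 0%N.
Proof. by rewrite /path_weight big_nil. Qed.

Lemma path_weight_cons y w p : path_weight ((y, w) :: p) = (w + path_weight p)%N.
Proof. by rewrite /path_weight big_cons. Qed.

Lemma path_weight_cat p q : path_weight (p ++ q) = (path_weight p + path_weight q)%N.
Proof. by rewrite /path_weight big_cat. Qed.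

(** Simplify the tail first; if the start occurs on it, what follows that occurrence is already a
    path from the start, and dropping the loop increases neither length nor weight. *)
Lemma walk_simple E x p y : walk E x p y ->
  exists p', [/\ is_path E x p' y, (size p' <= size p)%N
               & (path_weight p' <= path_weight p)%N].
Proof.
elim: p x => [|[z w] p IH] x.
  by move=> h; exists [::]; split=> //; rewrite is_path_walk h.
rewrite walk_cons => /andP[Exz /IH[p' []]]; rewrite is_path_walk.
move=> /andP[hw hu] hs hp.
have [xz|xz] := eqVneq x z.
  exists p'; rewrite is_path_walk xz hw hu; split=> //=; first lia.
  by rewrite path_weight_cons; lia.
have [xin|xnin] := boolP (x \in map fst p').
  case/mapP: xin => [[x' w'] /= + xx']; rewrite -{}xx' => /path.splitPr hsp.
  case: hsp hw hu hs hp => p1 p2.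
  rewrite walk_cat => /andP[_]; rewrite walk_cons => /andP[_ hw2].
  rewrite map_cat /= mem_cat cat_uniq !negb_or => /andP[_] /and3P[_ _ hu2].
  rewrite size_cat path_weight_cat path_weight_cons /= => hs hp.
  exists p2; rewrite is_path_walk hw2 hu2; split=> //=; first lia.
  by rewrite path_weight_cons; lia.
exists ((z, w) :: p'); split; last 2 first.
- by rewrite /=; lia.
- by rewrite !path_weight_cons; lia.
by rewrite is_path_walk walk_cons Exz hw map_cons /= inE negb_or xz xnin; move: hu => /= ->.
Qed.

Lemma walk_rev E x p y : (forall a b w, E a b w = E b a w) -> walk E x p y ->
  exists q, [/\ walk E y q x, size q = size p & path_weight q = path_weight p].
Proof.
move=> Esym; elim: p x => [|[z w] p IH] x.
  by rewrite walk_nil => /eqP ->; exists [::]; rewrite walk_nil eqxx.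
rewrite walk_cons => /andP[Exz /IH[q [hq sq wq]]].
exists (q ++ [:: (x, w)]); split.
- apply: walk_catP hq _.
  by rewrite walk_cons walk_nil eqxx andbT Esym.
- by rewrite size_cat sq addn1.
- by rewrite path_weight_cat !path_weight_cons path_weight_nil wq addn0 addnC.
Qed.

(** Hop and weight budgets are reals, so that the estimates compose without rounding. *)
Definition hw E x y (h w : R) : Prop :=
  exists p, [/\ walk E x p y, (size p)%:R <= h & (path_weight p)%:R <= w].

Lemma hw_refl E x h w : 0 <= h -> 0 <= w -> hw E x x h w.
Proof. by move=> h0 w0; exists [::]; rewrite path_weight_nil walk_nil. Qed.

Lemma hw_edge E x y w : E x y w -> hw E x y 1 w%:R.
Proof.
move=> Exy; exists [:: (y, w)].
by rewrite walk_cons walk_nil Exy eqxx path_weight_cons path_weight_nil addn0.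
Qed.

Lemma hw_trans E x y z h1 w1 h2 w2 :
  hw E x y h1 w1 -> hw E y z h2 w2 -> hw E x z (h1 + h2) (w1 + w2).
Proof.
move=> [p [hp sp wp]] [q [hq sq wq]]; exists (p ++ q); split.
- exact: walk_catP hp hq.
- by rewrite size_cat natrD lerD.
- by rewrite path_weight_cat natrD lerD.
Qed.

Lemma hw_le E x y h1 w1 h2 w2 :
  h1 <= h2 -> w1 <= w2 -> hw E x y h1 w1 -> hw E x y h2 w2.
Proof. by move=> hh ww [p [? ? ?]]; exists p; split=> //; lra. Qed.

Lemma hw_sub E F x y h w :
  (forall a b k, E a b k -> F a b k) -> hw E x y h w -> hw F x y h w.
Proof. by move=> EF [p [hp ? ?]]; exists p; split=> //; apply: sub_walk hp. Qed.

Lemma hw_sym E x y h w : (forall a b k, E a b k = E b a k) ->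
  hw E x y h w -> hw E y x h w.
Proof.
by move=> Es [p [/(walk_rev Es)[q [hq sq wq]] ? ?]]; exists q; rewrite sq wq.
Qed.

Lemma hop_dist_hw E b x y w : hw E x y b%:R w -> (hop_dist R E b x y <= w%:E)%E.
Proof.
move=> [p [/walk_simple[q [hq sq wq]] sp wp]].
apply: (@le_trans _ _ (path_weight q)%:R%:E).
  apply: ereal_inf_lbound; exists q => //; split=> //.
  by rewrite -(ler_nat R); apply: le_trans sp; rewrite ler_nat.
by rewrite lee_fin; apply: le_trans wp; rewrite ler_nat.
Qed.

Lemma dist_path E x y p : is_path E x p y -> (dist R E x y <= (path_weight p)%:R%:E)%E.
Proof. by move=> hp; apply: ereal_inf_lbound; exists p. Qed.

(** Path weights are natural numbers, so a nonempty set of them has a minimum. *)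
Lemma dist_attained E x y : (dist R E x y < +oo)%E ->
  exists p, is_path E x p y /\ dist R E x y = (path_weight p)%:R%:E.
Proof.
move=> fin.
have [ex|nex] := pselect (exists m, `[< exists2 p, is_path E x p y & path_weight p = m >]); last first.
  move: fin; rewrite /dist.
  rewrite (_ : [set d | _]%classic = set0) ?ereal_inf0 //.
  rewrite -subset0 => d [p hp _]; apply: nex; exists (path_weight p).
  by apply/asboolP; exists p.
case: (ex_minnP ex) => m /asboolP[p hp pm] mmin.
exists p; split=> //; apply/eqP; rewrite eq_le dist_path //=.
apply: le_ereal_inf_tmp => d [q hq ->]; rewrite lee_fin ler_nat pm mmin //.
by apply/asboolP; exists q.
Qed.

End Walks.

(** * Natural-number distances and the lower bound of a hopset *)

Lemma mgraph_of_sym n (G : wgraph n) a b w : mgraph_of G a b w = mgraph_of G b a w.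
Proof. by rewrite /mgraph_of adj_sym weight_sym. Qed.

Lemma mgraph_union_sym n (E : mgraph n) H : (forall a b w, E a b w = E b a w) ->
  forall a b w, mgraph_union E H a b w = mgraph_union E H b a w.
Proof. by move=> Es a b w; rewrite /mgraph_union Es; congr (_ || _); apply: orbC. Qed.

(* [dG] is the distance of a connected graph, as a natural number. *)
Definition is_nat_dist n (G : wgraph n) (dG : 'I_n -> 'I_n -> nat) :=
  (forall x y, exists2 p, walk (mgraph_of G) x p y & path_weight p = dG x y) /\
  (forall x y p, walk (mgraph_of G) x p y -> (dG x y <= path_weight p)%N).

Lemma nat_dist_exists (R : realType) n L (G : wgraph n) :
  diameter R G = L%:R%:E ->
  exists dG, [/\ is_nat_dist G dG, forall x y, (dG x y <= L)%N
    & forall x y, dist R (mgraph_of G) x y = (dG x y)%:R%:E].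
Proof.
move=> diam.
have leL x y : (dist R (mgraph_of G) x y <= L%:R%:E)%E.
  by rewrite -diam; apply: ereal_sup_ubound; exists (x, y).
have att x y : exists p, is_path (mgraph_of G) x p y /\
    dist R (mgraph_of G) x y = (path_weight p)%:R%:E.
  by apply: dist_attained; apply: le_lt_trans (leL x y) _; rewrite ltry.
exists (fun x y => path_weight (proj1_sig (cid (att x y)))); split.
- split=> x y; case: cid => p /= [hp dp].
    by exists p => //; move: hp; rewrite is_path_walk => /andP[].
  move=> q /walk_simple[q' [hq' _ wq']]; apply: leq_trans wq'.
  by have := dist_path R hq'; rewrite dp lee_fin ler_nat.
- move=> x y; case: cid => p /= [hp dp].
  by have := leL x y; rewrite dp lee_fin ler_nat.
- by move=> x y; case: cid => p /= [].
Qed.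

Section NatDist.
Variables (R : realType) (n : nat) (G : wgraph n) (dG : 'I_n -> 'I_n -> nat).
Hypothesis dGP : is_nat_dist G dG.

Lemma nat_dist_triangle x y z : (dG x z <= dG x y + dG y z)%N.
Proof.
have [p hp <-] := dGP.1 x y; have [q hq <-] := dGP.1 y z.
by rewrite -path_weight_cat; apply/dGP.2/(walk_catP hp hq).
Qed.

Lemma nat_dist_sym x y : dG x y = dG y x.
Proof.
apply/eqP; rewrite eqn_leq; apply/andP; split.
  have [p hp <-] := dGP.1 y x.
  by have [q [hq _ <-]] := walk_rev (@mgraph_of_sym _ G) hp; apply: dGP.2.
have [p hp <-] := dGP.1 x y.
by have [q [hq _ <-]] := walk_rev (@mgraph_of_sym _ G) hp; apply: dGP.2.
Qed.

Lemma nat_dist_refl x : dG x x = 0%N.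
Proof.
apply/eqP; rewrite -leqn0 -(path_weight_nil n); apply: dGP.2.
by rewrite walk_nil.
Qed.

(** This alone gives the lower bound of a hopset, for any hop budget, by the triangle inequality
    along a walk. *)
Definition sound_edges (H : seq (edge n)) :=
  forall e, e \in H -> (dG e.1.1 e.1.2 <= e.2)%N.

Lemma union_walk_ge H x p y : sound_edges H ->
  walk (mgraph_union (mgraph_of G) H) x p y -> (dG x y <= path_weight p)%N.
Proof.
move=> sH; elim: p x => [|[z w] p IH] x.
  by rewrite walk_nil => /eqP ->; rewrite nat_dist_refl.
rewrite walk_cons path_weight_cons => /andP[xz /IH hz].
apply: leq_trans (nat_dist_triangle x z y) (leq_add _ hz).
case/or3P: xz => [xz|/sH //|/sH /=]; last by rewrite nat_dist_sym.
rewrite -[w]addn0 -(path_weight_nil n) -(path_weight_cons z); apply: dGP.2.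
by rewrite walk_cons walk_nil xz eqxx.
Qed.

Lemma hw_union_ge H x y (h w : R) : sound_edges H ->
  hw (mgraph_union (mgraph_of G) H) x y h w -> (dG x y)%:R <= w.
Proof.
by move=> sH [p [hp _ wp]]; apply: le_trans wp; rewrite ler_nat (union_walk_ge sH hp).
Qed.

Lemma sound_hopset_lower H b x y : dist R (mgraph_of G) x y = (dG x y)%:R%:E ->
  sound_edges H -> hopset_lower R b G H x y.
Proof.
move=> dE sH; rewrite /hopset_lower dE; apply: le_ereal_inf_tmp => d [p [hp _] ->].
rewrite lee_fin ler_nat; apply: (union_walk_ge sH).
by move: hp; rewrite is_path_walk => /andP[].
Qed.

End NatDist.

(** * Cutting a shortest path into pieces *)

Section Chop.
Variables (R : realType) (n : nat) (E : mgraph n) (m : nat).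
Variables (v : nat -> 'I_n) (D : nat -> R).
Hypothesis Dmono : forall i, (i < m)%N -> D i <= D i.+1.
Hypothesis Dedge : forall i, (i < m)%N -> hw E (v i) (v i.+1) 1 (D i.+1 - D i).

Lemma D_le i j : (i <= j <= m)%N -> D i <= D j.
Proof.
elim: j => [|j IH] => [|/andP[ij jm]]; first by rewrite leqn0 => /andP[/eqP->].
move: ij; rewrite leq_eqVlt => /orP[/eqP -> //|ij].
by apply: le_trans (Dmono jm); apply: IH; rewrite -ltnS ij ltnW.
Qed.

(** Greedy cutting: take the longest piece of length at most [lam], then the next edge by itself.
    Piece and edge together exceed [lam], so there are at most [(D e - D s) / lam + 1] pieces, each
    costing [h + 1] hops and one [err]. *)
Lemma chop (good : nat -> Prop) (eps lam h err : R) :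
  0 <= eps -> 0 < lam -> 0 <= h -> 0 <= err ->
  (forall s e, (s <= e <= m)%N -> (forall j, (s <= j <= e)%N -> good j) ->
     D e - D s <= lam -> hw E (v s) (v e) h ((1 + eps) * (D e - D s) + err)) ->
  forall s e, (s <= e <= m)%N -> (forall j, (s <= j <= e)%N -> good j) ->
    hw E (v s) (v e) (((D e - D s) / lam + 1) * (h + 1))
       ((1 + eps) * (D e - D s) + ((D e - D s) / lam + 1) * err).
Proof.
move=> e0 l0 h0 r0 W s e; move: {2}(e - s).+1 (ltnSn (e - s)) => N.
elim: N s => // N IH s; rewrite ltnS => esN sem gd.
have /andP[se em] := sem.
pose P j := ((s <= j <= e)%N && (D j - D s <= lam)).
have exP : exists j, P j by exists s; rewrite /P leqnn se subrr ltW.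
have ubP j : P j -> (j <= e)%N by case/andP => /andP[].
(* [e1] is the far end of the longest admissible first piece. *)
case: (ex_maxnP exP ubP) => e1 /andP[/andP[se1 e1e] De1] e1max.
have W1 : hw E (v s) (v e1) h ((1 + eps) * (D e1 - D s) + err).
  apply: W => //; first by rewrite se1 (leq_trans e1e em).
  by move=> j /andP[sj je1]; apply: gd; rewrite sj (leq_trans je1).
have y0 a b : (s <= a <= b)%N -> (b <= e)%N -> 0 <= D b - D a.
  by move=> /andP[sa ab] be; rewrite subr_ge0 D_le // ab (leq_trans be em).
move: e1e; rewrite leq_eqVlt => /orP[/eqP e1e|e1e].
  rewrite -{}e1e in em W1 sem se *.
  have q0 : 0 <= (D e1 - D s) / lam.
    by apply: divr_ge0 (ltW l0); rewrite subr_ge0 D_le.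
  apply: hw_le W1; [nra | rewrite lerD2l; nra].
have e1m : (e1 < m)%N by apply: leq_trans e1e em.
(* Maximality of [e1]: piece and next edge pay for one unit of [(D e - D s) / lam]. *)
have Dl : lam < D e1.+1 - D s.
  rewrite ltNge; apply/negP => Dl.
  have := e1max e1.+1; rewrite /P (leq_trans se1 (leqnSn _)) e1e Dl => /(_ isT).
  by rewrite ltnn.
have sub2 : (e - e1.+1 < N)%N by lia.
have W3 : hw E (v e1.+1) (v e) (((D e - D e1.+1) / lam + 1) * (h + 1))
    ((1 + eps) * (D e - D e1.+1) + ((D e - D e1.+1) / lam + 1) * err).
  apply: IH => //; first by rewrite e1e.
  by move=> j /andP[ej je]; apply: gd; rewrite je andbT; lia.
have := hw_trans (hw_trans W1 (Dedge e1m)) W3.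
set q := (D e - D e1.+1) / lam; set q' := (D e - D s) / lam.
have q0 : 0 <= q by apply: divr_ge0 (ltW l0); apply: y0 => //; lia.
have qq : q + 1 <= q'.
  rewrite /q /q' -[X in _ + X](divff (lt0r_neq0 l0)) -mulrDl ler_pM2r ?invr_gt0 //.
  by lra.
have de := Dmono e1m.
apply: hw_le; first nra.
nra.
Qed.

End Chop.

Section Segments.
Variables (R : realType) (n : nat) (E : mgraph n) (m T : nat).
Variables (v : nat -> 'I_n) (D : nat -> R) (lev : nat -> nat).
Variables (eps c K : R) (lam : nat -> R).
Hypothesis Dmono : forall i, (i < m)%N -> D i <= D i.+1.
Hypothesis Dedge : forall i, (i < m)%N -> hw E (v i) (v i.+1) 1 (D i.+1 - D i).
Hypothesis eps_ge0 : 0 <= eps.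
Hypothesis c_ge : 4 * T%:R <= c.
Hypothesis K_ge0 : 0 <= K.
Hypothesis c_ge2 : 2 <= c.
Hypothesis lamS : forall i, lam i.+1 = c * lam i.
Hypothesis lam_gt0 : forall i, 0 < lam i.
(** Here [lev j] stands for the level at which the climb from [v j] stops; two vertices of equal
    level are joined through their centers, with [lev] hops for each climb and one between the
    centers. *)
Hypothesis same : forall s e, (s <= e <= m)%N -> lev s = lev e -> (lev s < T)%N ->
  D e - D s <= lam (lev s) ->
  hw E (v s) (v e) (2 * (lev s)%:R + 1)
     ((1 + eps) * (D e - D s) + K * lam (lev s) / c).

(** Induction on the highest level present. Between the first and the last vertex of top level one
    direct connection suffices; what lies before and after has lower levels and is cut into pieces
    of length [lam] of the level below, about [c] of them altogether. *)
Lemma segment i s e : (i < T)%N -> (s <= e <= m)%N ->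
  (forall j, (s <= j <= e)%N -> (lev j <= i)%N) -> D e - D s <= lam i ->
  hw E (v s) (v e) ((8 * c) ^+ i)
     ((1 + eps) * (D e - D s) + (2 * K) * i.+1%:R * lam i / c).
Proof.
have c2 := c_ge2; have cT' := c_ge; have e0 := eps_ge0; have K0 := K_ge0.
have c0 : 0 < c by lra.
elim: i s e => [|i IH] s e iT sem lv Dle.
  have ls : lev s = 0%N by have /andP[se _] := sem; have := lv s; rewrite leqnn se => /(_ isT); case: (lev s).
  have le : lev e = 0%N by have /andP[se _] := sem; have := lv e; rewrite leqnn se => /(_ isT); case: (lev e).
  have := same sem; rewrite ls le => /(_ erefl iT Dle).
  have := lam_gt0 0%N => l0.
  have l1 : 0 < lam 0 / c by rewrite divr_gt0.
  apply: hw_le; first by rewrite expr0 mulr0 add0r.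
  have := mulr_ge0 K0 (ltW l1).
  by rewrite lerD2l mulr1 -!mulrA; lra.
set h := (8 * c) ^+ i; set err := (2 * K) * i.+1%:R * lam i / c.
have h1 : 1 <= h by rewrite exprn_ege1 //; lra.
have err0 : 0 <= err.
  apply: divr_ge0 (ltW c0); apply: mulr_ge0 (ltW (lam_gt0 _)).
  by apply: mulr_ge0 => //; lra.
have h' : (8 * c) ^+ i.+1 = 8 * c * h by rewrite exprS.
have hi : 2 * i%:R + 7 <= 4 * c * h :> R.
  have h7 : 1 + 7 * i%:R <= h.
    rewrite /h; elim: (i) => [|j IHj]; first by rewrite expr0; lra.
    rewrite exprS -natr1; have j0 : 0 <= (j%:R : R) by [].
    have : 16 * (8 * c) ^+ j <= 8 * c * (8 * c) ^+ j by apply: ler_wpM2r; lra.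
    lra.
  have : 8 * h <= 4 * c * h by apply: ler_wpM2r; lra.
  have : 0 <= (i%:R : R) by [].
  lra.
have CH := chop Dmono Dedge (good := fun j => (lev j <= i)%N) eps_ge0 (lam_gt0 i)
   (le_trans ler01 h1) err0 (fun s e => IH s e (ltnW iT)).
have errE : (2 * K) * i.+2%:R * lam i.+1 / c = (2 * K) * i.+2%:R * lam i.
  by rewrite lamS; field; rewrite lt0r_neq0.
have cT : 4 * i.+1%:R <= c.
  by apply: le_trans c_ge; rewrite ler_pM2l // ler_nat ltnW.
(* Error recurrence: at most [c + 2] pieces and one direct connection. The two extra pieces cost at
   most [K * lam i] because [c >= 4 (i + 1)]; this is why the error grows linearly in the level. *)
have errc : (c + 2) * err + K * lam i <= (2 * K) * i.+2%:R * lam i.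
  rewrite /err -[i.+2%:R]natr1.
  have -> : (c + 2) * ((2 * K) * i.+1%:R * lam i / c) =
    (2 * K) * i.+1%:R * lam i + (K * 4) * lam i * (i.+1%:R / c) by field; rewrite lt0r_neq0.
  have : i.+1%:R / c <= 4^-1 by rewrite ler_pdivrMr // mulrC ler_pdivlMr //; lra.
  move=> tle; have : lam i * (i.+1%:R / c) <= lam i * 4^-1.
    by apply: ler_wpM2l => //; apply: ltW.
  move=> /(ler_wpM2l K0).
  by rewrite -!mulrA; lra.
clearbody err h.
(* Does a vertex of the top level [i.+1] occur? If not, [chop] applies to the whole segment. *)
have [/existsP[[j0 j0e] /= /andP[sj0 /eqP lj0]]|nex] := boolP [exists j : 'I_e.+1, (s <= j)%N && (lev j == i.+1)]; last first.
  have /(CH _ _ sem) : forall j, (s <= j <= e)%N -> (lev j <= i)%N.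
    move=> j jse; have /andP[sj je] := jse.
    have := lv j jse; rewrite leq_eqVlt => /orP[|//] ej.
    move: nex; rewrite negb_exists => /forallP/(_ (Ordinal (je : (j < e.+1)%N))) /=.
    by rewrite sj ej.
  set q := (D e - D s) / lam i => hW.
  have q0 : 0 <= q.
    by rewrite divr_ge0 ?(ltW (lam_gt0 _)) // subr_ge0 (D_le Dmono).
  have qc : q <= c by rewrite ler_pdivrMr // -lamS.
  have : (q + 1) * (h + 1) <= (c + 1) * (h + 1) by apply: ler_wpM2r; lra.
  have : c * (h + 1) <= c * (2 * h) by apply: ler_wpM2l; lra.
  have : 2 * h <= c * h by apply: ler_wpM2r; lra.
  move=> H1 H2 H3; apply: hw_le hW; first by rewrite h'; lra.
  by rewrite lerD2l errE; apply: le_trans errc; have := mulr_ge0 K0 (ltW (lam_gt0 i)); have : (q + 1) * err <= (c + 2) * err by [apply: ler_wpM2r => //; lra]; lra.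
pose P j := (s <= j <= e)%N && (lev j == i.+1).
have exP : exists j, P j by exists j0; rewrite /P sj0 -ltnS j0e lj0 eqxx.
have ubP j : P j -> (j <= e)%N by case/andP => /andP[].
(* [z] and [z'] are the first and the last vertex of top level; they are joined by [same]. *)
case: (ex_minnP exP) => z /andP[/andP[sz ze] /eqP lz] zmin.
case: (ex_maxnP exP ubP) => z' /andP[/andP[sz' z'e] /eqP lz'] zmax.
have zz' : (z <= z')%N by apply: zmin; rewrite /P sz' z'e lz' eqxx.
have em : (e <= m)%N by case/andP: sem.
set y1 := D z - D s; set y2 := D e - D z'.
have y10 : 0 <= y1 by rewrite subr_ge0 (D_le Dmono) // sz (leq_trans ze).
have y20 : 0 <= y2 by rewrite subr_ge0 (D_le Dmono) // z'e.
have pre : hw E (v s) (v z) ((y1 / lam i + 1) * (h + 1) + 1)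
    ((1 + eps) * y1 + (y1 / lam i + 1) * err).
  have q0 : 0 <= y1 / lam i by rewrite divr_ge0 // ltW.
  move: sz; rewrite leq_eqVlt => /orP[/eqP sz|sz].
    have p1 : 0 <= (y1 / lam i + 1) * (h + 1) by [apply: mulr_ge0; lra].
    have p2 : 0 <= (y1 / lam i + 1) * err by [apply: mulr_ge0 => //; lra].
    have p3 : 0 <= (1 + eps) * y1 by [apply: mulr_ge0 => //; lra].
    rewrite -sz; apply: hw_refl; lra.
  (* The prefix stops one vertex before [z], as [z] itself has too high a level; the edge into [z]
     accounts for the extra hop. *)
  case: z lz zmin zz' ze @y1 y10 q0 sz => // z lz zmin zz' ze y1 y10 q0 sz.
  have zm : (z < m)%N := leq_trans ze em.
  have := CH s z; rewrite -ltnS sz ltnW // => /(_ isT) => hW.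
  have {hW}hW := hw_trans (hW _) (Dedge zm).
  have dz := Dmono zm.
  apply: hw_le (hW _); last first.
  - move=> j /andP[sj jz].
    have := lv j; rewrite sj (_ : (j <= e)%N); last exact: leq_trans jz (ltnW ze).
    move=> /(_ isT); rewrite leq_eqVlt => /orP[lj|//].
    suff : (z < j)%N by rewrite ltnNge jz.
    by apply: zmin; rewrite /P sj lj andbT (leq_trans jz (ltnW ze)).
  - have le : ((D z - D s) / lam i + 1) * err <= (y1 / lam i + 1) * err.
      by apply: ler_wpM2r => //; rewrite lerD2r ler_pM2r ?invr_gt0 // /y1; lra.
    have : 0 <= eps * (D z.+1 - D z) by [apply: mulr_ge0 => //; lra].
    by move: le; rewrite /y1; lra.
  - have le : ((D z - D s) / lam i + 1) * (h + 1) <= (y1 / lam i + 1) * (h + 1).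
      by apply: ler_wpM2r; [lra|rewrite lerD2r ler_pM2r ?invr_gt0 // /y1; lra].
    by move: le; rewrite /y1 /y2; move: (_ * (h + 1)) (_ * (h + 1)) => *; lra.
have post : hw E (v z') (v e) ((y2 / lam i + 1) * (h + 1) + 1)
    ((1 + eps) * y2 + (y2 / lam i + 1) * err).
  have q0 : 0 <= y2 / lam i by rewrite divr_ge0 // ltW.
  move: z'e; rewrite leq_eqVlt => /orP[/eqP ze'|ze'].
    have p1 : 0 <= (y2 / lam i + 1) * (h + 1) by [apply: mulr_ge0; lra].
    have p2 : 0 <= (y2 / lam i + 1) * err by [apply: mulr_ge0 => //; lra].
    have p3 : 0 <= (1 + eps) * y2 by [apply: mulr_ge0 => //; lra].
    rewrite ze'; apply: hw_refl; lra.
  have zm : (z' < m)%N := leq_trans ze' em.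
  have := CH z'.+1 e; rewrite ze' em => /(_ isT) => hW.
  have {hW}hW := hw_trans (Dedge zm) (hW _).
  have dz := Dmono zm.
  apply: hw_le (hW _); last first.
  - move=> j /andP[sj jz].
    have := lv j; rewrite jz (_ : (s <= j)%N); last exact: leq_trans sz' (ltnW sj).
    move=> /(_ isT); rewrite leq_eqVlt => /orP[lj|//].
    suff : (j <= z')%N by rewrite leqNgt sj.
    by apply: zmax; rewrite /P lj andbT (leq_trans sz' (ltnW sj)).
  - have le : ((D e - D z'.+1) / lam i + 1) * err <= (y2 / lam i + 1) * err.
      by apply: ler_wpM2r => //; rewrite lerD2r ler_pM2r ?invr_gt0 // /y2; lra.
    have : 0 <= eps * (D z'.+1 - D z') by [apply: mulr_ge0 => //; lra].
    by move: le; rewrite /y2; lra.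
  - have le : ((D e - D z'.+1) / lam i + 1) * (h + 1) <= (y2 / lam i + 1) * (h + 1).
      by apply: ler_wpM2r; [lra|rewrite lerD2r ler_pM2r ?invr_gt0 // /y2; lra].
    by move: le; rewrite /y1 /y2; move: (_ * (h + 1)) (_ * (h + 1)) => *; lra.
have z'm : (z' <= m)%N := leq_trans z'e em.
have ym0 : 0 <= D z' - D z by rewrite subr_ge0 (D_le Dmono) // zz'.
have := @same z z'; rewrite zz' z'm lz lz' => /(_ isT erefl iT) mid.
have {}mid := mid _.
have midle : D z' - D z <= lam i.+1 by move: Dle; rewrite /y1 /y2 in y10 y20; lra.
have := hw_trans (hw_trans pre (mid midle)) post.
have q12 : y1 / lam i + y2 / lam i <= c.
  by rewrite -mulrDl ler_pdivrMr // -lamS; apply: le_trans Dle; rewrite /y1 /y2; lra.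
apply: hw_le.
  rewrite h' -natr1; move: hi h1 c2 q12; move: (y1 / lam i) (y2 / lam i) => q1 q2.
  move: (i%:R) => u hi h1 {}c2 q12.
  have : (q1 + q2 + 2) * (h + 1) <= (c + 2) * (h + 1) by apply: ler_wpM2r; lra.
  have : c * (h + 1) <= c * (2 * h) by apply: ler_wpM2l; lra.
  have : 2 * h <= c * h by apply: ler_wpM2r; lra.
  by move: hi; rewrite -!mulrA; lra.
rewrite errE; move: errc.
have -> : K * lam i.+1 / c = K * lam i by rewrite lamS; field; rewrite lt0r_neq0.
have : (y1 / lam i + y2 / lam i + 2) * err <= (c + 2) * err by apply: ler_wpM2r => //; lra.
rewrite /y1 /y2; move: (_ / _) (_ / _) ((2 * K) * _ * _) (K * _) => q1 q2 a b.
by rewrite !mulrDl; lra.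
Qed.

End Segments.

(** * Hops and stretch of a single scale *)

Section ScaleAnalysis.
Variables (R : realType) (n : nat) (G : wgraph n) (dG : 'I_n -> 'I_n -> nat).
Hypothesis dGP : is_nat_dist G dG.

(** Charging [eta] per edge makes a hop-limited exploration an ordinary shortest-walk computation: a
    walk of value at most [r] has at most [r / eta] edges. *)
Definition pval (eta : R) (p : seq ('I_n * nat)) : R :=
  (path_weight p)%:R + eta * (size p)%:R.

(* In a level step from the centers [A] to [A'], a center is either covered by
   a nearby center of [A'] or joined to all centers of [A] near it. *)
Definition level_ok (E : mgraph n) (H : seq (edge n)) (eta delta : R)
    (A A' : {set 'I_n}) : Prop :=
  forall x, x \in A ->
    (exists2 s, s \in A' & hw (mgraph_union (mgraph_of G) H) x s 1 (5 * delta)) \/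
    (forall y p, y \in A -> walk E x p y -> pval eta p <= delta ->
       hw (mgraph_union (mgraph_of G) H) x y 1 (pval eta p)).

Lemma nat_walkD (x y : 'I_n) : exists m (v : nat -> 'I_n) (D : nat -> nat),
  [/\ v 0%N = x /\ v m = y, D 0%N = 0%N, D m = dG x y,
      forall i, (i < m)%N -> (D i <= D i.+1)%N &
      forall i, (i < m)%N -> mgraph_of G (v i) (v i.+1) (D i.+1 - D i)%N].
Proof.
have [p hp <-] := dGP.1 x y.
elim: p x hp => [|[z w] p IH] x.
  rewrite walk_nil => /eqP ->; exists 0%N, (fun=> y), (fun=> 0%N).
  by rewrite path_weight_nil.
rewrite walk_cons => /andP[xz /IH[m [v [D [[v0 vm] D0 Dm Dle Dadj]]]]].
exists m.+1, (fun i => if i is j.+1 then v j else x),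
  (fun i => if i is j.+1 then (w + D j)%N else 0%N).
split=> //.
- by rewrite Dm path_weight_cons.
- by case=> [|i] //; rewrite ltnS leq_add2l => /Dle.
- case=> [_|i]; first by rewrite v0 D0 addn0 subn0.
  by rewrite ltnS subnDl => /Dadj.
Qed.

Lemma nat_walk_dist m (v : nat -> 'I_n) (D : nat -> nat) :
  (forall i, (i < m)%N -> (D i <= D i.+1)%N) ->
  (forall i, (i < m)%N -> mgraph_of G (v i) (v i.+1) (D i.+1 - D i)%N) ->
  forall s e, (s <= e <= m)%N -> (dG (v s) (v e))%:R <= (D e)%:R - (D s)%:R :> R.
Proof.
move=> Dle Dadj s; elim=> [|e IH] /andP[se em].
  by move: se; rewrite leqn0 => /eqP ->; rewrite (nat_dist_refl dGP) subrr.
move: se; rewrite leq_eqVlt => /orP[/eqP ->|se].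
  by rewrite (nat_dist_refl dGP) subrr.
have := nat_dist_triangle dGP (v s) (v e) (v e.+1).
rewrite -(ler_nat R) natrD => /le_trans; apply.
have := IH; rewrite -ltnS se ltnW // => /(_ isT) h1.
have : (dG (v e) (v e.+1) <= D e.+1 - D e)%N.
  rewrite -[(D e.+1 - D e)%N]addn0 -(path_weight_nil n).
  rewrite -(path_weight_cons (v e.+1)); apply: dGP.2.
  by rewrite walk_cons walk_nil Dadj // eqxx.
rewrite -(ler_nat R) natrB ?Dle // => h2.
by move: h1 h2; lra.
Qed.

Section Scale.
Variables (E' : mgraph n) (H : seq (edge n)) (T : nat) (As : nat -> {set 'I_n}).
Variables (eps c B M K : R) (lam : nat -> R).
Let E := mgraph_union (mgraph_of G) H.
Hypothesis sH : sound_edges dG H.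
Hypothesis eps01 : 0 <= eps <= 1.
Hypothesis c_ge : 4 * T%:R <= c.
Hypothesis c_ge_cst : 84 <= c.
Hypothesis K_ge : 6 * 40 + 4 <= K.
Hypothesis B_gt0 : 0 < B.
Hypothesis lamS : forall i, lam i.+1 = c * lam i.
Hypothesis lam_gt0 : forall i, 0 < lam i.
Hypothesis lam_le : forall i, (i < T)%N -> 2 * lam i <= M.
Hypothesis lower : forall x y, (dG x y)%:R <= M ->
  hw E' x y B ((1 + eps) * (dG x y)%:R).
Hypothesis As0 : As 0%N = [set: 'I_n].
Hypothesis AsT : As T = finset.set0.
Hypothesis levels : forall i, (i < T)%N ->
  level_ok E' H (4 * lam i / (c * B)) (4 * lam i) (As i) (As i.+1).

Definition uncovered_at i x := forall y p, y \in As i -> walk E' x p y ->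
  pval (4 * lam i / (c * B)) p <= 4 * lam i ->
  hw E x y 1 (pval (4 * lam i / (c * B)) p).

Lemma climb x : exists i y, [/\ (i < T)%N, y \in As i,
  hw E x y i%:R (40 * lam i / c) & uncovered_at i y].
Proof.
have cc := c_ge_cst; have c0 : 0 < c by lra.
suff : forall j i y, (j + i = T)%N -> y \in As i ->
    hw E x y i%:R (40 * lam i / c) ->
    exists i y, [/\ (i < T)%N, y \in As i,
      hw E x y i%:R (40 * lam i / c) & uncovered_at i y].
  apply; [exact: addn0|by rewrite As0 inE|].
  by apply: hw_refl => //; rewrite divr_ge0 ?(ltW c0) // mulr_ge0 ?(ltW (lam_gt0 _)).
elim=> [|j IH] i y ji yi hy.
  by move: yi; rewrite -[i]add0n ji AsT inE.
have iT : (i < T)%N by rewrite -ji addSn ltnS leq_addl.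
have [[s si hs]|un] := levels iT yi; last by exists i, y.
apply: (IH i.+1 s) => //; first by rewrite -ji addnS.
have := hw_trans hy hs; apply: hw_le; first by rewrite -natr1.
rewrite lamS; have l0 := lam_gt0 i.
have -> : 40 * (c * lam i) / c = 40 * lam i by field; rewrite lt0r_neq0.
have : 40 * lam i / c <= lam i by rewrite ler_pdivrMr // mulrC ler_pM2l //; lra.
lra.
Qed.

(** Assign to each vertex of a shortest path the level of its climb, apply [segment] to pieces of
    length [lam T.-1], and put the pieces together with [chop]. *)
Lemma scale_hw a b : let d := (dG a b)%:R in
  hw E a b ((d / lam T.-1 + 1) * ((8 * c) ^+ T.-1 + 1))
     ((1 + eps) * d + (d / lam T.-1 + 1) * ((2 * K) * T%:R * lam T.-1 / c)).
Proof.
have cc := c_ge_cst; have c0 : 0 < c by lra.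
have /andP[e0 e1] := eps01; have B0 := B_gt0; have KK := K_ge.
have T0 : (0 < T)%N.
  case: (posnP T) => // T0; have := finset.in_setT a.
  by rewrite -As0 -T0 AsT inE.
have [ctr ctrP] := choice (fun x => climb x).
have Esym : forall x y w, E x y w = E y x w.
  by apply: mgraph_union_sym; apply: mgraph_of_sym.
have [m [v [D [[v0 vm] D0 Dm Dle Dadj]]]] := nat_walkD a b.
pose Dr i : R := (D i)%:R; pose lev j := ctr (v j).
have Drmono i : (i < m)%N -> Dr i <= Dr i.+1 by move=> /Dle; rewrite ler_nat.
have Dredge i : (i < m)%N -> hw E (v i) (v i.+1) 1 (Dr i.+1 - Dr i).
  move=> im; rewrite -natrB ?Dle //; apply: hw_edge.
  by rewrite /E /mgraph_union Dadj.
have dGD := nat_walk_dist Dle Dadj.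
(* With [r = 40 lam / c] bounding each climb: the climbs cost [2 r], the detour of the center edge
   at most [(1 + eps) * 2 r <= 4 r], its hop charge [r / 10]. The total [6.1 r] is [244 lam / c],
   whence the bound on [K]. The radius [4 lam] leaves room for the walk between the centers. *)
have same s e : (s <= e <= m)%N -> lev s = lev e -> (lev s < T)%N ->
    Dr e - Dr s <= lam (lev s) ->
    hw E (v s) (v e) (2 * (lev s)%:R + 1)
      ((1 + eps) * (Dr e - Dr s) + K * lam (lev s) / c).
  move=> sem lse lT Dl; rewrite {}/lev in lse lT Dl *.
  have [ys [_ ysA hs un]] := ctrP (v s).
  have [ye [_ yeA he _]] := ctrP (v e).
  move: yeA he; rewrite -lse => yeA he.
  move: (ctr (v s)) lT ysA hs un yeA he Dl => i iT ysA hs un yeA he Dl {lse}.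
  have /(hw_union_ge dGP sH) ds := hs.
  have /(hw_union_ge dGP sH) de := he.
  have dse := dGD s e sem.
  have l0 := lam_gt0 i.
  have t1 := nat_dist_triangle dGP ys (v s) ye.
  have t2 := nat_dist_triangle dGP (v s) (v e) ye.
  rewrite (nat_dist_sym dGP ys (v s)) in t1.
  have dyy : (dG ys ye)%:R <= 2 * (40 * lam i / c) + (Dr e - Dr s).
    have : (dG ys ye)%:R <= (dG (v s) ys)%:R + ((dG (v s) (v e))%:R + (dG (v e) ye)%:R) :> R.
      by rewrite -!natrD ler_nat; apply: leq_trans t1 _; rewrite leq_add2l.
    lra.
  set r := 40 * lam i / c in hs he ds de dyy *.
  have rl : 84 * r <= 40 * lam i.
    by rewrite /r mulrA ler_pdivrMr // [X in X <= _]mulrC ler_wpM2l //; lra.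
  have r0 : 0 <= r by rewrite /r divr_ge0 ?(ltW c0) // mulr_ge0 // ltW.
  have [p [wp sp pw]] : hw E' ys ye B ((1 + eps) * (dG ys ye)%:R).
    by apply: lower; apply: le_trans (lam_le iT); lra.
  (* The edge charge is chosen so that the [B] hops of a walk in the lower graph cost together only
     [4 lam / c]. *)
  have etaB : 4 * lam i / (c * B) * (size p)%:R <= r / 10.
    apply: (@le_trans _ _ (4 * lam i / (c * B) * B)).
      by rewrite ler_wpM2l // divr_ge0 ?mulr_ge0 ?(ltW c0) // ltW.
    rewrite /r (_ : 4 * lam i / (c * B) * B = 40 * lam i / c / 10) //.
    by field; rewrite !lt0r_neq0.
  have KE : K * lam i / c = K * (r / 40) by rewrite /r; field; rewrite lt0r_neq0.
  clearbody r.
  have D0' : 0 <= Dr e - Dr s by apply: le_trans dse.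
  have pvle : pval (4 * lam i / (c * B)) p <= (1 + eps) * (2 * r + (Dr e - Dr s)) + r / 10.
    rewrite /pval lerD // (le_trans pw) // ler_wpM2l //; lra.
  have e2r : eps * (2 * r + (Dr e - Dr s)) <= 2 * r + (Dr e - Dr s).
    by rewrite ler_piMl //; lra.
  have e2r' : eps * r <= r by rewrite ler_piMl.
  have pvd : pval (4 * lam i / (c * B)) p <= 4 * lam i by lra.
  have := hw_trans (hw_trans hs (un _ _ yeA wp pvd)) (hw_sym Esym he).
  apply: hw_le; first by lra.
  rewrite KE.
  have : (6 * 40 + 4) * (r / 40) <= K * (r / 40) by apply: ler_wpM2r => //; lra.
  lra.
have K0 : 0 <= K by lra.
have cg := c_ge; have c2 : 2 <= c by lra.
have SEG := segment Drmono Dredge e0 cg K0 c2 lamS lam_gt0 same.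
have T1 : (T.-1 < T)%N by rewrite ltn_predL.
have h0 : 0 <= (8 * c) ^+ T.-1 by rewrite exprn_ge0 //; lra.
have r0 : 0 <= 2 * K * T%:R * lam T.-1 / c.
  rewrite divr_ge0 ?(ltW c0) // mulr_ge0 ?(ltW (lam_gt0 _)) // mulr_ge0 //; lra.
have := chop Drmono Dredge (good := fun j => (lev j <= T.-1)%N) e0 (lam_gt0 T.-1) h0 r0.
move=> /(_ _)/(_ 0%N m); rewrite leqnn v0 vm /Dr D0 Dm subr0; apply=> //.
  move=> s e sem gd Dl; have := SEG T.-1 s e T1 sem gd Dl.
  by rewrite prednK.
move=> j _; rewrite /lev; have [y [h _ _ _]] := ctrP (v j).
by rewrite -ltnS prednK.
Qed.

End Scale.
End ScaleAnalysis.

(** * Bellman-Ford exploration with bounded tables *)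

Lemma pval_nil (R : realType) n (eta : R) : pval eta ([::] : seq ('I_n * nat)) = 0.
Proof. by rewrite /pval path_weight_nil mulr0 addr0. Qed.

Lemma pval_cons (R : realType) n (eta : R) (x : 'I_n) w p :
  pval eta ((x, w) :: p) = w%:R + eta + pval eta p.
Proof. by rewrite /pval path_weight_cons natrD /= -natr1; ring. Qed.

Lemma pval_cat (R : realType) n (eta : R) (p q : seq ('I_n * nat)) :
  pval eta (p ++ q) = pval eta p + pval eta q.
Proof. by rewrite /pval path_weight_cat size_cat !natrD; ring. Qed.

Lemma pval_ge0 (R : realType) n (eta : R) (p : seq ('I_n * nat)) :
  0 <= eta -> 0 <= pval eta p.
Proof. by move=> e0; rewrite addr_ge0 ?mulr_ge0. Qed.

Lemma foldl_flatten A B (f : A -> B -> A) z (ss : seq (seq B)) :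
  foldl f z (flatten ss) = foldl (foldl f) z ss.
Proof. by elim: ss z => //= s ss IH z; rewrite foldl_cat IH. Qed.

(* An entry [(w, h, q)] of a table at [(x, v)] records a walk of weight [w] with
   [h] edges from the source labelled [v] to [x]; [q] is its last step back. *)
Definition entry (n : nat) := (nat * nat * option ('I_n * nat))%type.
Definition table (n : nat) := {ffun 'I_n * 'I_n -> option (entry n)}.

Section Explore.
Variables (R : realType) (n : nat).
Implicit Types (T : table n) (x y v : 'I_n) (st : table n * nat).

Variables (Lam : {set 'I_n}) (eta r : R) (K cap : nat).

Definition entry_val (e : entry n) : R := e.1.1%:R + eta * e.1.2%:R.

Definition row_size T x := #|[set v | isSome (T (x, v))]|.

Definition table_size T (h : nat) := #|[pred q : 'I_n * 'I_n | isSome (T q) && (q.2 < h)%N]|.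

Definition cut T (h : nat) : table n := [ffun q : 'I_n * 'I_n => if (q.2 < h)%N then T q else None].

(* On overflow the sources of largest label are given up. *)
Definition shrink T (hi : nat) : table n * nat :=
  let h := (\max_(h < hi.+1 | table_size T h <= cap) h)%N in (cut T h, h).

(** A new source enters a row only while the row holds fewer than [K] sources; known sources may
    always improve. *)
Definition improves T x v (e : entry n) : bool :=
  (x \in Lam) && (entry_val e <= r) &&
  (if T (x, v) is Some e' then entry_val e < entry_val e' else (row_size T x < K)%N).

Definition put T x v e : table n := [ffun q : 'I_n * 'I_n => if q == (x, v) then Some e else T q].

Definition update (o : 'I_n * 'I_n * nat * 'I_n) st : table n * nat :=
  let: (y, x, w, v) := o in
  if st.1 (y, v) is Some e0 then
    let e := (e0.1.1 + w, e0.1.2.+1, Some (y, w))%N in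
    if improves st.1 x v e then shrink (put st.1 x v e) st.2 else st
  else st.

Definition updates_of (e : edge n) : seq ('I_n * 'I_n * nat * 'I_n) :=
  flatten [seq [:: (e.1.1, e.1.2, e.2, v); (e.1.2, e.1.1, e.2, v)] | v <- enum 'I_n].

Definition relax st (e : edge n) := foldl (fun st o => update o st) st (updates_of e).

Definition init (src : 'I_n -> 'I_n -> bool) : table n :=
  [ffun q : 'I_n * 'I_n => if (q.1 \in Lam) && src q.1 q.2 then Some (0, 0, None)%N else None].

Section Spec.
Variables (l : seq (edge n)) (src : 'I_n -> 'I_n -> bool).
Hypothesis l_pos : forall e, e \in l -> (0 < e.2)%N.
Hypothesis eta_gt0 : 0 < eta.

Definition list_graph : mgraph n := fun a b w => ((a, b, w) \in l) || ((b, a, w) \in l).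

Definition restr (E : mgraph n) : mgraph n :=
  fun a b w => [&& a \in Lam, b \in Lam & E a b w].

Definition reaches x v (z : R) := exists x0 p,
  [/\ src x0 v, x0 \in Lam, walk (restr list_graph) x0 p x & pval eta p = z].

(** The last clause makes back pointers followable: the predecessor is still in the table, with a
    value smaller by at least that of the edge. As weights are positive, the hop count is at most
    the weight, and so fits into a word whenever the weight does. *)
Definition entry_ok T hi x v (e : entry n) := [/\ ((v < hi)%N /\ x \in Lam),
  entry_val e <= r, (e.1.2 <= e.1.1)%N, reaches x v (entry_val e)
  & if e.2 is Some (y, w) then list_graph y x w /\
      exists2 e0, T (y, v) = Some e0 & entry_val e0 + w%:R + eta <= entry_val e
    else src x v].

(** An upper bound for the entries that labels below [h] can ever occupy; if it fits into [cap],
    these labels survive every overflow (last clause of [explored]). *)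
Definition load (h : nat) : nat := #|[pred q : 'I_n * 'I_n | (q.2 < h)%N &&
  `[< exists2 z, z <= r & reaches q.1 q.2 z >] ]|.

Definition explored st := [/\ (st.2 <= n)%N,
  forall x v e, st.1 (x, v) = Some e -> entry_ok st.1 st.2 x v e,
  (table_size st.1 n <= cap)%N, forall x, (row_size st.1 x <= K)%N
  & forall h, (h <= n)%N -> (load h <= cap)%N -> (h <= st.2)%N].

Lemma list_graph_sym a b w : list_graph a b w = list_graph b a w.
Proof. by rewrite /list_graph orbC. Qed.

Lemma entry_val_ge0 e : 0 <= entry_val e.
Proof. by rewrite addr_ge0 // mulr_ge0 // ltW. Qed.

Lemma reaches_step x y v z w : reaches y v z -> list_graph y x w -> x \in Lam ->
  reaches x v (z + w%:R + eta).
Proof.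
move=> [x0 [p [sx xl wp <-]]] yx xL; exists x0, (p ++ [:: (x, w)]); split=> //.
  have yL : y \in Lam.
    case: (lastP p) wp => [|p' [y' w']]; first by rewrite walk_nil => /eqP <-.
    rewrite -cats1 walk_cat walk_cons walk_nil => /andP[_ /andP[/and3P[_ + _] /eqP <-]].
    by [].
  apply: walk_catP wp _.
  by rewrite walk_cons walk_nil eqxx andbT /restr yL xL.
by rewrite pval_cat pval_cons pval_nil; ring.
Qed.

Lemma shrinkP T hi : let st := shrink T hi in
  [/\ (st.2 <= hi)%N, (table_size st.1 n <= cap)%N
    & forall h, (h <= hi)%N -> (table_size T h <= cap)%N -> (h <= st.2)%N].
Proof.
rewrite /shrink /=; set h := (\max_(h < _ | _) h)%N.
have h0 : (table_size T (ord0 : 'I_hi.+1) <= cap)%N.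
  by rewrite /table_size eq_card0 // => q; rewrite !inE andbF.
have c0 : (0 < #|[pred h : 'I_hi.+1 | table_size T h <= cap]|)%N.
  by apply/card_gt0P; exists ord0.
have [h' h'P hE] := eq_bigmax_cond (fun h : 'I_hi.+1 => h : nat) c0.
have {}hE : h = h' by [].
split.
- by rewrite hE -ltnS.
- apply: leq_trans (_ : table_size T h <= _)%N; last by rewrite hE.
  apply/subset_leq_card/fintype.subsetP => q; rewrite !inE ffunE.
  by case: ifP => // qh /andP[-> _] /=.
- move=> k kh kc; exact: (@leq_bigmax_cond _ _ (fun h : 'I_hi.+1 => h : nat) (Ordinal (kh : (k < hi.+1)%N)) kc).
Qed.

Lemma cut_Some T h x v e : cut T h (x, v) = Some e <-> T (x, v) = Some e /\ (v < h)%N.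
Proof. by rewrite ffunE /=; case: ifP => vh; split=> // -[]. Qed.

Lemma row_size_cut T h x : (row_size (cut T h) x <= row_size T x)%N.
Proof.
apply/subset_leq_card/fintype.subsetP => v; rewrite !inE ffunE.
by case: ifP.
Qed.

Lemma put_Some T x v e x' v' e' : put T x v e (x', v') = Some e' ->
  (x' = x /\ v' = v /\ e' = e) \/ T (x', v') = Some e'.
Proof. by rewrite ffunE; case: eqP => [[-> ->] [<-]|_ h]; [left|right]. Qed.

Lemma row_size_put T x v e y : improves T x v e -> (row_size T y <= K)%N ->
  (row_size (put T x v e) y <= K)%N.
Proof.
move=> /andP[_ im] rK; have [yx|yx] := eqVneq y x; last first.
  apply: leq_trans rK; apply/subset_leq_card/fintype.subsetP => u; rewrite !inE ffunE.
  by rewrite xpair_eqE (negbTE yx).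
rewrite {}yx in rK *.
have /subset_leq_card sub : [set u | isSome (put T x v e (x, u))]
    \subset v |: [set u | isSome (T (x, u))].
  apply/fintype.subsetP => u; rewrite !inE ffunE xpair_eqE eqxx /=.
  by case: eqP.
rewrite /row_size; apply: leq_trans sub _; rewrite cardsU1 inE.
by case Tv : (T (x, v)) im => [e'|] im.
Qed.

Definition full T x := (K <= row_size T x)%N.

(** The sense in which a table only gets better: surviving labels keep entries that are at least as
    good, and full rows stay full. *)
Definition le_st st st' := [/\ (st'.2 <= st.2)%N,
  forall x v e, (v < st'.2)%N -> st.1 (x, v) = Some e ->
     exists2 e', st'.1 (x, v) = Some e' & entry_val e' <= entry_val e
  & forall x, full st.1 x -> full st'.1 x].

Lemma le_st_refl st : le_st st st.
Proof. by split=> // x v e _ h; exists e. Qed.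

Lemma le_st_trans st2 st1 st3 : le_st st1 st2 -> le_st st2 st3 -> le_st st1 st3.
Proof.
move=> [h1 e1 f1] [h2 e2 f2]; split; first exact: leq_trans h2 h1.
  move=> x v e vh /(e1 _ _ _ (leq_trans vh h2))[e' /(e2 _ _ _ vh)[e'' ? ?] ?].
  by exists e'' => //; lra.
by move=> x /f1/f2.
Qed.

Lemma put_le T x v e x' v' e0 : improves T x v e -> T (x', v') = Some e0 ->
  exists2 e', put T x v e (x', v') = Some e' & entry_val e' <= entry_val e0.
Proof.
move=> /andP[_ im] Te; rewrite ffunE; case: eqP => [[xx vv]|_]; last by exists e0.
by exists e => //; move: im; rewrite -xx -vv Te => /ltW.
Qed.

Lemma table_size_max T h : (table_size T h <= n * n)%N.
Proof. by rewrite -[n in (_ <= n * _)%N]card_ord -[n in (_ <= _ * n)%N]card_ord -card_prod max_card. Qed.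

(** Either rows never fill up or the table never overflows. With both limits active an overflow
    could empty a full row and invalidate what it had blocked. *)
Hypothesis mode : (n < K)%N || (n * n <= cap)%N.

Lemma update_le o st : explored st -> le_st st (update o st).
Proof.
case: o => [[[y x] w] v] [hin ok sz rw ld] /=.
case e0E : (st.1 (y, v)) => [e0|]; last exact: le_st_refl.
case: ifP => im; last exact: le_st_refl.
set e := (_, _, _) in im *; set T' := put _ _ _ _.
have [s1 s2 s3] := shrinkP T' st.2.
split=> //.
  move=> x' v' e1 vh /(put_le im)[e2 e2E e21]; exists e2 => //.
  by apply/cut_Some; rewrite e2E.
move=> x' fx; case/orP: mode => [nK|capn].
  suff : (n < n)%N by rewrite ltnn.
  apply: leq_trans nK (leq_trans fx _).
  by rewrite -[n in (_ <= n)%N]card_ord max_card.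
have hE : (shrink T' st.2).2 = st.2.
  apply/eqP; rewrite eqn_leq s1 s3 //.
  exact: leq_trans (table_size_max _ _) capn.
apply: leq_trans fx _; apply/subset_leq_card/fintype.subsetP => u; rewrite !inE.
case e1E : (st.1 (x', u)) => [e1|] // _.
have [e2 e2E _] := put_le im e1E.
have -> // : (shrink T' st.2).1 (x', u) = Some e2.
apply/cut_Some; split=> //; rewrite -[X in (_ < X)%N]/((shrink T' st.2).2) hE.
by have [[]] := ok _ _ _ e1E.
Qed.

Lemma update_explored o st : (let: (y, x, w, _) := o in list_graph y x w) ->
  explored st -> explored (update o st).
Proof.
case: o => [[[y x] w] v] yx [hin ok sz rw ld] /=.
case e0E : (st.1 (y, v)) => [e0|]; last by split.
case: ifP => im; last by split.
set e := (_, _, _) in im *; set T' := put _ _ _ _.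
have [s1 s2 s3] := shrinkP T' st.2.
have /andP[/andP[xL er] _] := im.
have ee : entry_val e = entry_val e0 + w%:R + eta by rewrite /entry_val /= natrD -natr1; ring.
have [[vh yL] e0r he0 re0 pe0] := ok _ _ _ e0E.
have w0 : (0 < w)%N by case/orP: yx => /l_pos.
have re : reaches x v (entry_val e) by rewrite ee; apply: reaches_step re0 yx xL.
have okT' x' v' e' : T' (x', v') = Some e' ->
   [/\ ((v' < st.2)%N /\ x' \in Lam), entry_val e' <= r, (e'.1.2 <= e'.1.1)%N,
    reaches x' v' (entry_val e') & if e'.2 is Some (y', w') then list_graph y' x' w' /\
      exists2 e1, T' (y', v') = Some e1 & entry_val e1 + w'%:R + eta <= entry_val e'
    else src x' v'].
  case/put_Some => [[-> [-> ->]]|/ok[h1 h2 h3 h4 h5]].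
    split=> //; first by rewrite /=; lia.
    split=> //; have [e1 e1E e10] := put_le im e0E; exists e1 => //.
    by rewrite ee; lra.
  split=> //; case: e'.2 h5 => [[y' w'] [yw [e1 e1E e10]]|//].
  split=> //; have [e2 e2E e21] := put_le im e1E; exists e2 => //; lra.
split.
- exact: leq_trans s1 hin.
- move=> x' v' e' /cut_Some[/okT'[[h0 h1] h2 h3 h4 h5] v'h]; split=> //.
  case: e'.2 h5 => [[y' w'] [yw [e1 e1E e10]]|//]; split=> //.
  by exists e1 => //; apply/cut_Some.
- exact: s2.
- move=> x'; apply: leq_trans (row_size_cut _ _ _) _.
  exact: row_size_put im (rw x').
(* Every entry with label below [h] is counted by [load h], so these labels fit and the cut is not
   below [h]. *)
- move=> h hn lh; apply: s3; first exact: ld.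
  apply: leq_trans lh; apply/subset_leq_card/fintype.subsetP => -[x' v'].
  rewrite !inE /= => /andP[+ ->] /=; case e'E : (T' (x', v')) => [e'|] // _.
  by have [_ h2 _ h4 _] := okT' _ _ _ e'E; apply/asboolP; exists (entry_val e').
Qed.

(** The only other way in which a source may be missing at [x]: a full row on the way refused it. *)
Definition blocked T x (z : R) := exists y p,
  [/\ full T y, y \in Lam, walk (restr list_graph) y p x & pval eta p <= z].

Definition settled st x v (z : R) :=
  (exists2 e, st.1 (x, v) = Some e & entry_val e <= z) \/ blocked st.1 x z.

Definition complete (j : nat) st := forall v x0 p x, src x0 v -> x0 \in Lam ->
  walk (restr list_graph) x0 p x -> (size p <= j)%N -> pval eta p <= r ->
  (v < st.2)%N -> settled st x v (pval eta p).

Lemma settled_le st st' x v z : le_st st st' -> (v < st'.2)%N ->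
  settled st x v z -> settled st' x v z.
Proof.
move=> [h1 e1 f1] vh [[e eE ez]|[y [p [fy yL wp pz]]]]; [left|right].
  by have [e' e'E e'e] := e1 _ _ _ vh eE; exists e' => //; lra.
by exists y, p; split=> //; apply: f1.
Qed.

Lemma blocked_step T y x w z : blocked T y z -> list_graph y x w -> y \in Lam ->
  x \in Lam -> blocked T x (z + w%:R + eta).
Proof.
move=> [y0 [p [fy yL wp pz]]] yx yL' xL; exists y0, (p ++ [:: (x, w)]); split=> //.
  by apply: walk_catP wp _; rewrite walk_cons walk_nil eqxx andbT /restr yL' xL.
by rewrite pval_cat pval_cons pval_nil; lra.
Qed.

(** If the update is refused, either [x] already has an entry at least as good, or its row is full
    and [x] blocks itself by the empty walk. *)
Lemma update_settles st y x w v z : explored st -> list_graph y x w ->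
  y \in Lam -> x \in Lam -> z + w%:R + eta <= r -> (v < (update (y, x, w, v) st).2)%N ->
  settled st y v z -> settled (update (y, x, w, v) st) x v (z + w%:R + eta).
Proof.
move=> ex yx yL xL zr vh [[e0 e0E e0z]|bl]; last first.
  apply: (settled_le (update_le _ ex) vh); right.
  exact: blocked_step bl yx yL xL.
move: vh; rewrite /= e0E; set e := (_, _, _).
have ee : entry_val e = entry_val e0 + w%:R + eta by rewrite /entry_val /= natrD -natr1; ring.
case: ifP => im vh.
  left; exists e; last by rewrite ee; lra.
  by apply/cut_Some; split=> //; rewrite ffunE eqxx.
move: im; rewrite /improves xL /= (_ : entry_val e <= r); last by rewrite ee; lra.
case e1E : (st.1 (x, v)) => [e1|] /= im.
  by left; exists e1 => //; move/negbT: im; rewrite -leNgt ee; lra.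
right; exists x, [::]; split=> //; first by rewrite /full leqNgt im.
  by rewrite walk_nil.
by rewrite pval_nil; have := entry_val_ge0 e; have := eta_gt0; rewrite ee; lra.
Qed.

Definition ops := flatten [seq updates_of e | e <- l].

Lemma relaxE st : foldl relax st l = foldl (fun st o => update o st) st ops.
Proof.
rewrite /ops foldl_flatten; elim: l st => //= e l' IH st; by rewrite IH.
Qed.

Lemma opsP y x w v : ((y, x, w, v) \in ops) = list_graph y x w.
Proof.
apply/flattenP/idP => [[us /mapP[e el ->]]|].
  case: e el => [[a b] c] el /flattenP[ts /mapP[v' _ ->]].
  by rewrite !inE => /orP[/eqP|/eqP] [-> -> -> _]; rewrite /list_graph el ?orbT.
case/orP => el.
  exists (updates_of (y, x, w)); first exact: map_f.
  apply/flattenP; exists [:: (y, x, w, v); (x, y, w, v)]; last by rewrite mem_head.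
  by apply/mapP; exists v; rewrite ?mem_enum.
exists (updates_of (x, y, w)); first exact: map_f.
apply/flattenP; exists [:: (x, y, w, v); (y, x, w, v)]; last by rewrite !inE eqxx orbT.
by apply/mapP; exists v; rewrite ?mem_enum.
Qed.

Lemma foldl_explored os st : {subset os <= ops} -> explored st ->
  explored (foldl (fun st o => update o st) st os)
  /\ le_st st (foldl (fun st o => update o st) st os).
Proof.
elim: os st => [|o os IH] st sub ex /=; first by split=> //; apply: le_st_refl.
have ex' : explored (update o st).
  apply: update_explored ex; have := sub o (mem_head _ _).
  by case: o {sub} => [[[y x] w] v]; rewrite opsP.
have [h1 h2] := IH _ (fun o' o's => sub o' (mem_behead (s := o :: os) o's)) ex'.
by split=> //; apply: le_st_trans h2; apply: update_le.
Qed.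

Lemma relax_list_explored l' st : {subset l' <= l} -> explored st ->
  explored (foldl relax st l').
Proof.
move=> sub ex; have -> : foldl relax st l' =
    foldl (fun st o => update o st) st (flatten [seq updates_of e | e <- l']).
  by rewrite foldl_flatten; elim: l' {ex sub} st => //= e l' IH st; rewrite IH.
apply: (proj1 (foldl_explored _ ex)) => o /flattenP[us /mapP[e el' ->] oe].
by apply/flattenP; exists (updates_of e) => //; apply: map_f; apply: sub.
Qed.

Lemma pass_explored st : explored st -> explored (foldl relax st l).
Proof. by move=> ex; rewrite relaxE; have [] := foldl_explored (st := st) (fun o h => h) ex. Qed.

(** The last edge of the walk is relaxed at some moment of the pass. Until then the state of its
    tail has only improved, the relaxation settles its head, and later updates keep it settled. *)
Lemma pass_complete j st : explored st -> complete j st -> complete j.+1 (foldl relax st l).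
Proof.
rewrite relaxE => ex cp v x0 p x sx x0L wp sp pr vh.
have [_ le_all] := foldl_explored (fun o h => h) ex.
have eta0 := eta_gt0.
case/lastP: p wp sp pr => [|p [x' w]] wp sp pr.
  apply: (settled_le le_all vh); apply: (cp v x0 [::] x sx x0L wp isT pr).
  by apply: leq_trans vh _; case: le_all.
move: wp; rewrite -cats1 walk_cat walk_cons walk_nil.
set y := last _ _ => /andP[wp /andP[/and3P[yL x'L yx] /eqP xx]].
rewrite -{}xx; move: sp; rewrite size_rcons ltnS => sp.
move: pr; rewrite -cats1 pval_cat pval_cons pval_nil addr0 addrA => pr.
have pr' : pval eta p <= r.
  by apply: le_trans pr; have : 0 <= (w%:R : R) by []; lra.
have in_ops : (y, x', w, v) \in ops by rewrite opsP.
have [l1 [l2 opsE]] : exists l1 l2, ops = l1 ++ (y, x', w, v) :: l2.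
  by case/path.splitPr: in_ops => l1 l2; exists l1, l2.
move: vh; rewrite opsE foldl_cat /=.
have [ex1 le1] := foldl_explored (st := st) (os := l1)
  (fun o h => eq_ind_r (fun s => o \in s) (etrans (mem_cat o _ _) (introT orP (or_introl h))) opsE) ex.
set st1 := foldl _ st l1 in ex1 le1 *.
have ex2 : explored (update (y, x', w, v) st1) by apply: update_explored ex1.
set st2 := update _ st1 in ex2 *.
have sub2 : {subset l2 <= ops}.
  by move=> o oo; rewrite opsE mem_cat inE oo !orbT.
have [_ le3] := foldl_explored sub2 ex2.
set st3 := foldl _ st2 l2 in le3 * => vh.
have vh2 : (v < st2.2)%N by apply: leq_trans vh _; case: le3.
have le2 : le_st st1 st2 by apply: update_le.
have vh1 : (v < st1.2)%N by apply: leq_trans vh2 _; case: le2.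
have vh0 : (v < st.2)%N by apply: leq_trans vh1 _; case: le1.
apply: (settled_le le3 vh).
apply: update_settles => //.
exact: settled_le le1 vh1 (cp v x0 p y sx x0L wp sp pr' vh0).
Qed.

Hypothesis src_fun : forall x v v', src x v -> src x v' -> v = v'.
Hypothesis cap_ge : (n <= cap)%N.
Hypothesis K_gt0 : (0 < K)%N.
Hypothesis r_ge0 : 0 <= r.

Lemma init_Some x v e : init src (x, v) = Some e ->
  [/\ x \in Lam, src x v & e = (0, 0, None)%N].
Proof. by rewrite ffunE /=; case: ifP => // /andP[xL sx] [<-]. Qed.

Lemma row_size_init x : (row_size (init src) x <= 1)%N.
Proof.
apply/card_le1P => v; rewrite !inE => vv u; rewrite !inE.
case eE : (init src (x, v)) vv => [e|] // _; have [_ sv _] := init_Some eE.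
apply/idP/eqP => [|->]; last by rewrite eE.
case e'E : (init src (x, u)) => [e'|] // _; have [_ su _] := init_Some e'E.
exact: src_fun su sv.
Qed.

Lemma table_size_rows T h : (table_size T h <= \sum_x row_size T x)%N.
Proof.
rewrite (eq_bigr (fun x => \sum_v (isSome (T (x, v)) : nat))%N); last first.
  move=> x _; rewrite /row_size -sum1_card big_mkcond /=.
  by apply: eq_bigr => v _; rewrite inE; case: (T _).
rewrite pair_big /= /table_size -sum1_card big_mkcond /=; apply: leq_sum => -[x v] _.
by rewrite inE /=; case: (T _) => //= e; case: ifP.
Qed.

Lemma init_explored : explored (init src, n).
Proof.
split=> //=.
- move=> x v e /init_Some[xL sx ->]; split=> //=.
  + by rewrite /entry_val /= mulr0 addr0.
  + exists x, [::]; split=> //; first by rewrite walk_nil.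
    by rewrite pval_nil /entry_val /= mulr0 addr0.
- apply: leq_trans (table_size_rows _ _) _; apply: leq_trans cap_ge.
  apply: leq_trans (_ : \sum_(x : 'I_n) 1 <= _)%N.
    by apply: leq_sum => x _; apply: row_size_init.
  by rewrite sum1_card card_ord.
- by move=> x; apply: leq_trans (row_size_init x) K_gt0.
Qed.

Lemma init_complete : complete 0 (init src, n).
Proof.
move=> v x0 [|//] x sx x0L; rewrite walk_nil => /eqP <- _ _ _; left.
exists (0, 0, None)%N; first by rewrite /= ffunE /= x0L sx.
by rewrite pval_nil /entry_val /= mulr0 addr0.
Qed.

Definition bf_run j : table n * nat := iter j (fun st => foldl relax st l) (init src, n).

Lemma run_explored j : explored (bf_run j).
Proof. by elim: j => [|j IH]; [apply: init_explored|apply: pass_explored]. Qed.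

Lemma run_complete j : complete j (bf_run j).
Proof.
elim: j => [|j IH]; first exact: init_complete.
exact: pass_complete (run_explored j) IH.
Qed.

(** A walk of value at most [r] has at most [r / eta <= j] edges, so [j] rounds settle it. *)
Lemma run_settled j v x0 p x : r <= eta * j%:R -> src x0 v -> x0 \in Lam ->
  walk (restr list_graph) x0 p x -> pval eta p <= r -> (v < (bf_run j).2)%N ->
  settled (bf_run j) x v (pval eta p).
Proof.
move=> rj sx x0L wp pr vh; apply: (run_complete sx x0L wp _ pr vh).
rewrite -(ler_nat R) -(ler_pM2l eta_gt0); apply: le_trans rj; apply: le_trans pr.
by rewrite /pval lerDr.
Qed.

Definition back_edges T v : mgraph n := fun a b w =>
  if T (a, v) is Some (_, Some (b', w')) then (b == b') && (w == w') else false.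

Lemma back_edges_sub st v a b w : explored st -> back_edges st.1 v a b w ->
  list_graph a b w.
Proof.
move=> [_ ok _ _ _]; rewrite /back_edges.
case eE : (st.1 (a, v)) => [[e [[b' w']|]]|] // /andP[/eqP -> /eqP ->].
by have [_ _ _ _ [+ _]] := ok _ _ _ eE; rewrite list_graph_sym.
Qed.

(** Each back pointer lowers the value by at least [eta > 0], so following them stops, necessarily
    at a source. *)
Lemma back_walk st x v e : explored st -> st.1 (x, v) = Some e ->
  exists s p, [/\ src s v, walk (back_edges st.1 v) x p s & pval eta p <= entry_val e].
Proof.
move=> [hin ok _ _ _]; have eta0 := eta_gt0.
have [m] : exists m : nat, entry_val e <= eta * m%:R.
  exists (Num.truncn (entry_val e / eta)).+1.
  by rewrite mulrC -ler_pdivrMr // ltW // truncnS_gt.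
elim: m x e => [|m IH] x e em eE; have [_ _ _ _] := ok _ _ _ eE.
  case eb : e.2 => [[y w]|]; last first.
    by move=> sx; exists x, [::]; rewrite walk_nil pval_nil entry_val_ge0.
  move=> [_ [e0 _ le0]]; have := entry_val_ge0 e0; have : 0 <= (w%:R : R) by [].
  by move: em; rewrite mulr0; lra.
case eb : e.2 => [[y w]|]; last first.
  by move=> sx; exists x, [::]; rewrite walk_nil pval_nil entry_val_ge0.
move=> [yx [e0 e0E le0]]; have w0 : 0 <= (w%:R : R) by [].
have [] := IH y e0 _ e0E; first by move: em; rewrite -natr1; lra.
move=> s [p [ss wp pe]]; exists s, ((y, w) :: p); split=> //.
  rewrite walk_cons wp andbT /back_edges eE.
  by case: e eb {em eE le0} => e1 e2 /= ->; rewrite !eqxx.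
by rewrite pval_cons; lra.
Qed.

End Spec.
End Explore.

(** * One level: covering, interconnection, choice of centers *)

Section Level.
Variables (R : realType) (n : nat) (l : seq (edge n)) (A : {set 'I_n}).
Variables (eta delta : R) (K cap J k : nat) (v0 : 'I_n) (pr : bool).
Implicit Types (T : table n) (B U Lam : {set 'I_n}) (x y u v s : 'I_n).
Implicit Types (st : table n * nat).
Hypothesis l_pos : forall e, e \in l -> (0 < e.2)%N.
Hypothesis eta_gt0 : 0 < eta.
Hypothesis delta_ge0 : 0 <= delta.
Hypothesis K_gt0 : (0 < K)%N.
Hypothesis cap_ge : (n <= cap)%N.
Hypothesis J_ge : 5 * delta <= eta * J%:R.
Let LG := list_graph l.

(** The edge gets the weight of an actual simple path read off the back pointers, so the stored path
    implements it exactly. By [new_edgeP] such a path exists whenever [(x, v)] has an entry, every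
    source labelled [v] lies in [tgt] and [x] does not; then the default [[::]] is not reached. *)
Definition new_edge T v x (tgt : {set 'I_n}) : pr_edge n :=
  let p := xget [::] [set p | [/\ is_path (back_edges T v) x p (last x (map fst p)),
      last x (map fst p) \in tgt
    & forall e, T (x, v) = Some e -> pval eta p <= entry_val eta e]]%classic in
  (k, (x, last x (map fst p), path_weight p), if pr then p else [::]).

Definition edge_ok (q : R) (x : pr_edge n) := [/\ scale_of x = k, (0 < (hedge x).2)%N
  & exists p, [/\ is_path LG (hedge x).1.1 p (hedge x).1.2,
      path_weight p = (hedge x).2, pval eta p <= q
    & hpath x = if pr then p else [::]]].

Lemma n_gt0 : (0 < n)%N.
Proof. exact: leq_ltn_trans (ltn_ord v0). Qed.

Lemma LG_pos x y w : LG x y w -> (0 < w)%N.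
Proof. by case/orP => /l_pos. Qed.

Lemma new_edgeP Lam r K' cap' src st T v x (tgt : {set 'I_n}) e :
  explored Lam eta r K' cap' l src st -> T = st.1 -> T (x, v) = Some e ->
  (forall s, src s v -> s \in tgt) -> x \notin tgt ->
  let a := new_edge T v x tgt in
  [/\ edge_ok (entry_val eta e) a, (hedge a).1.1 = x & (hedge a).1.2 \in tgt].
Proof.
move=> ex -> eE st_tgt xt; rewrite /new_edge; set P := (X in xget _ X).
have [] : P (xget [::] P).
  apply: xgetPex; have [s [p [ss wp pe]]] := back_walk eta_gt0 ex eE.
  have [p' [hp' sp' wp']] := walk_simple wp.
  have ls : last x (map fst p') = s by move: hp' => /and3P[_ _ /eqP].
  exists p'; split; rewrite ?ls //; first exact: st_tgt.
  move=> e'; rewrite eE => -[<-]; apply: le_trans pe.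
  by rewrite /pval lerD ?ler_nat // ler_wpM2l ?ler_nat // ltW.
move: (xget _ _) => p hp ht /(_ _ eE) pe.
have hp' : is_path LG x p (last x (map fst p)).
  move: hp; rewrite !is_path_walk => /andP[wp ->]; rewrite andbT.
  by apply: sub_walk wp => a b w; apply: back_edges_sub ex.
split=> //; split=> //=; last by exists p.
(* The empty path would end at [x], outside [tgt]; hence there is an edge and the weight is
   positive. *)
case: p hp' ht {hp pe} => [|[y w] p] /=; first by move=> _; rewrite (negbTE xt).
rewrite is_path_walk walk_cons path_weight_cons => /andP[/andP[/LG_pos w0 _] _] _.
by lia.
Qed.

Definition near B (q : R) x := exists b p, [/\ b \in B, walk LG b p x & pval eta p <= q].
(** The region to which the explorations from the centers are confined. *)
Definition far B := [set x | ~~ `[< near B (4 * delta) x >]].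
Definition vicinity x := [set v in A | `[< exists2 p, walk LG v p x & pval eta p <= delta >]].

Lemma restrT E a b w : restr [set: 'I_n] E a b w = E a b w.
Proof. by rewrite /restr !inE. Qed.

Lemma not_full T x : ~ full n.+1 T x.
Proof.
rewrite /full ltnNge => /negP; apply; rewrite -[n in (_ <= n)%N]card_ord.
exact: max_card.
Qed.

(** If a vertex of the walk were within [4 delta] of [B], following the rest of the walk would bring
    [x] within [4 delta + pval eta p] of [B]. *)
Lemma far_walk B v p x : walk LG v p x -> ~ near B (4 * delta + pval eta p) x ->
  v \in far B /\ walk (restr (far B) LG) v p x.
Proof.
have eta0 := ltW eta_gt0.
have far_pre u q y : walk LG u q y -> ~ near B (4 * delta + pval eta q) y -> u \in far B.
  move=> wq nn; rewrite inE; apply/asboolP => -[b [p' [bB wp' pp']]]; apply: nn.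
  exists b, (p' ++ q); split=> //; first exact: walk_catP wp' wq.
  by rewrite pval_cat lerD2r.
elim: p v => [|[y w] p IH] v wp nn.
  by split; [exact: far_pre wp nn|rewrite walk_nil -(walk_nil LG)].
have vf := far_pre _ _ _ wp nn.
move: wp; rewrite !walk_cons => /andP[vy wp].
have [] := IH y wp.
  move=> [b [p' [bB wp' pp']]]; apply: nn; exists b, p'; split=> //.
  by rewrite pval_cons; have : 0 <= (w%:R : R) by []; lra.
by move=> yf ->; split=> //; rewrite /restr vf yf vy.
Qed.

(** All of [B] shares the single label [v0]: only some nearby center of [B] is wanted, and the table
    has at most one entry per vertex. In [srcB] each center from label [a] on is its own source. *)
Definition src0 B x v := (v == v0) && (x \in B).
Definition srcB a x v := [&& x == v, v \in A & (a <= v)%N].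

Lemma src0_fun B x v v' : src0 B x v -> src0 B x v' -> v = v'.
Proof. by move=> /andP[/eqP -> _] /andP[/eqP -> _]. Qed.

Lemma srcB_fun a x v v' : srcB a x v -> srcB a x v' -> v = v'.
Proof. by move=> /andP[/eqP <- _] /andP[/eqP <- _]. Qed.

(** [run0] finds the vertices near [B]; [runB] lists the balls of one block of labels, limited by
    the table size only; [runA] serves the deterministic choice of centers and limits the rows
    only. *)
Definition run0 B j := bf_run [set: 'I_n] eta (5 * delta) n.+1 (n * n) l (src0 B) j.
Definition runB Lam a j := bf_run Lam eta delta n.+1 cap l (srcB a) j.
Definition runA j := bf_run [set: 'I_n] eta delta K (n * n) l (srcB 0) j.

Lemma delta5_ge0 : 0 <= 5 * delta. Proof. by rewrite mulr_ge0. Qed.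

Lemma nn_ge : (n <= n * n)%N. Proof. by rewrite leq_pmulr // n_gt0. Qed.

Lemma run0_explored B j : explored [set: 'I_n] eta (5 * delta) n.+1 (n * n) l (src0 B) (run0 B j).
Proof.
apply: run_explored => //.
- by rewrite ltnSn.
- exact: src0_fun.
- exact: nn_ge.
- exact: delta5_ge0.
Qed.

Lemma runB_explored Lam a j : explored Lam eta delta n.+1 cap l (srcB a) (runB Lam a j).
Proof. by apply: run_explored => //; [rewrite ltnSn|exact: srcB_fun]. Qed.

Lemma runA_explored j : explored [set: 'I_n] eta delta K (n * n) l (srcB 0) (runA j).
Proof. by apply: run_explored => //; [rewrite leqnn orbT|exact: srcB_fun|exact: nn_ge]. Qed.

Lemma load_max Lam r src h : (load Lam eta r l src h <= n * n)%N.
Proof. by rewrite -[n in (_ <= n * _)%N]card_ord -[n in (_ <= _ * n)%N]card_ord -card_prod max_card. Qed.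

Lemma run0_hi B j : (run0 B j).2 = n.
Proof.
have [h1 _ _ _ h2] := run0_explored B j.
by apply/eqP; rewrite eqn_leq h1 h2 // load_max.
Qed.

Lemma runA_hi j : (runA j).2 = n.
Proof.
have [h1 _ _ _ h2] := runA_explored j.
by apply/eqP; rewrite eqn_leq h1 h2 // load_max.
Qed.

Lemma run0_near B q x : q <= 5 * delta ->
  (exists2 e, (run0 B J).1 (x, v0) = Some e & entry_val eta e <= q) <-> near B q x.
Proof.
move=> q5; split.
  move=> [e eE eq]; have [_ ok _ _ _] := run0_explored B J.
  have [_ _ _ [b [p [/andP[_ bB] _ wp pe]]] _] := ok _ _ _ eE.
  exists b, p; split=> //; last by rewrite pe.
  by apply: sub_walk wp => a c w; rewrite restrT.
move=> [b [p [bB wp pq]]].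
have [] // := @run_settled R n [set: 'I_n] eta (5 * delta) n.+1 (n * n) l (src0 B) l_pos eta_gt0 _ (@src0_fun B) nn_ge isT delta5_ge0 J v0 b p x J_ge.
- by rewrite leqnn.
- by rewrite /src0 eqxx.
- by rewrite inE.
- by apply: sub_walk wp => a c w; rewrite restrT.
- exact: le_trans pq q5.
- by rewrite run0_hi.
- by move=> [e eE ep]; exists e => //; apply: le_trans pq.
- by move=> [y [p' [/not_full]]].
Qed.

Definition live st := [set x | if st.1 (x, v0) is Some e then 4 * delta < entry_val eta e else true].
Definition unc st := [set x in A | ~~ isSome (st.1 (x, v0))].

Lemma live_far B : live (run0 B J) = far B.
Proof.
have d0 := delta_ge0.
apply/setP => x; rewrite !inE.
have h4 : 4 * delta <= 5 * delta by lra.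
apply/idP/idP => [h|/asboolP h].
  apply/asboolP => /(run0_near B x h4)[e eE]; move: h; rewrite eE.
  by move=> /lt_le_trans h /h; rewrite ltxx.
case eE : ((run0 B J).1 (x, v0)) => [e|] //; rewrite ltNge; apply/negP => he.
by apply: h; apply/(run0_near B x h4); exists e.
Qed.

Lemma uncP B x : reflect (x \in A /\ ~ near B (5 * delta) x) (x \in unc (run0 B J)).
Proof.
rewrite inE; apply: (iffP andP) => -[xA h]; split=> //.
  by move=> /(run0_near B x (lexx _))[e eE _]; move: h; rewrite eE.
case eE : ((run0 B J).1 (x, v0)) => [e|] //; case: h.
apply/(run0_near B x (lexx _)); exists e => //.
by have [_ ok _ _ _] := run0_explored B J; have [] := ok _ _ _ eE.
Qed.

Definition cov_edges st B : seq (pr_edge n) :=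
  [seq new_edge st.1 v0 x B | x <- enum [set x in A :\: B | isSome (st.1 (x, v0))]].

Lemma cov_edges_ok B : {in cov_edges (run0 B J) B, forall a, edge_ok (5 * delta) a}.
Proof.
move=> a /mapP[x]; rewrite mem_enum !inE => /andP[/andP[xB xA]].
case eE : ((run0 B J).1 (x, v0)) => [e|] // _ ->.
have ex := run0_explored B J.
have [[h1 h2 [p [h3 h4 h5 h6]]] _ _] := new_edgeP ex erefl eE (fun s ss => proj2 (andP ss)) xB.
split=> //; exists p; split=> //; apply: le_trans h5 _.
by have [_ ok _ _ _] := ex; have [] := ok _ _ _ eE.
Qed.

Lemma size_cov_edges st B : (size (cov_edges st B) <= #|A|)%N.
Proof.
rewrite size_map -cardE; apply/subset_leq_card/fintype.subsetP => x.
by rewrite !inE => /andP[/andP[]].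
Qed.

Lemma cov_edgesP B x : x \in A -> x \notin B -> x \notin unc (run0 B J) ->
  exists2 a, a \in cov_edges (run0 B J) B & (hedge a).1.1 = x /\ (hedge a).1.2 \in B.
Proof.
move=> xA xB; rewrite inE xA /= negbK => xT.
case eE : ((run0 B J).1 (x, v0)) (xT) => [e|] // _.
have [_ h1 h2] := new_edgeP (run0_explored B J) erefl eE (fun s ss => proj2 (andP ss)) xB.
exists (new_edge (run0 B J).1 v0 x B) => //.
by apply: map_f; rewrite mem_enum !inE xB xA xT.
Qed.

Definition pair_edges st U : seq (pr_edge n) :=
  [seq new_edge st.1 q.2 q.1 [set q.2] |
    q <- enum [pred q : 'I_n * 'I_n | [&& q.1 \in U, q.1 != q.2 & isSome (st.1 (q.1, q.2))]]].

Lemma pair_edges_ok Lam a U : {in pair_edges (runB Lam a J) U, forall b, edge_ok (5 * delta) b}.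
Proof.
move=> b /mapP[[u v]]; rewrite mem_enum !inE /= => /and3P[uU uv].
case eE : ((runB Lam a J).1 (u, v)) => [e|] // _ ->.
have ex := runB_explored Lam a J.
have [[h1 h2 [p [h3 h4 h5 h6]]] _ _] := new_edgeP ex erefl eE
  (tgt := [set v]) (fun s ss => introT set1P (eqP (proj1 (andP ss)))) (introN set1P (elimN eqP uv)).
split=> //; exists p; split=> //; apply: le_trans h5 _.
have d0 := delta_ge0.
by have [_ ok _ _ _] := ex; have [_ + _ _ _] := ok _ _ _ eE; lra.
Qed.

Lemma runB_ball Lam a u v e : (runB Lam a J).1 (u, v) = Some e ->
  [/\ v \in vicinity u, (a <= v < (runB Lam a J).2)%N & u \in Lam].
Proof.
move=> eE; have [_ ok _ _ _] := runB_explored Lam a J.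
have [[vh uL] er _ [b [p [/and3P[/eqP -> vA av] bL wp pe]]] _] := ok _ _ _ eE.
split; rewrite ?av //; rewrite inE vA; apply/asboolP; exists p; last by rewrite pe.
by apply: sub_walk wp => x y w /and3P[].
Qed.

Lemma runB_settled Lam a v p u : v \in A -> (a <= v < (runB Lam a J).2)%N ->
  v \in Lam -> walk (restr Lam LG) v p u -> pval eta p <= delta ->
  exists2 e, (runB Lam a J).1 (u, v) = Some e & entry_val eta e <= pval eta p.
Proof.
move=> vA /andP[av vh] vL wp pd.
have rj : delta <= eta * J%:R by have := J_ge; have := delta_ge0; lra.
have [] // := @run_settled R n Lam eta delta n.+1 cap l (srcB a) l_pos eta_gt0 _ (@srcB_fun a) cap_ge isT delta_ge0 J v v p u rj.
- by rewrite leqnn.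
- by rewrite /srcB eqxx vA av.
- by move=> [y [p' [/not_full]]].
Qed.

(* The part of the balls which the runs starting from [a] have to cover. *)
Definition ball_load (W : {set 'I_n}) (h : nat) : nat :=
  (\sum_(u in W) #|[set v in vicinity u | (v < h)%N]|)%N.

Lemma ball_load_le W h h' : (h <= h')%N -> (ball_load W h <= ball_load W h')%N.
Proof.
move=> hh; apply: leq_sum => u _; apply/subset_leq_card/fintype.subsetP => v.
by rewrite [in X in X -> _]inE [in X in _ -> X]inE => /andP[-> /= vh]; exact: leq_trans vh hh.
Qed.

Lemma ball_load_step W h : (ball_load W h.+1 <= ball_load W h + n)%N.
Proof.
apply: (@leq_trans (\sum_(u in W) (#|[set v in vicinity u | (v < h)%N]| + 1))%N).
  apply: leq_sum => u _.
  have [hn|hn] := ltnP h n; last first.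
    apply: leq_trans (leq_addr _ _); apply/subset_leq_card/fintype.subsetP => v.
    rewrite [in X in X -> _]inE [in X in _ -> X]inE => /andP[-> _] /=.
    exact: leq_trans (ltn_ord v) hn.
  have /subset_leq_card sub : [set v in vicinity u | (v < h.+1)%N] \subset
      Ordinal hn |: [set v in vicinity u | (v < h)%N].
    apply/fintype.subsetP => v; rewrite [in X in X -> _]inE in_setU1 [X in _ || X]inE.
    move=> /andP[-> /=]; rewrite ltnS leq_eqVlt => /orP[/eqP vh|->]; last by rewrite orbT.
    by apply/orP; left; apply/eqP/val_inj.
  apply: leq_trans sub _; rewrite cardsU1 addnC leq_add2l.
  by case: (_ \notin _).
rewrite big_split /= leq_add2l sum1_card; apply: leq_trans (max_card _) _.
by rewrite card_ord.
Qed.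

Definition ring_load (W : {set 'I_n}) (a h : nat) : nat :=
  (\sum_(u in W) #|[set v in vicinity u | (a <= v < h)%N]|)%N.

Lemma ball_load_split W a h : (a <= h)%N ->
  ball_load W h = (ball_load W a + ring_load W a h)%N.
Proof.
move=> ah; rewrite /ball_load /ring_load -big_split /=; apply: eq_bigr => u _.
rewrite -[LHS](cardsID [set v : 'I_n | (v < a)%N]); congr (_ + _)%N.
  by apply: eq_card => v; rewrite !inE; case: (v \in A) => //=; case: `[< _ >] => //=; lia.
by apply: eq_card => v; rewrite !inE -leqNgt andbCA.
Qed.

Lemma restr_walk_end Lam x p y : x \in Lam -> walk (restr Lam LG) x p y -> y \in Lam.
Proof.
elim: p x => [|[z w] p IH] x xL; first by rewrite walk_nil => /eqP <-.
by rewrite walk_cons => /andP[/and3P[_ zL _] /IH]; apply.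
Qed.

Lemma card_pairs (P : rel 'I_n) :
  #|[pred q : 'I_n * 'I_n | P q.1 q.2]| = (\sum_u #|[pred v | P u v]|)%N.
Proof.
rewrite -sum1_card big_mkcond /= -(pair_big xpredT xpredT (fun u v => if P u v then 1 else 0)%N) /=.
by apply: eq_bigr => u _; rewrite -sum1_card [RHS]big_mkcond; apply: eq_bigr => v _; rewrite inE.
Qed.

Lemma load_ring Lam a h : (load Lam eta delta l (srcB a) h <= ring_load Lam a h)%N.
Proof.
rewrite /load (card_pairs (fun x v => (v < h)%N &&
  `[< exists2 z, z <= delta & reaches Lam eta l (srcB a) x v z >])).
rewrite /ring_load [in X in (_ <= X)%N]big_mkcond /=; apply: leq_sum => x _.
have reach v : (exists2 z, z <= delta & reaches Lam eta l (srcB a) x v z) ->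
    [/\ x \in Lam, v \in vicinity x & (a <= v)%N].
  move=> [z zd [x0 [p [/and3P[/eqP -> vA av] vL wp pz]]]].
  split=> //; first exact: restr_walk_end vL wp.
  rewrite inE vA; apply/asboolP; exists p; last by rewrite pz.
  by apply: sub_walk wp => ? ? ? /and3P[].
case: ifP => xL.
  apply/subset_leq_card/fintype.subsetP => v; rewrite !inE => /andP[vh /asboolP/reach].
  by move=> [_ + av]; rewrite inE => ->; rewrite av vh.
rewrite eq_card0 // => v; rewrite !inE; apply/negP => /andP[_ /asboolP/reach[]].
by rewrite xL.
Qed.

(** If the block stops at [h < n], the load up to [h.+1] overflows [cap]. Label [h] accounts for at
    most [n] of it, so more than [cap - n] of the total ball load has been dealt with. *)
Lemma runB_progress Lam a (h := (runB Lam a J).2) : (a <= n)%N ->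
  [/\ (a <= h)%N, (h <= n)%N
    & h = n \/ (ball_load Lam a + cap < ball_load Lam h + n)%N].
Proof.
move=> an; have [hn _ _ _ hload] := runB_explored Lam a J.
rewrite -/h in hn hload.
have ah : (a <= h)%N.
  apply: hload => //; apply: leq_trans (load_ring _ _ _) _.
  rewrite /ring_load big1 // => u _; apply/eqP; rewrite cards_eq0; apply/eqP/setP => v.
  by rewrite inE [RHS]inE; apply/negP => /andP[_]; lia.
split=> //; move: hn; rewrite leq_eqVlt => /orP[/eqP|hn]; [by left|right].
have lt : (cap < load Lam eta delta l (srcB a) h.+1)%N.
  by rewrite ltnNge; apply/negP => /(hload _ hn); rewrite ltnn.
have := leq_trans lt (load_ring _ _ _).
have := ball_load_step Lam h; have := ball_load_split Lam (leq_trans ah (leqnSn h)).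
by lia.
Qed.

Lemma size_pair_edges Lam a U :
  (size (pair_edges (runB Lam a J) U) <= ring_load U a (runB Lam a J).2)%N.
Proof.
rewrite size_map -cardE; set st := runB _ _ _.
rewrite (card_pairs (fun u v => [&& u \in U, u != v & isSome (st.1 (u, v))])).
rewrite /ring_load [in X in (_ <= X)%N]big_mkcond /=; apply: leq_sum => u _.
case: ifP => uU; last by rewrite eq_card0.
apply/subset_leq_card/fintype.subsetP => v; rewrite !inE /=.
case eE : (st.1 (u, v)) => [e|]; last by rewrite andbF.
by move=> _; have [] := runB_ball eE; rewrite inE => -> /andP[-> ->].
Qed.

Lemma pair_edgesP Lam a U u v p : u \in U -> u != v -> v \in A ->
  (a <= v < (runB Lam a J).2)%N -> v \in Lam ->
  walk (restr Lam LG) v p u -> pval eta p <= delta ->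
  exists b, [/\ b \in pair_edges (runB Lam a J) U, (hedge b).1 = (u, v)
    & (hedge b).2%:R <= pval eta p].
Proof.
move=> uU uv vA avh vL wp pd.
have [e eE ep] := runB_settled vA avh vL wp pd.
have [[_ _ [q [_ qw qe _]]] h1 h2] := new_edgeP (runB_explored Lam a J) erefl eE
  (tgt := [set v]) (fun s ss => introT set1P (eqP (proj1 (andP ss)))) (introN set1P (elimN eqP uv)).
exists (new_edge (runB Lam a J).1 v u [set v]); split.
- apply/mapP; exists (u, v) => //; rewrite mem_enum inE /= uU uv.
  by move: eE => ->.
- by move/set1P: h2 => h2; rewrite -[in RHS]h2 -[in RHS]h1 -surjective_pairing.
- apply: le_trans ep; apply: le_trans qe; rewrite -qw /pval lerDl.
  by rewrite mulr_ge0 // ltW.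
Qed.

Lemma LG_sym a b w : LG a b w = LG b a w. Proof. exact: list_graph_sym. Qed.

Lemma walk_revP x p y : walk LG x p y ->
  exists q, walk LG y q x /\ pval eta q = pval eta p.
Proof. by move=> /(walk_rev LG_sym)[q [wq sq pq]]; exists q; rewrite /pval sq pq. Qed.

Definition list_of T x := [set v | isSome (T (x, v))].
(** Disjointness bounds the number of representatives by [#|A| / K]; maximality makes every full
    list meet a list of the packing. *)
Definition packing T (Y : {set 'I_n}) := [forall y in Y, (K <= row_size T y)%N] &&
  [forall y in Y, forall y' in Y, (y != y') ==> [disjoint list_of T y & list_of T y']].
Definition max_packing T : {set 'I_n} :=
  if [pick Y | maxset (packing T) Y] is Some Y then Y else finset.set0.
Definition rep T y := if [pick v in list_of T y] is Some v then v else y.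
Definition chosen T := [set rep T y | y in max_packing T].

Lemma max_packingP T : maxset (packing T) (max_packing T).
Proof.
rewrite /max_packing; case: pickP => // none.
have p0 : packing T finset.set0.
  by apply/andP; split; apply/forall_inP => y; rewrite inE.
by have [Y /=] := maxset_exists p0; rewrite none.
Qed.

Lemma runA_walk y v j : v \in list_of (runA j).1 y ->
  v \in A /\ exists2 p, walk LG v p y & pval eta p <= delta.
Proof.
rewrite inE; case eE : ((runA j).1 (y, v)) => [e|] // _.
have [_ ok _ _ _] := runA_explored j.
have [_ er _ [x0 [p [/and3P[/eqP -> vA _] _ wp pe]]] _] := ok _ _ _ eE.
split=> //; exists p; last by rewrite pe.
by apply: sub_walk wp => ? ? ? /and3P[].
Qed.

Lemma repP T y : (K <= row_size T y)%N -> rep T y \in list_of T y.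
Proof.
rewrite /rep; case: pickP => // none; rewrite /row_size eq_card0 ?leqn0 => [/eqP K0|v].
  by have := K_gt0; rewrite K0.
by have := none v.
Qed.

Let TA := (runA J).1.

Lemma chosen_sub : chosen TA \subset A.
Proof.
have /maxsetP[/andP[/forall_inP full _] _] := max_packingP TA.
by apply/fintype.subsetP => b /imsetP[y /full/repP/runA_walk[yA _] ->].
Qed.

(** Double counting: each packed vertex owns at least [K] centers, and no center belongs to two of
    them. *)
Lemma card_chosen : (#|chosen TA| * K <= #|A|)%N.
Proof.
have /maxsetP[/andP[/forall_inP full /forall_inP dis] _] := max_packingP TA.
apply: leq_trans (leq_mul (leq_imset_card _ _) (leqnn K)) _.
rewrite -sum_nat_const.
apply: leq_trans (_ : \sum_(y in max_packing TA) row_size TA y <= _)%N.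
  by apply: leq_sum => y /full.
rewrite /row_size (eq_bigr (fun y => \sum_(v in list_of TA y) 1)%N); last first.
  by move=> y _; rewrite sum1_card.
rewrite (exchange_big_dep (mem A)) /=; last first.
  by move=> y v _ /runA_walk[].
rewrite -[X in (_ <= X)%N]sum1_card; apply: leq_sum => v _; rewrite sum1_card.
apply/card_le1P => y; rewrite unfold_in => /andP[yY vy] y'; rewrite unfold_in [RHS]inE.
apply/andP/eqP => [[y'Y vy']|-> //]; apply/eqP; apply: contraT => yy'.
have /forall_inP/(_ y' y'Y)/implyP := dis _ yY; rewrite eq_sym => /(_ yy').
by move=> /pred0P/(_ v) /=; rewrite vy vy'.
Qed.

(** By maximality the list of the blocking vertex [y] shares a center [v] with the list of some
    packed [y']. The walk representative of [y'], [y'], [v], [y], [x] has four parts of value at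
    most [delta]; this is the origin of the radius [4 delta]. *)
Lemma blocked_near x : blocked [set: 'I_n] eta K l TA x delta -> near (chosen TA) (4 * delta) x.
Proof.
move=> [y [p [fy _ wp pd]]].
have /maxsetP[/andP[/forall_inP full /forall_inP dis] mx] := max_packingP TA.
have [y' [v [y'Y vy vy']]] : exists y' v, [/\ y' \in max_packing TA,
    v \in list_of TA y & v \in list_of TA y'].
  have [yY|yY] := boolP (y \in max_packing TA).
    by exists y, (rep TA y); rewrite !repP.
  apply: contrapT => nex; have yin : y \in max_packing TA.
    rewrite -(mx (y |: max_packing TA)) ?setU11 ?subsetU1 //.
    have dy z : z \in max_packing TA -> [disjoint list_of TA y & list_of TA z].
      move=> zY; apply/pred0P => v /=; apply/negP => /andP[vy vz].
      by apply: nex; exists z, v.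
    apply/andP; split.
      by apply/forall_inP => z; rewrite !inE => /orP[/eqP -> //|/full].
    apply/forall_inP => z; rewrite in_setU1 => zY; apply/forall_inP => z'.
    rewrite in_setU1 => z'Y; apply/implyP => zz'.
    case/orP: zY zz' => [/eqP ->|zY]; case/orP: z'Y => [/eqP ->|z'Y] zz'.
    - by rewrite eqxx in zz'.
    - exact: dy.
    - by rewrite disjoint_sym; apply: dy.
    - by have /forall_inP/(_ z' z'Y)/implyP := dis z zY; apply.
  by rewrite yin in yY.
have [_ [p1 wp1 pd1]] := runA_walk (repP (full _ y'Y)).
have [_ [p2 /walk_revP[q2 [wq2 pq2]] pd2]] := runA_walk vy'.
have [_ [p3 wp3 pd3]] := runA_walk vy.
exists (rep TA y'), (p1 ++ q2 ++ p3 ++ p); split.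
- exact: imset_f.
- apply: walk_catP wp1 _; apply: walk_catP wq2 _; apply: walk_catP wp3 _.
  by apply: sub_walk wp => ? ? ? /and3P[].
- by rewrite !pval_cat pq2; lra.
Qed.

(** Such an [x] is not blocked, so its row contains its whole vicinity; it is not full either, so
    the vicinity has fewer than [K] centers. *)
Lemma chosen_ball x : x \in far (chosen TA) -> (#|vicinity x| < K)%N.
Proof.
have d0 := delta_ge0.
rewrite inE => /asboolP nx.
have rj : delta <= eta * J%:R by have := J_ge; lra.
have nfx : ~ full K TA x.
  move=> fx; apply: nx; apply: blocked_near; exists x, [::].
  by split; rewrite ?walk_nil ?pval_nil ?inE.
apply: leq_ltn_trans (_ : (row_size TA x < K)%N); last first.
  by rewrite ltnNge; apply/negP.
apply/subset_leq_card/fintype.subsetP => v; rewrite inE => /andP[vA /asboolP[p wp pd]].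
rewrite inE.
have [] // := @run_settled R n [set: 'I_n] eta delta K (n * n) l (srcB 0) l_pos eta_gt0 _ (@srcB_fun 0) nn_ge K_gt0 delta_ge0 J v v p x rj.
- by rewrite leqnn orbT.
- by rewrite /srcB eqxx vA.
- by rewrite inE.
- by apply: sub_walk wp => ? ? ?; rewrite restrT.
- by rewrite runA_hi.
- by move=> [e eE _]; rewrite /TA eE.
move=> [y [q [fy yL wq pq]]]; case: nx; apply: blocked_near; exists y, q; split=> //.
exact: le_trans pd.
Qed.

End Level.

(** * Expectations taken coin by coin *)

Section Expectation.
Variables (R : realType) (C : finType) (law : C -> R).
Hypothesis law1 : \sum_c law c = 1.

Fixpoint expect_seq (N : nat) (f : seq C -> R) : R :=
  if N is N'.+1 then \sum_c law c * expect_seq N' (fun cs => f (c :: cs)) else f [::].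

Lemma eq_expect_seq N f g : (forall cs, size cs = N -> f cs = g cs) ->
  expect_seq N f = expect_seq N g.
Proof.
elim: N f g => [|N IH] f g fg /=; first exact: fg.
by apply: eq_bigr => c _; congr (_ * _); apply: IH => cs sc; apply: fg; rewrite /= sc.
Qed.

Lemma expect_seq_cst N a : expect_seq N (fun=> a) = a.
Proof. by elim: N => //= N IH; rewrite IH -mulr_suml law1 mul1r. Qed.

Lemma expect_seq_affine N (a b : R) g :
  expect_seq N (fun cs => a + b * g cs) = a + b * expect_seq N g.
Proof.
elim: N g => //= N IH g; rewrite mulr_sumr.
have aE : a = \sum_c law c * a by rewrite -mulr_suml law1 mul1r.
rewrite [in RHS]aE -big_split; apply: eq_bigr => c _ /=.
by rewrite IH mulrDr mulrCA.
Qed.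

Lemma expect_seqD a b f :
  expect_seq (a + b) f = expect_seq a (fun cs => expect_seq b (fun cs' => f (cs ++ cs'))).
Proof.
elim: a f => //= a IH f; apply: eq_bigr => c _; congr (_ * _); exact: IH.
Qed.

Lemma sum_tuple N (f : seq C -> R) :
  \sum_(o : N.-tuple C) (\prod_(c <- o) law c) * f o = expect_seq N f.
Proof.
elim: N f => [|N IH] f /=.
  rewrite (big_pred1 [tuple]) => [|u]; last by rewrite [u]tuple0; apply/esym/eqP.
  by rewrite big_nil mul1r.
pose h (q : C * N.-tuple C) : N.+1.-tuple C := [tuple of q.1 :: q.2].
rewrite (reindex h) /=; last first.
  exists (fun o : N.+1.-tuple C => (thead o, [tuple of behead o])).
    by case=> c o _; rewrite /h /= theadE; congr (_, _); apply: val_inj.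
  by move=> o _; rewrite /h /= -tuple_eta.
rewrite -(pair_big xpredT xpredT (fun c (o : N.-tuple C) =>
  (\prod_(i <- h (c, o)) law i) * f (h (c, o)))) /=.
apply: eq_bigr => c _; rewrite -IH mulr_sumr; apply: eq_bigr => o _.
by rewrite big_cons mulrA.
Qed.

End Expectation.

(** * Programs as streaming algorithms *)

Section Machine.
Variables (R : realType) (n : nat) (C : finType) (law : C -> R).
Hypothesis law_ge0 : forall c, 0 <= law c.
Hypothesis law1 : \sum_c law c = 1.
Variables (D : Type) (encS : nat * D -> memory n) (out : D -> memory n) (d0 : D).
Hypothesis encS_inj : injective encS.
Hypothesis encS_neq0 : forall q, encS q <> [::].

(** One instruction describes one pass; of its coins only the one drawn at the end-of-pass token is
    used. *)
Record instr := Instr { rd : D -> edge n -> D; fin : C -> D -> D }.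

Definition noop : instr := Instr (fun d _ => d) (fun _ d => d).

(** No code word is empty, so the empty initial memory decodes to the default, which is the starting
    state. *)
Definition decode (m : memory n) : nat * D :=
  if pselect (exists q, encS q = m) is left h then proj1_sig (cid h) else (0%N, d0).

Lemma encSK : cancel encS decode.
Proof.
move=> q; rewrite /decode; case: pselect => [h|[]]; last by exists q.
by case: cid => q' /= /encS_inj.
Qed.

Lemma decode_nil : decode [::] = (0%N, d0).
Proof. by rewrite /decode; case: pselect => // h; have [q hq] := h; have := encS_neq0 hq. Qed.

Variable prog : seq instr.

Definition machine_step (c : C) (m : memory n) (tok : option (edge n)) : memory n :=
  let: (pc, d) := decode m in
  let ins := nth noop prog pc in
  if tok is Some e then encS (pc, rd ins d e)
  else let d' := fin ins c d in
       if pc.+1 == size prog then out d' else encS (pc.+1, d').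

Definition machine : streaming_alg R n := StreamingAlg law_ge0 law1 machine_step.

Variable s : seq (edge n).

Definition pass_end (ins : instr) (c : C) (d : D) : D := fin ins c (foldl (rd ins) d s).

(** A weakest precondition for all coins; [Sz] is demanded at every moment of a pass, because the
    space bound concerns every intermediate memory. *)
Fixpoint wp (P : seq instr) (Sz Q : D -> Prop) (d : D) : Prop :=
  if P is ins :: P' then
    (forall s1 s2, s = s1 ++ s2 -> Sz (foldl (rd ins) d s1)) /\
    (forall c, wp P' Sz Q (pass_end ins c d))
  else Q d.

Lemma wp_cat P1 P2 Sz Q d : wp P1 Sz (wp P2 Sz Q) d -> wp (P1 ++ P2) Sz Q d.
Proof. by elim: P1 d => //= ins P1 IH d [h1 h2]; split=> // c; apply: IH. Qed.

Lemma wp_mono P Sz (Q Q' : D -> Prop) d : (forall d, Q d -> Q' d) -> wp P Sz Q d -> wp P Sz Q' d.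
Proof.
move=> QQ; elim: P d => [|ins P IH] d /=; first exact: QQ.
by move=> [h1 h2]; split=> // c; apply: IH.
Qed.

(** The coins drawn at the edges of a pass are skipped. *)
Fixpoint exec (P : seq instr) (d : D) (cs : seq C) : D :=
  if P is ins :: P' then
    if drop (size s) cs is c :: cs' then exec P' (pass_end ins c d) cs' else d
  else d.

Fixpoint mean (g : D -> R) (P : seq instr) (d : D) : R :=
  if P is ins :: P' then \sum_c law c * mean g P' (pass_end ins c d) else g d.

Lemma mean_exec (g : D -> R) P d :
  expect_seq law (size P * (size s).+1) (fun cs => g (exec P d cs)) = mean g P d.
Proof.
elim: P d => // ins P IH d.
rewrite (_ : _ * _ = size s + (size P * (size s).+1).+1)%N; last by rewrite /= mulSn addSnnS.
rewrite expect_seqD -[RHS](expect_seq_cst law1 (size s)); apply: eq_expect_seq => cs sc /=.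
apply: eq_bigr => c _; congr (_ * _); rewrite -IH; apply: eq_expect_seq => cs' _.
by rewrite drop_size_cat.
Qed.

Lemma mean_cat g P1 P2 d : mean g (P1 ++ P2) d = mean (mean g P2) P1 d.
Proof. by elim: P1 d => //= ins P1 IH d; apply: eq_bigr => c _; rewrite IH. Qed.

Lemma mean_le g P Sz Q d a : wp P Sz Q d -> (forall d, Q d -> g d <= a) -> mean g P d <= a.
Proof.
move=> + Qg; elim: P d => [|ins P IH] d /=; first exact: Qg.
move=> [_ h]; rewrite -[leRHS]mul1r -law1 mulr_suml.
by apply: ler_sum => c _; apply: ler_wpM2l => //; apply: IH.
Qed.

Variables (Sz Q : D -> Prop) (fail : D -> bool).
Hypothesis rd_fail : forall ins d e, List.In ins prog -> fail d -> fail (rd ins d e).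
Hypothesis fin_fail : forall ins d c, List.In ins prog -> fail d -> fail (fin ins c d).

Definition step_of (m : memory n) (ct : C * option (edge n)) := machine_step ct.1 m ct.2.

(** The failure flag is never reset, so its value in the final state [d] bounds it, and with it the
    space, at all earlier times. *)
Definition state_ok (d : D) (m : memory n) := exists pc d1,
  [/\ (pc < size prog)%N, m = encS (pc, d1), Sz d1 & fail d1 -> fail d].

Lemma machine_pass pc d s1 s2 cs : s = s1 ++ s2 -> (pc < size prog)%N -> size cs = size s2 ->
  let ins := nth noop prog pc in
  (forall s1 s2, s = s1 ++ s2 -> Sz (foldl (rd ins) d s1)) ->
  let ms := scanl step_of (encS (pc, foldl (rd ins) d s1)) (zip cs (map Some s2)) in
  foldl step_of (encS (pc, foldl (rd ins) d s1)) (zip cs (map Some s2)) = encS (pc, foldl (rd ins) d s) /\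
  (forall m, List.In m ms -> exists2 s', m = encS (pc, foldl (rd ins) d s') & exists s'', s = s' ++ s'').
Proof.
elim: s2 s1 cs => [|e s2 IH] s1 cs sE pcl scs ins hS /=.
  by case: cs scs => //= _; rewrite sE cats0.
case: cs scs => //= c cs [scs].
have -> : step_of (encS (pc, foldl (rd ins) d s1)) (c, Some e) =
    encS (pc, foldl (rd ins) d (rcons s1 e)).
  by rewrite /step_of /machine_step /= encSK foldl_rcons.
have sE' : s = rcons s1 e ++ s2 by rewrite cat_rcons.
have [h1 h2] := IH _ _ sE' pcl scs hS; split=> // m [<-|/h2//].
by exists (rcons s1 e) => //; exists s2.
Qed.

Lemma fail_mono_rd ins d s1 : List.In ins prog -> fail d -> fail (foldl (rd ins) d s1).
Proof. by move=> II; elim: s1 d => //= e s1 IH d fd; apply/IH/rd_fail. Qed.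

Lemma fail_mono P d cs : (forall ins, List.In ins P -> List.In ins prog) ->
  fail d -> fail (exec P d cs).
Proof.
elim: P d cs => //= ins P IH d cs sub fd; case: (drop _ _) => // c cs'.
apply: IH => [J JP|]; first by apply: sub; right.
by apply: fin_fail; [apply: sub; left|apply: fail_mono_rd => //; apply: sub; left].
Qed.

Lemma machine_exec P pc d cs : wp P Sz Q d -> (0 < size P)%N -> drop pc prog = P ->
  size cs = (size P * (size s).+1)%N ->
  let ms := scanl step_of (encS (pc, d)) (zip cs (tokens (size P) s)) in
  let d' := exec P d cs in
  [/\ Q d', foldl step_of (encS (pc, d)) (zip cs (tokens (size P) s)) = out d'
    & forall m, List.In m ms -> state_ok d' m \/ m = out d'].
Proof.
elim: P pc d cs => // ins P IH pc d cs [hS hP] _ dpc scs.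
have pcl : (pc < size prog)%N.
  by rewrite ltnNge; apply/negP => /drop_oversize; rewrite dpc.
have II : nth noop prog pc = ins by rewrite -[pc]addn0 -nth_drop dpc.
have subP J : List.In J (ins :: P) -> List.In J prog.
  rewrite -dpc => JP; rewrite -(cat_take_drop pc prog).
  elim: (take pc prog) => //= a t IHt; by right.
have -> : tokens (size (ins :: P)) s = map Some s ++ None :: tokens (size P) s.
  by rewrite /tokens /= -cats1 -catA.
have szs : (size s <= size cs)%N by rewrite scs /= mulSn; lia.
rewrite -(cat_take_drop (size s) cs) zip_cat; last by rewrite size_takel // size_map.
have [c [cs' dcs]] : exists c cs', drop (size s) cs = c :: cs'.
  case E : (drop (size s) cs) => [|c cs']; last by exists c, cs'.
  by have := size_drop (size s) cs; rewrite E scs /= mulSn; lia.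
rewrite dcs /= scanl_cat foldl_cat /=; set m1 := foldl _ (encS (pc, d)) _.
have := @machine_pass pc d [::] s (take (size s) cs) erefl pcl.
rewrite II size_takel // => /(_ erefl hS); rewrite /= -/m1 => -[m1E hms].
have scs' : size cs' = (size P * (size s).+1)%N.
  by have := size_drop (size s) cs; rewrite dcs scs /= mulSn; lia.
rewrite drop_size_cat ?size_takel //.
have stepE : step_of m1 (c, None) =
    if pc.+1 == size prog then out (pass_end ins c d) else encS (pc.+1, pass_end ins c d).
  by rewrite m1E /step_of /machine_step encSK II.
have dP : drop pc.+1 prog = P.
  by rewrite -addn1 addnC -drop_drop dpc /= drop0.
have okpre m d' : (fail (pass_end ins c d) -> fail d') ->
    List.In m (scanl step_of (encS (pc, d)) (zip (take (size s) cs) (map Some s))) -> state_ok d' m.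
  move=> fd /hms[s' -> [s'' ss]]; exists pc, (foldl (rd ins) d s'); split=> //.
    exact: hS ss.
  move=> fs; apply: fd; apply: fin_fail; first by apply: subP; left.
  by rewrite ss foldl_cat; apply: fail_mono_rd => //; apply: subP; left.
case: P IH hP dpc scs subP scs' dP => [|ins' P] IH hP dpc scs subP scs' dP.
  have e : pc.+1 == size prog.
    by apply/eqP; have := size_drop pc prog; rewrite dpc /=; lia.
  rewrite e in stepE; case: cs' scs' dcs => // _ dcs /=.
  split; first exact: hP.
    by rewrite stepE.
  move=> m /List.in_app_iff[/okpre h|[<-|//]]; [left; exact: h|by right].
have e : (pc.+1 == size prog) = false.
  by apply/eqP => e; have := size_drop pc prog; rewrite dpc /= -e; lia.
rewrite e in stepE.
have [] := IH pc.+1 (pass_end ins c d) cs' (hP c) isT dP scs'.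
move=> h1 h2 h3; split=> //.
  by rewrite stepE.
move=> m /List.in_app_iff[/okpre h|[<-|]].
- by left; apply: h; apply: fail_mono => J JP; apply: subP; right.
- left; rewrite stepE; exists pc.+1, (pass_end ins c d); split=> //.
  + by have := size_drop pc.+1 prog; rewrite dP /=; lia.
  + by have [+ _] := hP c => /(_ [::] s erefl).
  + by apply: fail_mono => J JP; apply: subP; right.
- by rewrite stepE => /h3.
Qed.

Lemma size_tokens p : size (tokens p s) = (p * (size s).+1)%N.
Proof.
rewrite /tokens; elim: p => //= m IH.
by rewrite size_cat IH size_rcons size_map mulSn.
Qed.

Lemma foldl_scanl_last T U (f : T -> U -> T) x us : last x (scanl f x us) = foldl f x us.
Proof. by elim: us x => //= u us IH x; rewrite IH. Qed.

Lemma machine_init cs : (0 < size cs)%N ->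
  scanl step_of [::] (zip cs (tokens (size prog) s)) =
  scanl step_of (encS (0%N, d0)) (zip cs (tokens (size prog) s)).
Proof.
move=> _; case: (zip _ _) => //= [[c tok]] cts.
by rewrite (_ : step_of [::] (c, tok) = step_of (encS (0%N, d0)) (c, tok)) // /step_of /machine_step encSK decode_nil.
Qed.

Variables (small big : nat) (fits : word n -> bool).
Hypothesis prog_gt0 : (0 < size prog)%N.
Hypothesis Sz_enc : forall pc d, (pc < size prog)%N -> Sz d ->
  (size (encS (pc, d)) <= small + big * fail d)%N /\ all fits (encS (pc, d)).
Hypothesis Q_out : forall d, Q d -> (size (out d) <= small)%N /\ all fits (out d).
Hypothesis prog_wp : wp prog Sz Q d0.

Lemma machine_outcome (o : outcome machine (size prog) s) :
  let d := exec prog d0 (val o) in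
  [/\ Q d, final_memory o = out d, all (all fits) (run o)
    & (peak_space o <= small + big * fail d)%N].
Proof.
set d := exec _ _ _.
have sto : size (val o) = (size prog * (size s).+1)%N.
  by rewrite size_tuple size_tokens.
have so : (0 < size (val o))%N by rewrite sto muln_gt0 prog_gt0.
have runE : run o = scanl step_of [::] (zip (val o) (tokens (size prog) s)) by [].
rewrite machine_init // in runE.
have [Qd fE ms] := machine_exec prog_wp prog_gt0 (drop0 _) sto.
have zn : zip (val o) (tokens (size prog) s) <> [::].
  move=> z; have := size_zip (val o) (tokens (size prog) s); rewrite z sto size_tokens minnn /= => e.
  by rewrite sto -e in so.
have fin : final_memory o = out d.
  rewrite /final_memory runE -/d -fE -foldl_scanl_last.
  by case: (zip _ _) zn.
have msP m : List.In m (run o) -> (size m <= small + big * fail d)%N /\ all fits m.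
  rewrite runE => /ms[[pc [d1 [pcl -> Sd fd]]]|->].
    have [h1 h2] := Sz_enc pcl Sd; split=> //; apply: leq_trans h1 _.
    by rewrite leq_add2l leq_mul2l; case: (fail d1) fd => [->//|]; rewrite orbT.
  by have [h1 h2] := Q_out Qd; split=> //; apply: leq_trans h1 (leq_addr _ _).
split=> //.
  move: msP; elim: (run o) => //= m ms' IH h.
  by rewrite (proj2 (h m (or_introl erefl))) IH // => m' h'; apply: h; right.
rewrite /peak_space; move: msP; elim: (run o) => [|m ms' IH] h; first by rewrite big_nil.
rewrite big_cons geq_max (proj1 (h m (or_introl erefl))) /=.
by apply: IH => m' h'; apply: h; right.
Qed.

(** The larger space bound is charged only to the runs that end with the failure flag set. *)
Lemma machine_peak :
  expect (@peak_space R n machine (size prog) s) <=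
  small%:R + big%:R * mean (fun d => (fail d)%:R) prog d0.
Proof.
have sz : size (tokens (size prog) s) = (size prog * (size s).+1)%N.
  exact: size_tokens.
rewrite /expect; apply: (@le_trans _ _ (\sum_(o : outcome machine (size prog) s)
    (\prod_(c <- o) law c) * (small%:R + big%:R * (fail (exec prog d0 (val o)))%:R))).
  apply: ler_sum => o _; apply: ler_wpM2l.
    by apply: prodr_ge0 => c _; apply: law_ge0.
  have [_ _ _] := machine_outcome o.
  by rewrite -(ler_nat R) natrD natrM.
have := sum_tuple law (size (tokens (size prog) s))
  (fun cs => small%:R + big%:R * (fail (exec prog d0 cs))%:R).
move=> ->; rewrite -(mean_exec (fun d => (fail d)%:R)) -sz.
by rewrite expect_seq_affine.
Qed.

End Machine.

(** * Encoding the state in words *)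

Section Bits.
Local Open Scope nat_scope.

(** Counters are stored bit by bit: a word may only hold numbers up to [2 * L], which the program
    counter and the labels may exceed. *)
Fixpoint bits_rec (f m : nat) : seq bool :=
  if f is f'.+1 then if m == 0 then [::] else odd m :: bits_rec f' m./2 else [::].

Definition bits m := bits_rec m m.

Lemma bits_recK f m : m <= f -> foldr (fun (b : bool) a => b + a.*2) 0 (bits_rec f m) = m.
Proof.
elim: f m => [|f IH] m /=; first by rewrite leqn0 => /eqP.
case: eqP => [-> //|/eqP m0 mf] /=; rewrite IH ?odd_double_half //.
by rewrite -leq_double; have := odd_double_half m; case: (odd m); lia.
Qed.

Lemma bits_inj : injective bits.
Proof. by move=> a b e; rewrite -(bits_recK (leqnn a)) -(bits_recK (leqnn b)) -!/(bits _) e. Qed.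

Lemma size_bits_rec f m k : m < 2 ^ k -> size (bits_rec f m) <= k.
Proof.
elim: f m k => [|f IH] m k //= mk.
have [//|m0] := eqVneq m 0; case: k mk => [|k].
  by rewrite expn0 ltnS leqn0 (negbTE m0).
move=> mk; rewrite /= ltnS; apply: IH; rewrite expnS in mk.
by have := odd_double_half m; lia.
Qed.

Lemma size_bits k m : m < 2 ^ k -> size (bits m) <= k.
Proof. exact: size_bits_rec. Qed.

End Bits.

Section Encoding.
Variable n : nat.
Local Open Scope nat_scope.
Implicit Types (X Y : Type).

(** Self-delimiting codes can be concatenated and still be decoded, which makes [enc_data]
    injective. *)
Definition prefix_free X (f : X -> memory n) :=
  forall x y s t, f x ++ s = f y ++ t -> x = y /\ s = t.

(** [Weight 1] announces a further element and [Weight 0] ends the list. *)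
Definition enc_seq X (f : X -> memory n) (xs : seq X) : memory n :=
  flatten [seq Weight 1 :: f x | x <- xs] ++ [:: Weight 0].

Definition enc_bool (b : bool) : memory n := [:: Weight (nat_of_bool b)].
Definition enc_nat (m : nat) : memory n := enc_seq enc_bool (bits m).
Definition enc_set (A : {set 'I_n}) : memory n := enc_seq (fun i => [:: Ident i]) (enum A).
Definition enc_path (p : seq ('I_n * nat)) : memory n :=
  enc_seq (fun y => [:: Ident y.1; Weight y.2]) p.
Definition enc_pr_edge (x : pr_edge n) : memory n :=
  Weight (scale_of x) :: words_of_edge (hedge x) ++ enc_path (hpath x).
Definition enc_entry (e : entry n) : memory n :=
  [:: Weight e.1.1; Weight e.1.2] ++
  (if e.2 is Some (y, w) then [:: Weight 1; Ident y; Weight w] else [:: Weight 0]).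
Definition entries (T : table n) : seq ('I_n * 'I_n * entry n) :=
  pmap (fun q => omap (pair q) (T q)) (enum {: 'I_n * 'I_n}).
Definition enc_table (T : table n) : memory n :=
  enc_seq (fun q => [:: Ident q.1.1; Ident q.1.2] ++ enc_entry q.2) (entries T).

(** [dH] is the hopset so far and [dE] the edges of the running trial. [dA] and [dB] are the current
    and the next centers, [dL] the region open to exploration, [dU] the uncovered centers, [da] the
    label at which the next block starts, [dS] the table with its label bound. The flags say that a
    trial is under way, that the level is finished, and that the fallback has been used. *)
Record data := Data {
  dH : seq (pr_edge n); dE : seq (pr_edge n);
  dA : {set 'I_n}; dB : {set 'I_n}; dL : {set 'I_n}; dU : {set 'I_n};
  da : nat; dS : table n * nat;
  dbusy : bool; dacc : bool; dfail : bool }.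

Definition enc_data (q : nat * data) : memory n :=
  let d := q.2 in
  enc_nat q.1 ++ enc_seq enc_pr_edge (dH d) ++ enc_seq enc_pr_edge (dE d) ++
  enc_set (dA d) ++ enc_set (dB d) ++ enc_set (dL d) ++ enc_set (dU d) ++
  enc_nat (da d) ++ enc_table (dS d).1 ++ enc_nat (dS d).2 ++
  enc_bool (dbusy d) ++ enc_bool (dacc d) ++ enc_bool (dfail d).

Lemma enc_seq_pf X (f : X -> memory n) : prefix_free f -> prefix_free (enc_seq f).
Proof.
move=> pf; elim=> [|x xs IH] [|y ys] s t; rewrite /enc_seq //=.
- by case.
- rewrite -!catA => -[/pf[-> e]].
  by have [-> ->] : xs = ys /\ s = t by apply: IH; rewrite /enc_seq -!catA.
Qed.

Lemma comp_pf X Y (g : X -> Y) (f : Y -> memory n) : injective g ->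
  prefix_free f -> prefix_free (f \o g).
Proof. by move=> gi pf x y s t /pf[/gi -> ->]. Qed.

Lemma enc_bool_pf : prefix_free enc_bool.
Proof. by move=> [] [] s t []. Qed.

Lemma enc_nat_pf : prefix_free enc_nat.
Proof. exact: comp_pf bits_inj (enc_seq_pf enc_bool_pf). Qed.

Lemma enc_set_pf : prefix_free enc_set.
Proof.
apply: (comp_pf (g := fun A : {set 'I_n} => enum A) (f := enc_seq _)).
  by move=> A B e; apply/setP => x; rewrite -mem_enum e mem_enum.
by apply: enc_seq_pf => x y s t [].
Qed.

Lemma enc_pr_edge_pf : prefix_free enc_pr_edge.
Proof.
move=> [[k [[u v] w]] p] [[k' [[u' v'] w']] p'] s t.
rewrite /enc_pr_edge /scale_of /hedge /hpath /= => -[-> -> -> ->] e.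
have pf : prefix_free enc_path by apply: enc_seq_pf => -[a b] [c d] s' t' [-> -> ->].
by have [-> ->] := pf _ _ _ _ e.
Qed.

Lemma enc_entry_pf : prefix_free enc_entry.
Proof.
move=> [[w h] q] [[w' h'] q'] s t; rewrite /enc_entry /=.
case: q => [[y c]|]; case: q' => [[y' c']|] //=.
  by case=> -> -> -> -> ->.
by case=> -> -> ->.
Qed.

Lemma entriesP T q e : ((q, e) \in entries T) = (T q == Some e).
Proof.
rewrite /entries mem_pmap; apply/mapP/eqP => [[q' _]|Tq].
  by case E : (T q') => [e'|] //= [-> ->].
by exists q; rewrite ?mem_enum // Tq.
Qed.

Lemma entries_inj : injective entries.
Proof.
move=> T T' e; apply/ffunP => q.
case E : (T q) => [a|]; first by apply/esym/eqP; rewrite -entriesP -e entriesP E.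
case E' : (T' q) => [a|] //.
have := entriesP T' q a; rewrite -e entriesP E E' eqxx.
by case: eqP.
Qed.

Lemma enc_table_pf : prefix_free enc_table.
Proof.
apply: (comp_pf entries_inj (f := enc_seq _)); apply: enc_seq_pf.
move=> [[a b] e] [[a' b'] e'] s t E.
have [-> ->] := congr1 (take 2) E.
have E2 : enc_entry e ++ s = enc_entry e' ++ t := congr1 (fun u => behead (behead u)) E.
by have [-> ->] := enc_entry_pf E2.
Qed.

Lemma enc_data_inj : injective enc_data.
Proof.
move=> [pc [H E A B L U a [T h] x y z]] [pc' [H' E' A' B' L' U' a' [T' h'] x' y' z']].
rewrite /enc_data /=.
have hpf := enc_seq_pf enc_pr_edge_pf.
move=> /enc_nat_pf[-> /hpf[-> /hpf[-> /enc_set_pf[-> /enc_set_pf[-> ]]]]].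
move=> /enc_set_pf[-> /enc_set_pf[-> /enc_nat_pf[-> /enc_table_pf[-> /enc_nat_pf[-> ]]]]].
by move=> /enc_bool_pf[-> /enc_bool_pf[-> ]]; case: z z' => [] [].
Qed.

Lemma enc_data_neq0 q : enc_data q <> [::].
Proof.
rewrite /enc_data /enc_nat {1}/enc_seq; move=> /(congr1 size).
by rewrite !size_cat /= !addn1 !addSn.
Qed.

Lemma size_enc_seq X (f : X -> memory n) c xs :
  (forall x, List.In x xs -> size (f x) <= c) -> size (enc_seq f xs) <= c.+1 * size xs + 1.
Proof.
rewrite /enc_seq size_cat /= leq_add2r => h.
elim: xs h => //= x xs IH h; rewrite size_cat mulnS -addSn; apply: leq_add.
  by rewrite ltnS; apply: h; left.
by apply: IH => y yx; apply: h; right.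
Qed.

Lemma enc_seq_all X (f : X -> memory n) (fits : pred (word n)) xs :
  fits (Weight 0) -> fits (Weight 1) -> (forall x, List.In x xs -> all fits (f x)) ->
  all fits (enc_seq f xs).
Proof.
move=> f0 f1 h; rewrite /enc_seq all_cat /= f0 /= andbT.
elim: xs h => //= x xs IH h; rewrite f1 /= all_cat h /=; last by left.
by apply: IH => y yx; apply: h; right.
Qed.

Lemma In_mem (X : eqType) (x : X) xs : List.In x xs -> x \in xs.
Proof. by elim: xs => //= y xs IH [->|/IH]; rewrite inE ?eqxx // => ->; rewrite orbT. Qed.

Lemma size_enc_nat k m : m < 2 ^ k -> size (enc_nat m) <= 2 * k + 1.
Proof.
move=> mk; apply: leq_trans (size_enc_seq (c := 1) _) _; first by [].
by rewrite leq_add2r leq_mul2l size_bits.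
Qed.

Lemma size_enc_nat_le m k : m <= k -> size (enc_nat m) <= 2 * k + 3.
Proof.
move=> mk; apply: leq_trans (size_enc_nat (k := k.+1) _) _; last lia.
by apply: leq_ltn_trans mk (ltn_trans (ltnSn k) _); apply: ltn_expl.
Qed.

Lemma size_enc_set A : size (enc_set A) <= 2 * n + 1.
Proof.
apply: leq_trans (size_enc_seq (c := 1) _) _; first by [].
rewrite leq_add2r leq_mul2l -cardE; apply: leq_trans (max_card _) _.
by rewrite card_ord.
Qed.

Lemma size_entries T : size (entries T) <= table_size T n.
Proof.
rewrite /entries size_pmap /table_size cardE -size_filter; apply: uniq_leq_size.
  by rewrite filter_uniq // enum_uniq.
move=> q; rewrite mem_filter mem_enum !inE ltn_ord andbT => /andP[+ _].
by case: (T q).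
Qed.


Lemma size_cat13 (a1 a2 a3 a4 a5 a6 a7 a8 a9 a10 a11 a12 a13 : memory n) : size (a1 ++ a2 ++ a3 ++ a4 ++ a5 ++ a6 ++ a7 ++ a8 ++ a9 ++ a10 ++ a11 ++ a12 ++ a13) = size a1 + size a2 + size a3 + size a4 + size a5 + size a6 + size a7 + size a8 + size a9 + size a10 + size a11 + size a12 + size a13.
Proof. by rewrite !size_cat !addnA. Qed.

Lemma all_cat13 (p : pred (word n)) (a1 a2 a3 a4 a5 a6 a7 a8 a9 a10 a11 a12 a13 : memory n) : all p a1 -> all p a2 -> all p a3 -> all p a4 -> all p a5 -> all p a6 -> all p a7 -> all p a8 -> all p a9 -> all p a10 -> all p a11 -> all p a12 -> all p a13 -> all p (a1 ++ a2 ++ a3 ++ a4 ++ a5 ++ a6 ++ a7 ++ a8 ++ a9 ++ a10 ++ a11 ++ a12 ++ a13).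
Proof. by rewrite !all_cat; do 13![move=> ->]. Qed.

Section Fits.
Variable L : nat.

Definition pr_fits (J : nat) (x : pr_edge n) : bool :=
  [&& scale_of x <= 2 * L, (hedge x).2 <= 2 * L, size (hpath x) <= J
    & all (fun y : 'I_n * nat => y.2 <= 2 * L) (hpath x)].

Definition entry_fits (e : entry n) : bool :=
  [&& e.1.1 <= 2 * L, e.1.2 <= 2 * L & if e.2 is Some (_, w) then w <= 2 * L else true].

Lemma size_enc_data pc d k J m t : pc < 2 ^ k ->
  (forall x, x \in dH d ++ dE d -> pr_fits J x) ->
  size (dH d) + size (dE d) <= m -> table_size (dS d).1 n <= t ->
  da d <= n -> (dS d).2 <= n ->
  size (enc_data (pc, d)) <= (3 * J + 6) * m + 8 * t + 12 * n + 2 * k + 17.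
Proof.
move=> pck fH sm st an hn; have b1 b : size (enc_bool b) = 1 by [].
rewrite /enc_data size_cat13 !b1 [fst _]/= [snd _]/=.
have ed xs : {subset xs <= dH d ++ dE d} ->
    size (enc_seq enc_pr_edge xs) <= (3 * J + 6) * size xs + 1.
  move=> sub; apply: leq_trans (size_enc_seq (c := 3 * J + 5) _) _; last by rewrite -[(_ + 5).+1]addnS.
  move=> x /In_mem/sub/fH/and4P[_ _ sJ _].
  have -> : size (enc_pr_edge x) = 4 + size (enc_path (hpath x)) by [].
  have := size_enc_seq (f := fun y : 'I_n * nat => [:: Ident y.1; Weight y.2]) (c := 2) (xs := hpath x) (fun _ _ => leqnn _).
  by rewrite -/(enc_path _); lia.
have hH : size (enc_seq enc_pr_edge (dH d)) <= (3 * J + 6) * size (dH d) + 1.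
  by apply: ed => x xH; rewrite mem_cat xH.
have hE : size (enc_seq enc_pr_edge (dE d)) <= (3 * J + 6) * size (dE d) + 1.
  by apply: ed => x xH; rewrite mem_cat xH orbT.
have hT : size (enc_table (dS d).1) <= 8 * t + 1.
  apply: leq_trans (size_enc_seq (c := 7) _) _.
    by move=> q _; rewrite /enc_entry /=; case: (q.2.2) => [[]|].
  by rewrite leq_add2r leq_mul2l; apply: leq_trans (size_entries _) st.
have := size_enc_set (dA d); have := size_enc_set (dB d).
have := size_enc_set (dL d); have := size_enc_set (dU d).
have := size_enc_nat pck; have := size_enc_nat_le an; have := size_enc_nat_le hn.
have : (3 * J + 6) * size (dH d) + (3 * J + 6) * size (dE d) <= (3 * J + 6) * m.
  by rewrite -mulnDr leq_mul2l sm orbT.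
by lia.
Qed.

Hypothesis L_gt0 : 0 < L.

Lemma words_path_fits p : all (fun y : 'I_n * nat => y.2 <= 2 * L) p ->
  all (word_fits L) (flatten [seq [:: Ident y.1; Weight y.2] | y <- p]).
Proof. by elim: p => //= y p IH /andP[yL /IH ->]; rewrite yL. Qed.

Lemma enc_bool_fits b : all (word_fits L) (enc_bool b).
Proof. by rewrite /enc_bool; case: b => /=; rewrite ?andbT //; lia. Qed.

Lemma enc_seq_fits X (f : X -> memory n) xs :
  (forall x, List.In x xs -> all (word_fits L) (f x)) -> all (word_fits L) (enc_seq f xs).
Proof. by apply: enc_seq_all => /=; lia. Qed.

Lemma enc_nat_fits m : all (word_fits L) (enc_nat m).
Proof. by apply: enc_seq_fits => b _; apply: enc_bool_fits. Qed.

Lemma enc_set_fits A : all (word_fits L) (enc_set A).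
Proof. by apply: enc_seq_fits. Qed.

Lemma enc_data_fits pc d J :
  (forall x, x \in dH d ++ dE d -> pr_fits J x) ->
  (forall q e, (dS d).1 q = Some e -> entry_fits e) ->
  all (word_fits L) (enc_data (pc, d)).
Proof.
move=> fH fT; rewrite /enc_data.
have ed xs : {subset xs <= dH d ++ dE d} -> all (word_fits L) (enc_seq enc_pr_edge xs).
  move=> sub; apply: enc_seq_fits => x /In_mem/sub/fH/and4P[h1 h2 _ h3].
  rewrite /enc_pr_edge /= h1 h2 /=; apply: enc_seq_fits => y /In_mem yp /=.
  by rewrite andbT; exact: (allP h3).
apply: all_cat13 (enc_nat_fits _) _ _ (enc_set_fits _) (enc_set_fits _) (enc_set_fits _) (enc_set_fits _) (enc_nat_fits _) _ (enc_nat_fits _) (enc_bool_fits _) (enc_bool_fits _) (enc_bool_fits _).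
- by apply: ed => x xH; rewrite mem_cat xH.
- by apply: ed => x xH; rewrite mem_cat xH orbT.
- apply: enc_seq_fits => -[q e] /In_mem; rewrite entriesP => /eqP/fT/and3P[h1 h2 h3].
  by rewrite /= h1 h2; case: (e.2) h3 => [[y w] /= ->|_] /=; lia.
Qed.

End Fits.
End Encoding.

(** * The program and its passes *)

Section Program.
Variables (R : realType) (n : nat) (C : finType).
Variables (v0 : 'I_n) (tau J : nat) (pr : bool).
Variables (delta eta : nat -> nat -> R) (Kf : nat -> nat) (smp : nat -> C -> 'I_n -> bool).
Implicit Types (d : data n) (B : {set 'I_n}).

(** The first scale of the group of [k]; explorations at scale [k] use hopset edges of smaller
    scales only. *)
Definition low (k : nat) : nat := (k %/ tau * tau)%N.

Definition low_edges (H : seq (pr_edge n)) (k : nat) : seq (edge n) :=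
  [seq hedge x | x <- H & (scale_of x < low k)%N].

Definition tbl0 : table n := [ffun => None].

Definition setS d st : data n :=
  Data (dH d) (dE d) (dA d) (dB d) (dL d) (dU d) (da d) st (dbusy d) (dacc d) (dfail d).

Definition idle d : data n :=
  Data (dH d) [::] (dA d) (dB d) (dL d) (dU d) (da d) (tbl0, 0%N) false (dacc d) (dfail d).

(** One Bellman-Ford round: edges of [G] are relaxed as they arrive, the stored hopset edges at the
    end of the pass. *)
Definition pass_instr (k : nat) (r et : R) (K cap : nat) : instr n C (data n) :=
  Instr (fun d e => setS d (relax (dL d) et r K cap (dS d) e))
    (fun _ d => setS d (foldl (relax (dL d) et r K cap) (dS d) (low_edges (dH d) k))).

Definition pure (f : C -> data n -> data n) : instr n C (data n) := Instr (fun d _ => d) f.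

Section LevelProgram.
Variables (k i : nat).
Let dl := delta k i.
Let et := eta k i.
Let K := Kf i.

(** One covering edge per center, and [32 * K] interconnecting edges per center on average. *)
Definition edge_bound (A : {set 'I_n}) : nat := (#|A| * (1 + 32 * K))%N.

Definition start B d : data n :=
  if (#|B| * K <= #|dA d|)%N then
    Data (dH d) [::] (dA d) B [set: 'I_n] (dU d) (da d)
      (init [set: 'I_n] (src0 v0 B), n) true (dacc d) (dfail d)
  else idle d.

Definition sample (c : C) d : data n :=
  if dacc d then d else start [set v in dA d | smp i c v] d.

Definition harvest0 d : data n :=
  if dbusy d then
    let Lam := live et dl v0 (dS d) in
    Data (dH d) (cov_edges (dA d) et k v0 pr (dS d) (dB d)) (dA d) (dB d) Lam
      (unc (dA d) v0 (dS d)) 0 (init Lam (srcB (dA d) 0), n) true (dacc d) (dfail d)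
  else d.

(** A trial that would exceed the edge budget is abandoned, so an accepted level meets the size
    bound in every run. *)
Definition harvestB d : data n :=
  if dbusy d then
    let E := dE d ++ pair_edges et k pr (dS d) (dU d) in
    let h := (dS d).2 in
    if (size E <= edge_bound (dA d))%N then
      Data (dH d) E (dA d) (dB d) (dL d) (dU d) h
        (init (dL d) (srcB (dA d) h), n) true (dacc d) (dfail d)
    else idle d
  else d.

Definition accept d : data n :=
  if dbusy d && (n <= da d)%N then
    Data (dH d ++ dE d) [::] (dA d) (dB d) (dL d) (dU d) (da d) (tbl0, 0%N) false true (dfail d)
  else idle d.

Definition det_init d : data n :=
  if dacc d then d else
    Data (dH d) [::] (dA d) (dB d) [set: 'I_n] (dU d) (da d)
      (init [set: 'I_n] (srcB (dA d) 0), n) true false true.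

Definition det_choose d : data n :=
  if dbusy d then start (chosen K (dS d).1) d else d.

Definition finish d : data n :=
  Data (dH d) (dE d) (dB d) (dB d) (dL d) (dU d) (da d) (dS d) (dbusy d) false (dfail d).

Definition block_prog (cap : nat) :=
  nseq J (pass_instr k dl et n.+1 cap) ++ [:: pure (fun _ => harvestB)].

Definition trial_prog (cap Z : nat) :=
  nseq J (pass_instr k (5 * dl) et n.+1 (n * n)) ++ pure (fun _ => harvest0) ::
  flatten (nseq Z (block_prog cap)) ++ [:: pure (fun _ => accept)].

(** With capacity [2 * n] every block deals with more than [n] of the ball load, so [16 * K] blocks
    exhaust a load of [16 * K * n]. *)
Definition random_prog := pure sample :: trial_prog (2 * n) (16 * K).

(** The fallback. Unless the level is already finished it sets the failure flag; its tables are
    larger, but a single block suffices. *)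
Definition det_prog := pure (fun _ => det_init) ::
  nseq J (pass_instr k dl et K (n * n)) ++ pure (fun _ => det_choose) ::
  trial_prog (n + n * K) 1.

Definition level_prog (trials : nat) :=
  flatten (nseq trials random_prog) ++ det_prog ++ [:: pure (fun _ => finish)].

End LevelProgram.

Variable s : seq (edge n).
Hypothesis s_pos : forall e, e \in s -> (0 < e.2)%N.
Variables (M tsmall tbig L : nat).

Definition table_bound d := if dfail d then tbig else tsmall.

Definition sized d : Prop :=
  [/\ (size (dH d) + size (dE d) <= M)%N, (table_size (dS d).1 n <= table_bound d)%N,
      (da d <= n)%N /\ ((dS d).2 <= n)%N,
      forall x, x \in dH d ++ dE d -> pr_fits L (if pr then J else 0) x
    & forall q e, (dS d).1 q = Some e -> entry_fits L e].

Lemma wp_passes k r et K cap Q d (inv : table n * nat -> Prop) j :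
  let f := relax (dL d) et r K cap in
  (forall st, inv st -> inv (foldl f st (s ++ low_edges (dH d) k))) ->
  (forall st s1 s2, inv st -> s = s1 ++ s2 -> sized (setS d (foldl f st s1))) ->
  inv (dS d) ->
  (let st := iter j (fun st => foldl f st (s ++ low_edges (dH d) k)) (dS d) in
   inv st -> Q (setS d st)) ->
  wp s (nseq j (pass_instr k r et K cap)) sized Q d.
Proof.
move=> f inv_step inv_sized inv0 HQ.
have dE d' : d' = setS d' (dS d') by case: d'.
have rdE d' s1 : dL d' = dL d -> foldl (rd (pass_instr k r et K cap)) d' s1 =
    setS d' (foldl f (dS d') s1).
  elim: s1 d' => [|e s1 IH] d' dL' /=; first exact: dE.
  by rewrite IH //= dL'.
have : exists2 st, inv st & d = setS d st.
  by exists (dS d) => //; apply: dE.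
suff : forall d', (exists2 st, inv st & d' = setS d st) ->
    (let st := iter j (fun st => foldl f st (s ++ low_edges (dH d) k)) (dS d') in
      inv st -> Q (setS d st)) -> wp s (nseq j (pass_instr k r et K cap)) sized Q d'.
  by move=> h h'; apply: h.
elim: j {inv0 HQ} => [|j IH] d' [st ist ->] /= HQ; first exact: HQ.
split=> [s1 s2 ss|c]; first by rewrite rdE //=; apply: inv_sized ist ss.
apply: IH.
  exists (foldl f st (s ++ low_edges (dH d) k)); first exact: inv_step.
  by rewrite /pass_end rdE //= foldl_cat.
by rewrite /pass_end rdE //= -foldl_cat; move: HQ; rewrite -iterSr.
Qed.

Lemma relax_tbl0 Lam et (r : R) K cap h l : foldl (relax Lam et r K cap) (tbl0, h) l = (tbl0, h).
Proof.
elim: l => //= e l IH; rewrite -[RHS]IH; congr foldl; rewrite /relax.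
elim: (updates_of e) => //= -[[[y x] w] v] us IHu.
by rewrite [X in foldl _ X us](_ : _ = (tbl0, h)) // /update /tbl0 /= ffunE.
Qed.

Lemma wp_idle_passes k r et K cap Q d j : dS d = (tbl0, 0%N) -> sized d -> Q d ->
  wp s (nseq j (pass_instr k r et K cap)) sized Q d.
Proof.
move=> dS0 sd Qd; have dE : setS d (tbl0, 0%N) = d by rewrite -dS0; case: (d).
apply: (@wp_passes _ _ _ _ _ _ _ (fun st => st = (tbl0, 0%N))) => //.
- by move=> st ->; rewrite relax_tbl0.
- by move=> st s1 s2 -> _; rewrite relax_tbl0 dE.
- by move=> st ->; rewrite dE.
Qed.

Lemma wp_pure f Q d : sized d -> (forall c, Q (f c d)) -> wp s [:: pure f] sized Q d.
Proof.
have e d' s1 : foldl (rd (pure f)) d' s1 = d' by elim: s1.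
move=> sd Qd; split=> [s1 s2 _|c]; first by rewrite e.
by rewrite /pass_end e.
Qed.

Lemma wp_pure_cons f P Q d : sized d -> (forall c, wp s P sized Q (f c d)) ->
  wp s (pure f :: P) sized Q d.
Proof.
have e d' s1 : foldl (rd (pure f)) d' s1 = d' by elim: s1.
move=> sd Qd; split=> [s1 s2 _|c]; first by rewrite e.
by rewrite /pass_end e.
Qed.

End Program.

(** * Correctness and failure probability of one level *)

Section LevelRun.
Variables (R : realType) (n : nat) (C : finType) (law : C -> R).
Hypothesis law_ge0 : forall c, 0 <= law c.
Hypothesis law1 : \sum_c law c = 1.
Variables (v0 : 'I_n) (tau J : nat) (pr : bool).
Variables (delta eta : nat -> nat -> R) (Kf : nat -> nat) (smp : nat -> C -> 'I_n -> bool).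
Variables (s : seq (edge n)) (M tsmall tbig L k i : nat).
Variables (H0 : seq (pr_edge n)) (A : {set 'I_n}).
Implicit Types (d : data n) (B : {set 'I_n}).
Let dl := delta k i.
Let et := eta k i.
Let K := Kf i.
Let l := s ++ low_edges tau H0 k.
Let Jp := if pr then J else 0%N.
Hypothesis l_pos : forall e, e \in l -> (0 < e.2)%N.
Hypothesis et_gt0 : 0 < et.
Hypothesis dl_ge0 : 0 <= dl.
Hypothesis K_gt0 : (0 < K)%N.
Hypothesis J_ge : 5 * dl <= et * J%:R.
Hypothesis dl_le : 5 * dl <= (2 * L)%:R.
Hypothesis k_le : (k <= 2 * L)%N.
Hypothesis M_ge : (size H0 + edge_bound Kf i A <= M)%N.
Hypothesis H0_fits : forall x, x \in H0 -> pr_fits L Jp x.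
Hypothesis tsmall_ge : (2 * n <= tsmall)%N.
Hypothesis tbig_ge : (n + n * K <= tbig)%N.

Let tb f := if f : bool then tbig else tsmall.
Let Sz : data n -> Prop := sized J pr M tsmall tbig L.

Lemma dl_leL : dl <= (2 * L)%:R.
Proof. by have := dl_ge0; have := dl_le; lra. Qed.

(** The value is at most [5 * dl], which is at most [2 * L] and at most [et * J]; the former bounds
    the weights, the latter the number of edges of the stored path. *)
Lemma edge_ok_fits x : edge_ok l et k pr (5 * dl) x -> pr_fits L Jp x.
Proof.
move=> [sx _ [p [_ pw pv hp]]]; rewrite /pr_fits sx k_le -pw hp /=.
have et0 := et_gt0; have h1 := J_ge; have h2 := dl_le.
have p0 : 0 <= (path_weight p)%:R :> R by [].
have q0 : 0 <= et * (size p)%:R by rewrite mulr_ge0 // ltW.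
have pwL : (path_weight p <= 2 * L)%N by rewrite -(ler_nat R); move: pv; rewrite /pval; lra.
have pJ : (size p <= J)%N.
  by rewrite -(ler_nat R) -(ler_pM2l et0); move: pv; rewrite /pval; lra.
rewrite pwL /Jp; case: (pr) => //=; rewrite pJ /=; apply/allP => -[y w] yp.
apply: leq_trans pwL; elim: p yp {pw pv hp p0 q0 pJ} => //= -[z c] p IH.
rewrite inE path_weight_cons => /orP[/eqP[_ ->]|/IH]; first exact: leq_addr.
by move=> /leq_trans; apply; apply: leq_addl.
Qed.

Lemma explored_fits Lam r K' cap src st : explored Lam et r K' cap l src st ->
  r <= (2 * L)%:R -> forall q e, st.1 q = Some e -> entry_fits L e.
Proof.
have et0 := et_gt0; move=> [_ ok _ _ _] rL [x v] e eE.
have [_ er hw _ pt] := ok _ _ _ eE.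
have h0 : 0 <= et * e.1.2%:R by rewrite mulr_ge0 // ltW.
have wL : (e.1.1 <= 2 * L)%N by rewrite -(ler_nat R); move: er; rewrite /entry_val; lra.
rewrite /entry_fits wL (leq_trans hw wL) /=.
case: e.2 pt => [[y w] [_ [e0 _ le0]]|//]; rewrite -(ler_nat R).
have := entry_val_ge0 et_gt0 e0; lra.
Qed.

Definition bounded d := [/\ dH d = H0, (size (dE d) <= edge_bound Kf i A)%N,
  {in dE d, forall x, edge_ok l et k pr (5 * dl) x} & (da d <= n)%N].

Lemma bounded_sized d st : bounded d -> (table_size st.1 n <= tb (dfail d))%N ->
  (st.2 <= n)%N -> (forall q e, st.1 q = Some e -> entry_fits L e) -> Sz (setS d st).
Proof.
move=> [hH sE okE an] ts hn ef; split=> //=.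
- by rewrite hH; apply: leq_trans M_ge; rewrite leq_add2l.
- move=> x; rewrite hH mem_cat => /orP[/H0_fits //|/okE]; exact: edge_ok_fits.
Qed.

Lemma wp_bf r K' cap src (Q : data n -> Prop) d : bounded d -> dS d = (init (dL d) src, n) ->
  (forall x v v', src x v -> src x v' -> v = v') ->
  (n < K')%N || (n * n <= cap)%N -> (n <= cap)%N -> (0 < K')%N ->
  0 <= r -> r <= (2 * L)%:R ->
  (forall st, explored (dL d) et r K' cap l src st ->
     (table_size st.1 n <= tb (dfail d))%N) ->
  (let st := bf_run (dL d) et r K' cap l src J in
   explored (dL d) et r K' cap l src st -> Sz (setS d st) -> Q (setS d st)) ->
  wp s (nseq J (pass_instr n C tau k r et K' cap)) Sz Q d.
Proof.
move=> bd dSE sf mode nc K'0 r0 rL tsb HQ; have [hH _ _ _] := bd.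
have sz st : explored (dL d) et r K' cap l src st -> Sz (setS d st).
  move=> ex; apply: bounded_sized => //; first exact: tsb ex.
    by have [] := ex.
  exact: explored_fits ex rL.
apply: (@wp_passes _ _ _ _ _ _ _ _ _ _ _ _ _ _ _ _ _ _ (fun st => explored (dL d) et r K' cap l src st)).
- by move=> st ex; rewrite hH -/l; apply: pass_explored ex.
- move=> st s1 s2 ex ss.
  have ex' : explored (dL d) et r K' cap l src (foldl (relax (dL d) et r K' cap) st s1).
    by apply: relax_list_explored ex => // e es; rewrite mem_cat ss mem_cat es.
  exact: sz ex'.
- by rewrite dSE; apply: init_explored.
- by rewrite dSE hH -/l => /= ex; exact: (HQ ex (sz _ ex)).
Qed.

Definition lvl_cover (E : seq (pr_edge n)) B := forall x, x \in A ->
  (exists2 t, t \in B & x = t \/ exists2 e, e \in E &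
     (hedge e).1 = (x, t) /\ (hedge e).2%:R <= 5 * dl) \/
  (forall y p, y \in A -> walk (list_graph l) x p y -> pval et p <= dl ->
     x = y \/ exists2 e, e \in E & (hedge e).1 = (x, y) /\ (hedge e).2%:R <= pval et p).

Definition level_result E B := [/\ (size E <= edge_bound Kf i A)%N,
  {in E, forall x, edge_ok l et k pr (5 * dl) x}, lvl_cover E B
  & B \subset A /\ (#|B| * K <= #|A|)%N].

Definition resting f acc d := [/\ dA d = A, dE d = [::], dS d = (tbl0 n, 0%N), dbusy d = false
  & [/\ dacc d = acc, dfail d = f & (da d <= n)%N]].
Definition pending f d := resting f false d /\ dH d = H0.
Definition accepted f d := resting f true d /\
  exists2 E, dH d = H0 ++ E & level_result E (dB d).

Lemma table_size0 h : table_size (tbl0 n) h = 0%N.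
Proof. by apply: eq_card0 => q; rewrite inE /tbl0 ffunE. Qed.

Lemma resting_sized f d : pending f d \/ accepted f d -> Sz d.
Proof.
have rs acc : resting f acc d -> (size (dH d) <= M)%N ->
    (forall x, x \in dH d -> pr_fits L Jp x) -> Sz d.
  move=> [hA hE hS hb [ha hf an]] sH fH; split.
  - by rewrite hE addn0.
  - by rewrite hS table_size0.
  - by rewrite hS.
  - by move=> x; rewrite hE cats0; apply: fH.
  - by move=> q e; rewrite hS /= /tbl0 ffunE.
case=> [[rd hH]|[rd [E hH [sE okE _ _]]]]; apply: (rs _ rd); rewrite hH.
- exact: leq_trans (leq_addr _ _) M_ge.
- exact: H0_fits.
- by rewrite size_cat; apply: leq_trans M_ge; rewrite leq_add2l.
- by move=> x; rewrite mem_cat => /orP[/H0_fits//|/okE]; apply: edge_ok_fits.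
Qed.

Lemma idle_resting f acc d : resting f acc d -> idle d = d.
Proof. by case: d => ? ? ? ? ? ? ? ? ? ? ? [/= _ -> -> -> _]. Qed.

(** The first condition lets [Z] blocks cover all labels; the second keeps the interconnecting edges
    within the budget. *)
Definition good cap Z B :=
  (ball_load l A et dl (far l et dl B) n <= Z * (cap - n))%N &&
  (ball_load l A et dl (A :&: far l et dl B) n <= 32 * (#|A| * K))%N.

Definition started B f d := [/\ [/\ dH d = H0, dE d = [::], dA d = A & dB d = B],
  [/\ dL d = [set: 'I_n], dbusy d = true, dacc d = false & dfail d = f],
  (da d <= n)%N & dS d = (init [set: 'I_n] (src0 v0 B), n)].

Section Trial.
Variables (cap Z : nat) (f : bool).
Hypothesis cap_ge : (n <= cap)%N.
Hypothesis cap_tb : (cap <= tb f)%N.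
Hypothesis Z_gt0 : (0 < Z)%N.
Let blocks z := flatten (nseq z (block_prog n C tau J pr delta eta Kf k i cap)).
Let trial := trial_prog C v0 tau J pr delta eta Kf k i cap Z.

Lemma n_tb : (n <= tb f)%N. Proof. exact: leq_trans cap_ge cap_tb. Qed.

Lemma wp_resting_blocks z g acc d (Q : data n -> Prop) : resting g acc d -> Sz d -> Q d ->
  wp s (blocks z) Sz Q d.
Proof.
move=> rd sd Qd; elim: z => //= z IH.
rewrite /blocks /= /block_prog; apply: wp_cat; apply: wp_cat.
have [_ _ hS hb _] := rd.
apply: wp_idle_passes => //; apply: wp_pure => // c.
by rewrite /harvestB hb.
Qed.

Lemma wp_resting_trial g acc d (Q : data n -> Prop) : resting g acc d -> Sz d -> Q d ->
  wp s trial Sz Q d.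
Proof.
move=> rd sd Qd; have [_ _ hS hb _] := rd.
rewrite /trial /trial_prog; apply: wp_cat; apply: wp_idle_passes => //.
apply: wp_pure_cons => // c; rewrite /harvest0 hb.
apply: wp_cat; apply: (wp_resting_blocks _ rd) => //.
by apply: wp_pure => // _; rewrite /accept hb /= (idle_resting rd).
Qed.

Variable B : {set 'I_n}.
Hypothesis BA : B \subset A.
Hypothesis BK : (#|B| * K <= #|A|)%N.
Let st0 := run0 l et dl v0 B J.
Let U := unc A v0 st0.

(** The invariant after [z] blocks: all pairs with second label below [da d] are connected, and
    unless all labels are done, [z] times more than [cap - n] of the ball load is used up. *)
Definition block z d := [/\ bounded d, [/\ dA d = A, dB d = B & dL d = far l et dl B],
  [/\ dU d = U, dbusy d = true, dacc d = false & dfail d = f],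
  dS d = (init (dL d) (srcB A (da d)), n)
  & [/\ (size (dE d) <= #|A| + ball_load l A et dl U (da d))%N,
     da d = n \/ (z * (cap - n) + z <= ball_load l A et dl (far l et dl B) (da d))%N,
     forall x, x \in A -> x \notin B -> x \notin U ->
       exists2 a, a \in dE d & (hedge a).1.1 = x /\ (hedge a).1.2 \in B
   & forall u v p, u \in U -> u != v -> v \in A -> (v < da d)%N ->
       walk (list_graph l) v p u -> pval et p <= dl ->
       exists b, [/\ b \in dE d, (hedge b).1 = (u, v) & (hedge b).2%:R <= pval et p]]].

Lemma U_far : U \subset A :&: far l et dl B.
Proof.
apply/fintype.subsetP => x /(uncP A v0 l_pos et_gt0 dl_ge0 J_ge B x)[xA nx].
rewrite finset.in_setI xA inE /=; apply/asboolP => -[b [p [bB wp pd]]]; apply: nx.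
exists b, p; split=> //; have := dl_ge0; lra.
Qed.

Lemma ball_load_sub (W W' : {set 'I_n}) h : W \subset W' ->
  (ball_load l A et dl W h <= ball_load l A et dl W' h)%N.
Proof.
move=> /fintype.subsetP sub; rewrite /ball_load [leqRHS](big_setID W) /=.
by rewrite (finset.setIidPr _) ?leq_addr //; apply/fintype.subsetP.
Qed.

Lemma size_good h : good cap Z B -> (h <= n)%N ->
  (#|A| + ball_load l A et dl U h <= edge_bound Kf i A)%N.
Proof.
move=> /andP[_ g2] hn; rewrite /edge_bound mulnDr muln1 leq_add2l mulnCA.
by apply: leq_trans g2; apply: leq_trans (ball_load_le _ _ _ _ _ hn) (ball_load_sub _ U_far).
Qed.

Lemma block_step z d : block z d ->
  wp s (block_prog n C tau J pr delta eta Kf k i cap) Sz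
    (fun d' => block z.+1 d' \/ (pending f d' /\ ~~ good cap Z B)) d.
Proof.
have d0 := dl_ge0; have dL2 := dl_le.
move=> [bd [hA hB hL] [hU hb ha hf] hS [sE prog cov pairs]]; have [hH sE' okE an] := bd.
apply: wp_cat; apply: wp_bf hS _ _ _ _ _ _ _ _ => //.
- exact: srcB_fun.
- by rewrite ltnSn.
- exact: dl_leL.
- by move=> st [_ _ h _ _]; rewrite hf; apply: leq_trans h cap_tb.
move=> st ex Szd.
apply: (wp_pure s Szd) => _; rewrite /harvestB /= hb ha hf hA hB hU hH.
have stE : st = runB l A et dl cap (far l et dl B) (da d) J by rewrite /st hL.
set E := _ ++ _.
have [ah hn prog'] := runB_progress A l_pos et_gt0 dl_ge0 K_gt0 cap_ge J_ge (far l et dl B) an.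
rewrite -stE in ah hn prog'.
have sE2 : (size E <= #|A| + ball_load l A et dl U st.2)%N.
  rewrite /E size_cat (ball_load_split l A et_gt0 dl_ge0 K_gt0 cap_ge J_ge U ah) addnA leq_add //.
  by rewrite stE; apply: size_pair_edges.
(* Exceeding the budget certifies that [B] is not good. *)
case: ifP => sz; last first.
  right; split; first by split=> //; split.
  apply: contraFN sz => g; apply: leq_trans sE2 _; exact: size_good.
have okE' : {in E, forall x, edge_ok l et k pr (5 * dl) x}.
  move=> x; rewrite mem_cat => /orP[/okE//|]; rewrite stE.
  exact: (pair_edges_ok l_pos et_gt0 dl_ge0 K_gt0 cap_ge J_ge).
left; split=> //; split=> //=.
- case: prog' => [->|h]; first by left.
  case: prog => [an'|h']; first by left; apply/eqP; rewrite eqn_leq hn -{1}an' ah.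
  by right; have := cap_ge; move: h h'; rewrite mulSn; lia.
- move=> x xA xB xU; have [a aE h] := cov x xA xB xU; exists a => //.
  by rewrite mem_cat aE.
- move=> u v p uU uv vA vh wv pd.
  (* Smaller labels were handled by earlier blocks. For the others [u] is uncovered, so the walk
     stays in the far region and this block finds it. *)
  have [va|va] := ltnP v (da d).
    have [b [bE h1 h2]] := pairs u v p uU uv vA va wv pd.
    by exists b; split=> //; rewrite mem_cat bE.
  have [_ nu] := uncP A v0 l_pos et_gt0 dl_ge0 J_ge B u uU.
  have [|vL wv'] := far_walk et_gt0 wv (B := B) (delta := dl).
    move=> [b [q [bB wq pq]]]; apply: nu; exists b, q; split=> //; lra.
  have avh : (da d <= v < (runB l A et dl cap (far l et dl B) (da d) J).2)%N by rewrite va -stE.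
  have [b [bE h1 h2]] := pair_edgesP k pr l_pos et_gt0 dl_ge0 K_gt0 cap_ge J_ge uU uv vA avh vL wv' pd.
  by exists b; split=> //; rewrite mem_cat stE bE orbT.
Qed.

Lemma wp_blocks m z d : block z d -> wp s (blocks m) Sz
  (fun d' => block (z + m) d' \/ (pending f d' /\ ~~ good cap Z B)) d.
Proof.
elim: m z d => [|m IH] z d bd; first by rewrite addn0; left.
rewrite /blocks /=; apply: wp_cat; apply: wp_mono (block_step bd) => d' [bd'|[pd ng]].
  by rewrite addnS -addSn; apply: IH.
have [rd _] := pd; apply: (wp_resting_blocks _ rd); last by right.
by apply: resting_sized; left; apply: pd.
Qed.

Lemma src0_table Lam (et' r : R) K' cap' st : explored Lam et' r K' cap' l (src0 v0 B) st ->
  (table_size st.1 n <= n)%N.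
Proof.
move=> [_ ok _ _ _]; apply: leq_trans (table_size_rows _ _) _.
rewrite -[leqRHS]card_ord -sum1_card; apply: leq_sum => x _.
rewrite /row_size -(cards1 v0); apply/subset_leq_card/fintype.subsetP => v.
rewrite finset.in_set1 !inE; case eE : (st.1 (x, v)) => [e|] // _.
by have [_ _ _ [x0 [p [/andP[]]]]] := ok _ _ _ eE.
Qed.

Lemma block_accepted d : block Z d -> (n <= da d)%N ->
  level_result (dE d) (dB d) /\ dH d = H0.
Proof.
move=> [[hH sE okE an] [hA hB hL] [hU hb ha hf] hS [sE' prog cov pairs]] nd.
split=> //; split=> //; rewrite hB //.
move=> x xA; have [xB|xB] := boolP (x \in B); first by left; exists x => //; left.
have [xU|xU] := boolP (x \in U); last first.
  have [e eE [e1 e2]] := cov x xA xB xU; left; exists (hedge e).1.2 => //; right.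
  exists e => //; split; first by rewrite -e1 -surjective_pairing.
  have [_ _ [p [_ <- pv _]]] := okE _ eE; apply: le_trans pv.
  by rewrite /pval lerDl mulr_ge0 // ltW.
right=> y p yA /(walk_revP et)[q [wq pq]]; rewrite -pq => pd.
have [->|xy] := eqVneq x y; first by left.
have [|b [bE h1 h2]] := pairs x y q xU xy yA _ wq pd; last by right; exists b.
exact: leq_trans (ltn_ord y) nd.
Qed.

(** The trial can fail only through the sample: every reason for abandoning it refutes [good]. *)
Lemma wp_trial d : started B f d ->
  wp s trial Sz (fun d' => accepted f d' \/ (pending f d' /\ ~~ good cap Z B)) d.
Proof.
have d0 := dl_ge0; have dL2 := dl_le.
move=> [[hH hE hA hB] [hL hb ha hf] an hS].
have bd : bounded d by split; rewrite ?hE.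
rewrite -hL in hS; apply: wp_cat; apply: wp_bf hS _ _ _ _ _ _ _ _ => //.
- exact: src0_fun.
- by rewrite ltnSn.
- by apply: nn_ge v0.
- by rewrite mulr_ge0.
- by move=> st /src0_table h; rewrite hf; apply: leq_trans h n_tb.
move=> st ex Szd.
have stE : st = st0 by rewrite /st hL.
apply: (wp_pure_cons Szd) => _; apply: wp_cat.
set d1 := harvest0 _ _ _ _ _ _ _.
have d1E : d1 = Data H0 (cov_edges A et k v0 pr st0 B) A B (live et dl v0 st0) U 0
    (init (live et dl v0 st0) (srcB A 0), n) true false f.
  by rewrite /d1 /harvest0 /= hb hH hA hB ha hf stE.
have b0 : block 0 d1.
  have sc := size_cov_edges A et k v0 pr st0 B.
  have lE : live et dl v0 st0 = far l et dl B by apply: live_far.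
  rewrite d1E; split; [|by split|by []|by []|split=> //=].
  - split=> //=; last exact: (cov_edges_ok l_pos et_gt0 dl_ge0 K_gt0 cap_ge J_ge).
    by apply: leq_trans sc _; rewrite /edge_bound leq_pmulr.
  - exact: leq_trans sc (leq_addr _ _).
  - by right; rewrite mul0n.
  - by move=> x xA xB xU; apply: (cov_edgesP k pr l_pos et_gt0 dl_ge0 K_gt0 cap_ge J_ge).
apply: wp_mono (wp_blocks Z b0) => d2 [|[pd ng]]; last first.
  have [rd _] := pd; have sd : Sz d2 by apply: resting_sized; left; apply: pd.
  have [_ _ _ hb' _] := rd.
  by apply: (wp_pure s sd) => _; rewrite /accept hb' /= (idle_resting rd); right.
rewrite add0n => bd2.
have [bd' [hA' hB' hL'] [hU' hb' ha' hf'] hS' [sE' prog' _ _]] := bd2.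
have [hH' _ _ an'] := bd'.
have sz2 : Sz d2.
  have -> : d2 = setS d2 (dS d2) by case: (d2).
  have ex2 : explored (dL d2) et dl n.+1 cap l (srcB A (da d2)) (dS d2).
    by rewrite hS'; apply: init_explored => //; apply: srcB_fun.
  apply: bounded_sized => //.
  - by have [_ _ h _ _] := ex2; rewrite hf'; apply: leq_trans h cap_tb.
  - by have [h _ _ _ _] := ex2.
  - by apply: explored_fits ex2 dl_leL.
apply: (wp_pure s sz2) => _; rewrite /accept hb' /=; case: leqP => nd.
  left; split; first by split=> //; split.
  have [lr _] := block_accepted bd2 nd.
  by rewrite /= hH'; exists (dE d2).
right; split; first by split=> //; split.
(* With labels left over, the [Z] blocks would have consumed at least [Z * (cap - n) + Z] of the
   load, more than a good sample allows. *)
apply/negP => /andP[g1 _]; case: prog' => [e|h]; first by rewrite e ltnn in nd.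
have := leq_trans h (ball_load_le l A et dl (far l et dl B) an').
by have := Z_gt0; move: g1; lia.
Qed.

End Trial.
Let det := det_prog C v0 tau J pr delta eta Kf k i.

(** By [chosen_ball] every far vertex has fewer than [K] centers in its vicinity, so the ball load
    is at most [n * K] and the trial for the chosen centers cannot fail. *)
Lemma wp_det_pending f d : pending f d -> wp s det Sz (accepted true) d.
Proof.
move=> pd; have sd : Sz d by apply: resting_sized; left; apply: pd.
  have [[hA hE hS hb [ha _ an]] hH] := pd.
  apply: (wp_pure_cons sd) => _; set d1 := det_init d.
  have d1E : d1 = Data H0 [::] A (dB d) [set: 'I_n] (dU d) (da d)
      (init [set: 'I_n] (srcB A 0), n) true false true.
    by rewrite /d1 /det_init ha hH hA.
  rewrite d1E; have bd1 : bounded d1 by rewrite d1E; split.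
  rewrite d1E in bd1; apply: wp_cat; apply: (wp_bf bd1 erefl) => //.
  - exact: srcB_fun.
  - by rewrite leqnn orbT.
  - by apply: nn_ge v0.
  - exact: dl_leL.
  - move=> st [_ _ _ rw _]; apply: leq_trans (table_size_rows _ _) _.
    apply: (@leq_trans (n * K)%N); last by apply: leq_trans tbig_ge; apply: leq_addl.
    by rewrite -[n in (n * _)%N]card_ord -sum_nat_const; apply: leq_sum => x _; apply: rw.
  move=> st ex Szd; apply: (wp_pure_cons Szd) => _; set d2 := det_choose _ _ _ _.
  pose B := chosen K (runA l A et dl K J).1.
  have sB : B \subset A by apply: chosen_sub => //; exact: v0.
  have cB : (#|B| * K <= #|A|)%N by apply: card_chosen => //; exact: v0.
  have d2P : started B true d2.
    by rewrite /d2 /det_choose /= /start /= -/B cB.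
  have cap0 : (n <= n + n * K)%N by apply: leq_addr.
  have g : good (n + n * K) 1 B.
    have bl (W : {set 'I_n}) : W \subset far l et dl B -> (ball_load l A et dl W n <= #|W| * K)%N.
      move=> /fintype.subsetP Wf; rewrite -sum_nat_const; apply: leq_sum => u /Wf uf.
      have := chosen_ball v0 l_pos et_gt0 dl_ge0 K_gt0 J_ge uf.
      move=> /ltnW; apply: leq_trans; apply/subset_leq_card/fintype.subsetP => v.
      by rewrite inE => /andP[].
    apply/andP; split.
      apply: leq_trans (bl _ (fintype.subxx _)) _; rewrite mul1n addKn leq_mul2r.
      by rewrite -[X in (_ <= X)%N]card_ord max_card orbT.
    apply: leq_trans (bl _ (finset.subsetIr _ _)) _.
    apply: leq_trans (leq_pmull _ (isT : 0 < 32)%N); rewrite leq_mul2r.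
    by rewrite subset_leq_card ?finset.subsetIl // orbT.
  apply: wp_mono (wp_trial (f := true) (Z := 1) cap0 _ isT sB cB d2P) => // d' [//|[_]].
  by rewrite g.
Qed.

Lemma wp_det_accepted f d : accepted f d -> wp s det Sz (accepted f) d.
Proof.
move=> ad; have sd : Sz d by apply: resting_sized; right; apply: ad.
have [rd _] := ad; have [_ _ hS hb [ha _ _]] := rd.
apply: (wp_pure_cons sd) => _; rewrite /det_init ha.
apply: wp_cat; apply: wp_idle_passes => //.
apply: (wp_pure_cons sd) => _; rewrite /det_choose hb.
exact: wp_resting_trial rd sd ad.
Qed.

Definition lucky (c : C) : bool :=
  let B := [set v in A | smp i c v] in (#|B| * K <= #|A|)%N && good (2 * n) (16 * K) B.

Let random := random_prog v0 tau J pr delta eta Kf smp k i.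

Lemma n2_tb f : (2 * n <= tb f)%N.
Proof.
case: f => //=; apply: leq_trans tbig_ge.
by rewrite mul2n -addnn leq_add2l leq_pmulr.
Qed.

Lemma wp_random_accepted f d : accepted f d -> wp s random Sz (accepted f) d.
Proof.
move=> ad; have sd : Sz d by apply: resting_sized; right; apply: ad.
have [rd _] := ad; have [_ _ _ _ [ha _ _]] := rd.
apply: (wp_pure_cons sd) => c; rewrite /sample ha.
exact: wp_resting_trial rd sd ad.
Qed.

Lemma wp_random_sample f d c : pending f d ->
  wp s (trial_prog C v0 tau J pr delta eta Kf k i (2 * n) (16 * K)) Sz
    (fun d' => accepted f d' \/ (pending f d' /\ ~~ lucky c)) (sample v0 Kf smp i c d).
Proof.
move=> pd; have sd : Sz d by apply: resting_sized; left; apply: pd.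
have [rd hH] := pd; have [hA hE hS hb [ha hf an]] := rd.
rewrite /sample ha /start hA; set B := [set v in A | smp i c v].
case: ifP => cB; last first.
  rewrite (idle_resting rd); apply: wp_resting_trial rd sd _; right; split=> //.
  by rewrite /lucky cB.
have sB : B \subset A by apply/fintype.subsetP => x; rewrite inE => /andP[].
have st : started B f (Data (dH d) [::] A B [set: 'I_n] (dU d) (da d)
      (init [set: 'I_n] (src0 v0 B), n) true (dacc d) (dfail d)) by [].
have n2 : (n <= 2 * n)%N by rewrite mul2n -addnn leq_addr.
have z0 : (0 < 16 * K)%N by rewrite muln_gt0.
apply: wp_mono (wp_trial n2 (n2_tb f) z0 sB cB st) => d' [|[pd' ng]]; first by left.
by right; split=> //; rewrite /lucky cB.
Qed.

Lemma wp_random_pending f d : pending f d ->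
  wp s random Sz (fun d' => accepted f d' \/ pending f d') d.
Proof.
move=> pd; have sd : Sz d by apply: resting_sized; left; apply: pd.
apply: (wp_pure_cons sd) => c.
by apply: wp_mono (wp_random_sample c pd) => d' [|[]]; [left|right].
Qed.

Lemma wp_randoms f d r : pending f d \/ accepted f d ->
  wp s (flatten (nseq r random)) Sz (fun d' => accepted f d' \/ pending f d') d.
Proof.
elim: r d => [|r IH] d pa; first by case: pa; [right|left].
rewrite -[flatten _]/(random ++ flatten (nseq r random)); apply: wp_cat; case: pa => pa.
  by apply: wp_mono (wp_random_pending pa) => d' [] h; apply: IH; [right|left].
by apply: wp_mono (wp_random_accepted pa) => d' h; apply: IH; right.
Qed.

(* The state in which a level ends and the next one starts. *)
Definition ended f d := exists E B, [/\ dH d = H0 ++ E, dA d = B, level_result E B,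
  [/\ dE d = [::], dS d = (tbl0 n, 0%N) & dbusy d = false]
  & [/\ dacc d = false, dfail d = f & (da d <= n)%N]].

Lemma wp_finish f d : accepted f d -> wp s [:: pure (fun _ : C => @finish n)] Sz (ended f) d.
Proof.
move=> ad; have sd : Sz d by apply: resting_sized; right; apply: ad.
apply: (wp_pure s sd) => _; have [[hA hE hS hb [ha hf an]] [E hH lr]] := ad.
by exists E, (dB d).
Qed.

Lemma wp_det_finish f d : pending f d \/ accepted f d ->
  wp s (det ++ [:: pure (fun _ : C => @finish n)]) Sz (fun d' => exists f', ended f' d') d.
Proof.
case=> pa; apply: wp_cat.
  apply: wp_mono (wp_det_pending pa) => d' /wp_finish.
  by apply: wp_mono => d'' h; exists true.
apply: wp_mono (wp_det_accepted pa) => d' /wp_finish.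
by apply: wp_mono => d'' h; exists f.
Qed.

Lemma wp_level f d r : pending f d ->
  wp s (level_prog v0 tau J pr delta eta Kf smp k i r) Sz (fun d' => exists f', ended f' d') d.
Proof.
move=> pd; apply: wp_cat; apply: wp_mono (wp_randoms r (or_introl pd)) => d' pa.
by apply: (wp_det_finish (f := f)); case: pa; [right|left].
Qed.

Section Mean.
Variables (g : data n -> R) (a q : R).
Hypothesis g_le1 : forall d f, ended f d -> g d <= 1.
Hypothesis g_le : forall d, ended false d -> g d <= a.
Hypothesis a_ge0 : 0 <= a.
Hypothesis q01 : 0 <= q <= 1.
Hypothesis unlucky : \sum_c law c * (~~ lucky c)%:R <= q.
Let g1 := mean law s g (det ++ [:: pure (fun _ : C => @finish n)]).

(** Each trial draws a fresh coin and leaves the level pending only if the coin is unlucky. Here [a]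
    bounds the mean once the level has ended without fallback, and [q ^+ r] the probability of
    reaching the fallback. *)
Lemma mean_randoms d r : (accepted false d -> mean law s g1 (flatten (nseq r random)) d <= a) /\
  (pending false d -> mean law s g1 (flatten (nseq r random)) d <= a + q ^+ r).
Proof.
have /andP[q0 q1] := q01; elim: r d => [|r IH] d.
  split=> [ad|pd] /=.
    apply: (mean_le law_ge0 law1 (Sz := Sz) (Q := ended false)) => //.
    by apply: wp_cat; apply: wp_mono (wp_det_accepted ad) => d'; apply: wp_finish.
  rewrite expr0 -[X in X <= _]add0r; apply: lerD => //.
  apply: (mean_le law_ge0 law1 (wp_det_finish (or_introl pd))) => d' [f']; exact: g_le1.
rewrite -[flatten _]/(random ++ flatten (nseq r random)) mean_cat.
split=> [ad|pd].
  apply: (mean_le law_ge0 law1 (wp_random_accepted ad)) => d' ad'.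
  exact: (IH d').1.
apply: (@le_trans _ _ (\sum_c law c * (a + (~~ lucky c)%:R * q ^+ r))).
  apply: ler_sum => c _; apply: ler_wpM2l => //.
  have e : pass_end s (pure (sample v0 Kf smp i)) c d = sample v0 Kf smp i c d.
    rewrite /pass_end; congr (fin _ _ _).
    by elim: s.
  rewrite e.
  apply: (mean_le law_ge0 law1 (wp_random_sample c pd)) => d' [ad'|[pd' ->]].
    by apply: le_trans ((IH d').1 ad') _; rewrite lerDl mulr_ge0 // exprn_ge0.
  by rewrite mul1r; apply: (IH d').2.
under eq_bigr do rewrite mulrDr mulrA.
rewrite big_split /= -!mulr_suml law1 mul1r lerD2l exprS.
by apply: ler_wpM2r => //; apply: exprn_ge0.
Qed.

Lemma mean_level d r : pending false d ->
  mean law s g (level_prog v0 tau J pr delta eta Kf smp k i r) d <= a + q ^+ r.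
Proof. by move=> pd; rewrite mean_cat; apply: (mean_randoms d r).2. Qed.

End Mean.
End LevelRun.

(** * A random sample of centers is good with constant probability *)

Lemma markov_le (R : realType) (C : finType) (law : C -> R) (f : C -> nat) (a : nat) (e : R) :
  (forall c, 0 <= law c) -> 0 <= e -> \sum_c law c * (f c)%:R <= e * a%:R ->
  \sum_c law c * (a < f c)%N%:R <= e.
Proof.
move=> l0 e0 h; have [a0|a0] := posnP a.
  apply: le_trans e0; rewrite a0 mulr0 in h; apply: le_trans h; apply: ler_sum => c _.
  by apply: ler_wpM2l => //; rewrite ler_nat a0; case: (f c).
have a0' : 0 < a%:R :> R by rewrite ltr0n.
rewrite -(ler_pM2r a0'); apply: le_trans h; rewrite mulr_suml; apply: ler_sum => c _.
rewrite -mulrA; apply: ler_wpM2l => //; rewrite -natrM ler_nat.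
by case: ltnP => [/ltnW|]; rewrite ?mul1n ?mul0n.
Qed.

(** [(1 - q)^m (1 + m q) <= ((1 - q) (1 + q))^m <= 1] by Bernoulli. *)
Lemma expr_bernoulli (R : realType) (q : R) m : 0 <= q <= 1 -> m%:R * (1 - q) ^+ m * q <= 1.
Proof.
move=> /andP[q0 q1]; have b : 1 + m%:R * q <= (1 + q) ^+ m.
  elim: m => [|m IH]; first by rewrite mul0r addr0 expr0.
  rewrite exprS -natr1; apply: (@le_trans _ _ ((1 + q) * (1 + m%:R * q))).
    have h : 0 <= m%:R * q * q by rewrite !mulr_ge0.
    lra.
  by rewrite ler_wpM2l // addr_ge0.
have p0 : 0 <= (1 - q) ^+ m by rewrite exprn_ge0 // subr_ge0.
have h1 : (1 - q) ^+ m * (1 + m%:R * q) <= 1.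
  apply: (@le_trans _ _ ((1 - q) ^+ m * (1 + q) ^+ m)); first exact: ler_wpM2l.
  rewrite -exprMn exprn_ile1 //; last by nra.
  by rewrite mulr_ge0 ?subr_ge0 // addr_ge0.
by move: h1 p0; rewrite mulrDr mulr1; nra.
Qed.

Section Sample.
Variables (R : realType) (n : nat) (X : finType) (P : pred X) (K : nat).
Hypothesis K_gt0 : (0 < K)%N.
Hypothesis cardP : (#|P| * (4 * K) = #|X|)%N.
Hypothesis X_gt0 : (0 < #|X|)%N.
Let C := {ffun 'I_n -> X}.
Let law (c : C) : R := (#|C|%:R)^-1.
Let q : R := (4 * K%:R)^-1.

Lemma card_coins_gt0 : (0 < #|C|)%N.
Proof. by rewrite card_ffun expn_gt0 X_gt0. Qed.

Lemma uniform_ge0 c : 0 <= law c. Proof. by rewrite invr_ge0. Qed.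

Lemma uniform1 : \sum_c law c = 1.
Proof.
have c0 : #|C|%:R != 0 :> R by rewrite pnatr_eq0 -lt0n; exact: card_coins_gt0.
by rewrite /law sumr_const -[LHS]mulr_natr; exact: mulVf.
Qed.

Lemma q01 : 0 <= q <= 1.
Proof.
have k1 : 1 <= K%:R :> R by rewrite ler1n.
by rewrite /q invr_ge0 invf_le1; [apply/andP; split|]; lra.
Qed.

Lemma prob_missed (M : {set 'I_n}) :
  \sum_c law c * [forall v in M, ~~ P (c v)]%:R = (1 - q) ^+ #|M|.
Proof.
have k1 : 1 <= K%:R :> R by rewrite ler1n.
have x0 : #|X|%:R != 0 :> R by rewrite pnatr_eq0 -lt0n.
have cP : (#|X|%:R : R) = #|P|%:R * (4 * K%:R) by rewrite -cardP !natrM.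
have cN : (#|[predC P]|%:R : R) = (1 - q) * #|X|%:R.
  have := cardC P; move=> /(congr1 (fun m => m%:R : R)); rewrite natrD /= => e.
  rewrite (_ : #|[predC P]|%:R = #|X|%:R - #|P|%:R); last by rewrite -e addrC addKr.
  by rewrite cP /q; field; lra.
pose F v := if v \in M then [predC P] : {pred X} else predT.
rewrite -mulr_sumr -natr_sum -big_mkcond /= sum1_card.
have -> : #|[pred c : C | [forall v in M, ~~ P (c v)]]| = #|family F|.
  apply: eq_card => c; rewrite !inE; apply/forall_inP/familyP => h v; rewrite /F.
    by case: ifP => // vM; rewrite inE; apply: h.
  by move=> vM; have := h v; rewrite /F vM.
rewrite card_family foldrE big_map big_enum /=.
rewrite card_ffun card_ord (bigID (mem M)) /= natrM !natr_prod.
have -> : \prod_(v in M) #|F v|%:R = ((1 - q) * #|X|%:R) ^+ #|M| :> R.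
  by rewrite -prodr_const; apply: eq_bigr => v vM; rewrite /F vM cN.
have -> : \prod_(v | v \notin M) #|F v|%:R = #|X|%:R ^+ #|[predC M]| :> R.
  by rewrite -prodr_const; apply: eq_bigr => v /negbTE vM; rewrite /F vM.
rewrite exprMn -mulrA -exprD.
have -> : (#|M| + #|[predC M]|)%N = n by rewrite cardC card_ord.
by rewrite natrX mulrCA mulVf ?mulr1 // expf_neq0.
Qed.

Variables (l : seq (edge n)) (et dl : R) (A : {set 'I_n}).
Hypothesis dl_ge0 : 0 <= dl.
Let S (c : C) := [set v in A | P (c v)].

Lemma mean_card_sample : \sum_c law c * #|S c|%:R = q * #|A|%:R.
Proof.
have h v : \sum_c law c * (P (c v))%:R = q.
  have := prob_missed [set v]; rewrite cards1 expr1 => e.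
  have -> : q = \sum_c law c - \sum_c law c * [forall v0 in [set v], ~~ P (c v0)]%:R.
    by rewrite e uniform1 subKr.
  rewrite -sumrB; apply: eq_bigr => c _; rewrite -{2}[law c]mulr1 -mulrBr; congr (_ * _).
  have -> : [forall v0 in [set v], ~~ P (c v0)] = ~~ P (c v).
    by apply/forall_inP/idP => [h|h v0 /set1P ->//]; apply: h; rewrite inE.
  by case: (P (c v)); rewrite /= ?subr0 ?subrr.
rewrite (eq_bigr (fun c => \sum_(v in A) law c * (P (c v))%:R)); last first.
  move=> c _; rewrite -mulr_sumr -natr_sum -big_mkcondr /= sum1_card; congr (_ * _%:R).
  by apply: eq_card => v; rewrite !inE.
rewrite exchange_big /= (eq_bigr (fun=> q)) => [|v _]; last exact: h.
by rewrite sumr_const mulr_natr.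
Qed.

(** A far vertex has its whole vicinity unsampled. With [m] centers in the vicinity this has
    probability [(1 - q)^m], so the expected contribution is at most [m (1 - q)^m <= 1/q = 4 K]. *)
Lemma mean_ball_load (W : {set 'I_n}) :
  \sum_c law c * (ball_load l A et dl (W :&: far l et dl (S c)) n)%:R <= 4 * K%:R * #|W|%:R.
Proof.
have k1 : 1 <= K%:R :> R by rewrite ler1n.
have -> : 4 * K%:R * #|W|%:R = \sum_(x in W) (4 * K%:R : R).
  by rewrite sumr_const mulr_natr.
pose miss c x : R := [forall v in vicinity l A et dl x, ~~ P (c v)]%:R * #|vicinity l A et dl x|%:R.
apply: (@le_trans _ _ (\sum_(c : C) \sum_(x in W) law c * miss c x)); rewrite /miss.
  apply: ler_sum => c _; rewrite -mulr_sumr; apply: ler_wpM2l; first exact: uniform_ge0.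
  rewrite /ball_load (eq_bigl (fun x => (x \in W) && (x \in far l et dl (S c)))); last first.
    by move=> x; rewrite finset.in_setI.
  rewrite big_mkcondr /= natr_sum; apply: ler_sum => x xW.
  rewrite -natrM ler_nat; case: ifP => // xf.
  have -> : [forall v in vicinity l A et dl x, ~~ P (c v)].
    apply/forall_inP => v; rewrite inE => /andP[vA /asboolP[p wp pd]]; apply/negP => Pv.
    move: xf; rewrite inE => /asboolP; apply; exists v, p; split=> //; first by rewrite inE vA.
    by have := dl_ge0; lra.
  rewrite mul1n; apply/subset_leq_card/fintype.subsetP => v.
  by rewrite inE => /andP[].
rewrite exchange_big /=; apply: ler_sum => x _.
under eq_bigr do rewrite mulrA.
rewrite -mulr_suml prob_missed mulrC.
have := expr_bernoulli #|vicinity l A et dl x| q01.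
by rewrite {2}/q ler_pdivrMr ?mul1r //; lra.
Qed.

(** Three Markov bounds: the means are a quarter of the allowed sample size, a quarter of the total
    load and an eighth of the load at centers; [1/4 + 1/4 + 1/8 = 5/8]. *)
Lemma prob_unlucky : \sum_c law c * (~~ [&& #|S c| * K <= #|A|,
    ball_load l A et dl (far l et dl (S c)) n <= 16 * K * (2 * n - n)
  & ball_load l A et dl (A :&: far l et dl (S c)) n <= 32 * (#|A| * K)]%N)%:R <= 5 / 8.
Proof.
have k1 : 1 <= K%:R :> R by rewrite ler1n.
have m1 : \sum_c law c * (#|A| < #|S c| * K)%N%:R <= 4^-1.
  apply: markov_le => //; first exact: uniform_ge0.
  under eq_bigr do rewrite natrM mulrA.
  rewrite -mulr_suml mean_card_sample.
  rewrite (_ : q * #|A|%:R * K%:R = 4^-1 * #|A|%:R) //.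
  by rewrite /q; field; lra.
have m2 : \sum_c law c * (16 * K * (2 * n - n) < ball_load l A et dl (far l et dl (S c)) n)%N%:R <= 4^-1.
  apply: markov_le => //; first exact: uniform_ge0.
  have := mean_ball_load [set: 'I_n]; rewrite finset.cardsT card_ord.
  under eq_bigr do rewrite finset.setTI.
  move=> h; apply: le_trans h _; rewrite mul2n -addnn addnK !natrM; lra.
have m3 : \sum_c law c * (32 * (#|A| * K) < ball_load l A et dl (A :&: far l et dl (S c)) n)%N%:R <= 8^-1.
  apply: markov_le => //; first exact: uniform_ge0.
  apply: le_trans (mean_ball_load A) _; rewrite !natrM; lra.
apply: (@le_trans _ _ (4^-1 + (4^-1 + 8^-1))); last lra.
apply: le_trans (lerD m1 (lerD m2 m3)); rewrite -!big_split /=; apply: ler_sum => c _.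
rewrite -!mulrDr; apply: ler_wpM2l; first exact: uniform_ge0.
rewrite -!natrD ler_nat !ltnNge.
by rewrite !negb_and; do 3!case: (~~ (_ <= _)%N).
Qed.

End Sample.

(** * Composing levels and scales into the whole algorithm *)

Lemma mean_le1 (R : realType) n (C : finType) (law : C -> R) (D : Type) (s : seq (edge n))
    (g : D -> R) P d : (forall c, 0 <= law c) -> \sum_c law c = 1 -> (forall d, g d <= 1) ->
  mean law s g P d <= 1.
Proof.
move=> l0 l1 g1; elim: P d => [|ins P IH] d /=; first exact: g1.
by rewrite -l1; apply: ler_sum => c _; rewrite ler_piMr.
Qed.

Lemma streamable_le (R : realType) n L (O : Type) (enc : O -> memory n) size_of good
    (size1 space1 passes1 size2 space2 passes2 : R) :
  size1 <= size2 -> space1 <= space2 -> passes1 <= passes2 ->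
  streamable L enc size_of good size1 space1 passes1 ->
  streamable L enc size_of good size2 space2 passes2.
Proof.
move=> h1 h2 h3 [alg [p [hp h]]]; exists alg, p; split; first exact: le_trans h3.
move=> G s mind diam sG; have [out [h4 h5 h6]] := h G s mind diam sG.
by exists out; split=> //; [apply: le_trans h1|apply: le_trans h2].
Qed.

Lemma dyadic d : (1 < d)%N -> exists j, (2 ^ j < d <= 2 ^ j.+1)%N.
Proof.
move=> d1; have dp : (0 < d.-1)%N by lia.
have /andP[j1 j2] := trunc_log_bounds (isT : 1 < 2)%N dp.
by exists (trunc_log 2 d.-1); apply/andP; split; lia.
Qed.

Lemma pos_addn_gt1 a b : (0 < a)%N -> (0 < b)%N -> (a + b <= 1)%N = false.
Proof. by lia. Qed.

Lemma pos_count a b (c : bool) : (a + b = c)%N -> (0 < a)%N || (0 < b)%N = c.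
Proof. by case: c; lia. Qed.

Lemma space_bound_fail a ts tb c d e (f : bool) :
  (a + 8 * (if f then tb else ts) + c + d + e <= a + 8 * ts + c + d + e + 8 * tb * f)%N.
Proof. by case: f; lia. Qed.

Section Whole.
Variables (R : realType) (n : nat) (C : finType) (law : C -> R).
Hypothesis law_ge0 : forall c, 0 <= law c.
Hypothesis law1 : \sum_c law c = 1.
Variables (v0 : 'I_n) (tau J : nat) (pr : bool) (Kf : nat -> nat) (smp : nat -> C -> 'I_n -> bool).
Variables (T trials nS L S : nat) (c eps1 eps kk : R).

(** Normalized so that the top level has [lamf k T.-1 = 2^k / 16]. A distance of at most [2^k.+1]
    then consists of at most [32 + 1] pieces, which gives the 33 in [hops]. *)
Definition lamf (k i : nat) : R := (2 ^ k)%:R / 16 / c ^+ T.-1 * c ^+ i.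
Definition hops : R := 33 * ((8 * c) ^+ T.-1 + 1).
(** The hops for a distance up to [2^k] when only the earlier groups are available: [2^tau + 1]
    pieces, each followed by an edge of [G]. *)
Definition lower_hops : R := (2 ^ tau + 1)%:R * (hops + 1).
Definition deltaf k i := 4 * lamf k i.
Definition etaf k i := 4 * lamf k i / (c * lower_hops).

Definition scale_init (d : data n) : data n :=
  Data (dH d) (dE d) [set: 'I_n] (dB d) (dL d) (dU d) (da d) (dS d) (dbusy d) (dacc d) (dfail d).

Definition levels_prog k i m := flatten
  [seq level_prog v0 tau J pr deltaf etaf Kf smp k j trials | j <- iota i m].
Definition scale_prog k : seq (instr n C (data n)) :=
  pure (fun _ => scale_init) :: levels_prog k 0 T.
Definition scales_prog k m := flatten [seq scale_prog j | j <- iota k m].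

Definition data0 : data n := Data [::] [::] finset.set0 finset.set0 finset.set0 finset.set0 0
  (tbl0 n, 0%N) false false false.

(** Uniform in the edge list and the center set, since these depend on the coins of earlier
    levels. *)
Definition unlucky_le (q : R) := forall i l (et dl : R) (A : {set 'I_n}), (i < T)%N -> 0 <= dl ->
  \sum_c law c * (~~ [&& #|[set v in A | smp i c v]| * Kf i <= #|A|,
    ball_load l A et dl (far l et dl [set v in A | smp i c v]) n <= 16 * Kf i * (2 * n - n)
  & ball_load l A et dl (A :&: far l et dl [set v in A | smp i c v]) n <= 32 * (#|A| * Kf i)]%N)%:R <= q.

Hypothesis tau_gt0 : (0 < tau)%N.
Hypothesis T_gt0 : (0 < T)%N.
Hypothesis c_ge : 4 * T%:R <= c.
Hypothesis c_ge84 : 84 <= c.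
Hypothesis kk_ge : 6 * 40 + 4 <= kk.
Hypothesis J_ge : 5 * (c * lower_hops) <= J%:R.
Hypothesis eps1_ge : 33 * (2 * kk * T%:R / (16 * c)) <= eps1.
Hypothesis eps1_le : ((nS %/ tau).+1)%:R * eps1 <= eps.
Hypothesis eps_le1 : eps <= 1.
Hypothesis Kf_gt0 : forall i, (0 < Kf i)%N.
Hypothesis nS_lt : forall k, (k < nS)%N -> (2 ^ k < L)%N.
Hypothesis count_ok : forall a : nat -> nat, a 0%N = n ->
  (forall i, (i < T)%N -> (a i.+1 * Kf i <= a i)%N) ->
  (\sum_(i < T) a i * (1 + 32 * Kf i) <= S)%N /\ a T = 0%N.

Variables (tsmall tbig : nat).
Hypothesis tsmall_ge : (2 * n <= tsmall)%N.
Hypothesis tbig_ge : forall i, (i < T)%N -> (n + n * Kf i <= tbig)%N.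
Let M := (nS * S)%N.
Let Jp := if pr then J else 0%N.
Let Sz : data n -> Prop := sized J pr M tsmall tbig L.

Section Graph.
Variables (G : wgraph n) (dG : 'I_n -> 'I_n -> nat) (s : seq (edge n)).
Hypothesis dGP : is_nat_dist G dG.
Hypothesis sG : is_stream_of G s.

Lemma c_gt0 : 0 < c. Proof. by have := c_ge84; lra. Qed.

Lemma hops_ge : 33 <= hops.
Proof.
have h : 0 <= (8 * c) ^+ T.-1 by rewrite exprn_ge0 // mulr_ge0 // ltW // c_gt0.
by rewrite /hops; lra.
Qed.

Lemma lower_hops_gt0 : 0 < lower_hops.
Proof. by rewrite mulr_gt0 // ?ltr0n ?addn1 //; have := hops_ge; lra. Qed.

Lemma lamf_gt0 k i : 0 < lamf k i.
Proof.
have c0 := c_gt0; rewrite mulr_gt0 ?exprn_gt0 // divr_gt0 ?exprn_gt0 // divr_gt0 //.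
Qed.

Lemma lamfS k i : lamf k i.+1 = c * lamf k i.
Proof. by rewrite /lamf exprS mulrCA. Qed.

Lemma lamf_last k : lamf k T.-1 = (2 ^ k)%:R / 16.
Proof. by rewrite /lamf divfK // expf_neq0 // gt_eqF // c_gt0. Qed.

Lemma lamf_le k i : (i < T)%N -> lamf k i <= (2 ^ k)%:R / 16.
Proof.
move=> iT; rewrite -lamf_last; have iT1 : (i <= T.-1)%N by rewrite -ltnS prednK.
have c1 : 1 <= c by have := c_ge84; lra.
rewrite /lamf; apply: ler_wpM2l; last exact: ler_weXn2l.
by rewrite divr_ge0 ?exprn_ge0 ?divr_ge0 // ltW // c_gt0.
Qed.

Lemma etaf_gt0 k i : 0 < etaf k i.
Proof.
apply: divr_gt0; apply: mulr_gt0 => //; first exact: lamf_gt0; first exact: c_gt0.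
exact: lower_hops_gt0.
Qed.

Lemma deltaf_ge0 k i : 0 <= deltaf k i.
Proof. by rewrite mulr_ge0 // ltW // lamf_gt0. Qed.

Lemma rounds_ge k i : 5 * deltaf k i <= etaf k i * J%:R.
Proof.
have cb : 0 < c * lower_hops by rewrite mulr_gt0 ?c_gt0 ?lower_hops_gt0.
apply: (@le_trans _ _ (etaf k i * (5 * (c * lower_hops)))).
  by rewrite [leRHS]mulrCA /etaf divfK // gt_eqF.
by apply: ler_wpM2l J_ge; rewrite ltW // etaf_gt0.
Qed.

Lemma deltaf_le k i : (k < nS)%N -> (i < T)%N -> 5 * deltaf k i <= (2 * L)%:R.
Proof.
move=> /nS_lt kL iT; have := lamf_le k iT; rewrite /deltaf.
have : (2 ^ k)%:R <= L%:R :> R by rewrite ler_nat ltnW.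
by rewrite natrM; have : 0 <= (2 ^ k)%:R :> R by []; lra.
Qed.

Lemma scale_le k : (k < nS)%N -> (k <= 2 * L)%N.
Proof.
move=> /nS_lt kL; apply: leq_trans (leq_pmull _ (isT : 0 < 2)%N).
by apply: ltnW; apply: leq_ltn_trans kL; apply: ltnW; apply: ltn_expl.
Qed.

Lemma eps1_ge0 : 0 <= eps1.
Proof.
apply: le_trans eps1_ge; rewrite mulr_ge0 // divr_ge0 ?mulr_ge0 //; last by rewrite ltW // c_gt0.
by have := kk_ge; lra.
Qed.

Lemma stream_mem u v w : ((u, v, w) \in s) || ((v, u, w) \in s) = mgraph_of G u v w.
Proof. by rewrite -!has_pred1 !has_count; apply: pos_count; apply: sG. Qed.

Lemma stream_pos e : e \in s -> (0 < e.2)%N.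
Proof.
case: e => [[u v] w] es; have := stream_mem u v w; rewrite es /=.
by move=> /esym/andP[uv /eqP ->]; apply: weight_gt0.
Qed.

Lemma list_graph_stream F u v w :
  list_graph (s ++ F) u v w = mgraph_union (mgraph_of G) F u v w.
Proof.
rewrite /list_graph /mgraph_union !mem_cat -stream_mem.
by case: (_ \in s) => //=; case: (_ \in F); rewrite ?orbT ?orbF.
Qed.

Lemma sub_is_path (E E' : mgraph n) x p y : (forall a b w, E a b w -> E' a b w) ->
  is_path E x p y -> is_path E' x p y.
Proof.
move=> sub; rewrite !is_path_walk => /andP[wp ->]; rewrite andbT.
exact: sub_walk wp.
Qed.

Lemma union_sub (F F' : seq (edge n)) u v w : {subset F <= F'} ->
  mgraph_union (mgraph_of G) F u v w -> mgraph_union (mgraph_of G) F' u v w.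
Proof.
by move=> sub /or3P[h|/sub h|/sub h]; apply/or3P; [constructor 1|constructor 2|constructor 3].
Qed.

Definition edge_inv (H : seq (pr_edge n)) (x : pr_edge n) := [/\ (0 < (hedge x).2)%N,
  (dG (hedge x).1.1 (hedge x).1.2 <= (hedge x).2)%N, pr_fits L Jp x
  & pr -> is_path (mgraph_union (mgraph_of G) (below_scale (scale_of x) H))
              (hedge x).1.1 (hpath x) (hedge x).1.2 && (path_weight (hpath x) == (hedge x).2)].

(** The stretch error is [eps1] per group of scales, not per scale. *)
Definition scale_inv (H : seq (pr_edge n)) k := forall x y, (2 ^ k < dG x y <= 2 ^ k.+1)%N ->
  hw (mgraph_union (mgraph_of G) (at_scale k H)) x y hops
     ((1 + ((k %/ tau).+1)%:R * eps1) * (dG x y)%:R).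

Definition hist k (H : seq (pr_edge n)) := [/\ (size H <= k * S)%N,
  forall x, x \in H -> (scale_of x < k)%N /\ edge_inv H x,
  forall j, (j < k)%N -> (size (at_scale j H) <= S)%N
  & forall j, (j < k)%N -> scale_inv H j].

Lemma short_dist x y : (dG x y <= 1)%N -> hw (mgraph_of G) x y 1 ((dG x y)%:R : R).
Proof.
have [p wp <-] := dGP.1 x y; case: p wp => [|[z w] p].
  rewrite walk_nil path_weight_nil => /eqP -> _; exact: hw_refl.
rewrite walk_cons path_weight_cons => /andP[xz wp].
have w0 : (0 < w)%N by move: xz => /andP[xz /eqP ->]; apply: weight_gt0.
case: p wp => [|[z' w'] p].
  rewrite walk_nil path_weight_nil addn0 => /eqP zy _; apply: hw_edge.
  by rewrite -zy.
rewrite walk_cons path_weight_cons => /andP[/andP[zz' /eqP w'E] _].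
have := weight_gt0 zz'; rewrite -w'E => w'0.
by rewrite pos_addn_gt1 // addn_gt0 w'0.
Qed.

Lemma hist_hw k H m (e : R) : hist k H -> (m <= k)%N -> 0 <= e ->
  (forall j, (j < m)%N -> ((j %/ tau).+1)%:R * eps1 <= e) ->
  forall F : seq (edge n), (forall j, (j < m)%N -> {subset at_scale j H <= F}) ->
  forall x y, (dG x y <= 2 ^ m)%N ->
  hw (mgraph_union (mgraph_of G) F) x y hops ((1 + e) * (dG x y)%:R).
Proof.
move=> [_ _ _ hs] mk e0 he F HF x y dm.
have hh := hops_ge.
have d0 : 0 <= (dG x y)%:R :> R by [].
have [d1|d1] := leqP (dG x y) 1.
  apply: hw_le (hw_sub _ (short_dist d1)); first by lra.
    by rewrite ler_peMl //; lra.
  by move=> a b w; rewrite /mgraph_union => ->.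
have [j jd] := dyadic d1.
have jm : (j < m)%N.
  rewrite -(ltn_exp2l _ _ (isT : 1 < 2)%N); apply: leq_trans dm; by case/andP: jd.
apply: hw_le (hw_sub _ (hs j (leq_trans jm mk) x y jd)) => //.
  by apply: ler_wpM2r => //; rewrite lerD2l; apply: he.
by move=> a b w; apply: union_sub; apply: HF.
Qed.

Lemma low_le k : (low tau k <= k)%N. Proof. exact: leq_trunc_div. Qed.

Lemma low_lt k : (k < low tau k + tau)%N.
Proof. by rewrite {1}(divn_eq k tau) ltn_add2l ltn_mod. Qed.

Lemma at_low j (H : seq (pr_edge n)) k : (j < low tau k)%N -> {subset at_scale j H <= low_edges tau H k}.
Proof.
move=> jk e /mapP[x]; rewrite mem_filter => /andP[/eqP xj xH] ->.
by apply/mapP; exists x => //; rewrite mem_filter xj jk.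
Qed.

(** Cut a shortest path at length [2^(low k)]; each piece is served by the scales of earlier groups
    ([hist_hw]), and there are at most [2^tau + 1] pieces because [k < low tau k + tau]. *)
Lemma low_hw k H x y : hist k H -> (k < nS)%N -> (dG x y <= 2 ^ k)%N ->
  hw (mgraph_union (mgraph_of G) (low_edges tau H k)) x y lower_hops
     ((1 + (k %/ tau)%:R * eps1) * (dG x y)%:R).
Proof.
move=> hH kS dk; set e := _ * eps1.
have e0 : 0 <= e by rewrite mulr_ge0 // eps1_ge0.
have [m [v [D [[v0E vm] D0 Dm Dle Dadj]]]] := nat_walkD dGP x y.
pose Dr i : R := (D i)%:R; pose g := low tau k.
have Drmono i : (i < m)%N -> Dr i <= Dr i.+1 by move=> /Dle; rewrite ler_nat.
set E := mgraph_union _ _.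
have Dredge i : (i < m)%N -> hw E (v i) (v i.+1) 1 (Dr i.+1 - Dr i).
  move=> im; rewrite -natrB ?Dle //; apply: hw_edge.
  by rewrite /E /mgraph_union Dadj.
have hh := hops_ge.
have g0 : 0 < (2 ^ g)%:R :> R by rewrite ltr0n expn_gt0.
have h0 : 0 <= hops by lra.
have := chop Drmono Dredge (good := xpredT) e0 g0 h0 (lexx 0).
move=> /(_ _)/(_ 0%N m); rewrite leqnn v0E vm /Dr D0 Dm subr0 mulr0 addr0 => h.
apply: hw_le (h _ isT (fun _ _ => isT)) => //; last first.
  move=> a b ab _ Dab; have dab := nat_walk_dist R dGP Dle Dadj ab.
  rewrite addr0.
  have := @hist_hw k H g e hH (low_le k) e0 _ (low_edges tau H k) (fun j => @at_low j H k) (v a) (v b) _.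
  move=> hab; apply: hw_le (hab _ _) => //.
  - by apply: ler_wpM2l => //; lra.
  - move=> j jg; apply: ler_wpM2r; first exact: eps1_ge0.
    by rewrite ler_nat ltn_divLR.
  - by rewrite -(ler_nat R); apply: le_trans dab Dab.
rewrite /lower_hops ler_wpM2r //; first by lra.
rewrite natrD lerD2r ler_pdivrMr // -natrM ler_nat.
by apply: leq_trans dk _; rewrite -expnD leq_exp2l // addnC ltnW // low_lt.
Qed.

Definition level_edge Hk k (x : pr_edge n) := [/\ scale_of x = k, (0 < (hedge x).2)%N, pr_fits L Jp x
  & exists p, [/\ is_path (mgraph_union (mgraph_of G) (low_edges tau Hk k)) (hedge x).1.1 p (hedge x).1.2,
      path_weight p = (hedge x).2 & hpath x = if pr then p else [::]]].

Definition level_state k i f (d : data n) := exists Hk E As,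
  [/\ hist k Hk, pending (Hk ++ E) (As i) f d, As 0%N = [set: 'I_n], {in E, forall x, level_edge Hk k x}
  & [/\ (size E <= \sum_(j < i) edge_bound Kf j (As j))%N,
      forall j, (j < i)%N -> (#|As j.+1| * Kf j <= #|As j|)%N
    & forall j, (j < i)%N -> lvl_cover tau deltaf etaf s k j Hk (As j) E (As j.+1)]].

Lemma low_edges_cat (H E : seq (pr_edge n)) k : {in E, forall x, scale_of x = k} ->
  low_edges tau (H ++ E) k = low_edges tau H k.
Proof.
move=> sE; rewrite /low_edges filter_cat (_ : [seq x <- E | _] = [::]) ?cats0 //.
apply/eqP; rewrite -[_ == _]negbK -has_filter; apply/hasPn => x /sE ->.
by rewrite -leqNgt low_le.
Qed.

(** [count_ok] speaks of complete sequences, so the cardinalities known so far are continued by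
    0. *)
Lemma partial_count i (As : nat -> {set 'I_n}) : (i < T)%N -> As 0%N = [set: 'I_n] ->
  (forall j, (j < i)%N -> (#|As j.+1| * Kf j <= #|As j|)%N) ->
  (\sum_(j < i.+1) edge_bound Kf j (As j) <= S)%N.
Proof.
move=> iT A0 h; pose a j := if (j <= i)%N then #|As j| else 0%N.
have [|j jT|h1 _] := count_ok (a := a).
- by rewrite /a A0 finset.cardsT card_ord.
- by rewrite /a; case: ltnP => // ji; rewrite (ltnW ji) h.
apply: leq_trans h1; rewrite (big_ord_widen_cond T xpredT (fun j => edge_bound Kf j (As j))) //.
rewrite big_mkcond /=; apply: leq_sum => j _; case: ifP => // ji.
by rewrite ltnS in ji; rewrite /a ji.
Qed.

Lemma level_prem k i f d : (k < nS)%N -> (i < T)%N -> level_state k i f d ->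
  exists H0 A, [/\ pending H0 A f d, (forall e, e \in s ++ low_edges tau H0 k -> (0 < e.2)%N),
    (size H0 + edge_bound Kf i A <= M)%N, (forall x, x \in H0 -> pr_fits L Jp x)
  & forall f' d', ended tau pr deltaf etaf Kf s k i H0 A f' d' -> level_state k i.+1 f' d'].
Proof.
move=> kS iT [Hk [E [As [hH pd A0 okE [sE cd cov]]]]].
have [sH hx sS _] := hH.
have sck : {in E, forall x, scale_of x = k} by move=> x /okE[].
have lowE := low_edges_cat Hk sck.
exists (Hk ++ E), (As i); split=> //.
- move=> e; rewrite mem_cat lowE => /orP[/stream_pos//|/mapP[x + ->]].
  by rewrite mem_filter => /andP[_ /hx[_ []]].
- rewrite size_cat -addnA; have := partial_count iT A0 cd; rewrite big_ord_recr /= => h.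
  apply: (@leq_trans (k * S + S)%N).
    by apply: leq_add sH _; apply: leq_trans h; rewrite leq_add2r.
  by rewrite addnC -mulSn leq_mul2r kS orbT.
- by move=> x; rewrite mem_cat => /orP[/hx[_ []]|/okE[]].
move=> f' d' [E' [B [hH' hA' [sE' okE' cov' [BA BK]] [hE hS hb] [ha hf an]]]].
pose As' j := if (j <= i)%N then As j else B.
have Ai : As' i = As i by rewrite /As' leqnn.
have AiS : As' i.+1 = B by rewrite /As' ltnn.
exists Hk, (E ++ E'), As'; rewrite AiS; split=> //.
- by split; [split|rewrite catA].
- move=> x; rewrite mem_cat => /orP[/okE//|xE'].
  have fx : pr_fits L Jp x.
    exact: (edge_ok_fits (etaf_gt0 k i) (rounds_ge k i) (deltaf_le kS iT) (scale_le kS) (okE' x xE')).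
  have [sx wx [p [hp wp _ px]]] := okE' x xE'; split=> //; exists p; split=> //.
  by apply: sub_is_path hp => a b w; rewrite lowE list_graph_stream.
split.
- rewrite size_cat big_ord_recr /= Ai; apply: leq_add sE'.
  apply: leq_trans sE _; apply: eq_leq; apply: eq_bigr => j _.
  by rewrite /As' ltnW.
- move=> j; rewrite ltnS leq_eqVlt => /orP[/eqP ->|ji]; first by rewrite Ai AiS.
  by rewrite /As' ji (ltnW ji) cd.
- have up (F F' : seq (pr_edge n)) j A1 A2 H1 : {subset F <= F'} -> low_edges tau H1 k = low_edges tau Hk k ->
      lvl_cover tau deltaf etaf s k j H1 A1 F A2 -> lvl_cover tau deltaf etaf s k j Hk A1 F' A2.
    move=> FF lE cv x /cv[[t tB [->|[e eF h]]]|h].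
    + by left; exists t => //; left.
    + by left; exists t => //; right; exists e => //; apply: FF.
    + right=> y p yA wp pd'; rewrite -lE in wp.
      by have [->|[e eF h']] := h y p yA wp pd'; [left|right; exists e => //; apply: FF].
  move=> j; rewrite ltnS leq_eqVlt => /orP[/eqP ->|ji].
    rewrite Ai AiS; apply: up lowE cov' => x xE; by rewrite mem_cat xE orbT.
  rewrite /As' ji (ltnW ji); apply: up (cov j ji) => // x xE; by rewrite mem_cat xE.
Qed.

Definition scale_state k f (d : data n) := [/\ hist k (dH d), dE d = [::], dS d = (tbl0 n, 0%N)
  & [/\ dbusy d = false, dacc d = false, dfail d = f & (da d <= n)%N]].

Lemma scale_start k f d : scale_state k f d -> level_state k 0 f (scale_init d).
Proof.
move=> [hH hE hS [hb ha hf an]].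
exists (dH d), [::], (fun=> [set: 'I_n]); split=> //.
by split; [split|rewrite cats0].
Qed.

Lemma scale_sized k f d : (k <= nS)%N -> scale_state k f d -> Sz d.
Proof.
move=> kS [[sH hx _ _] hE hS [hb ha hf an]]; split.
- by rewrite hE addn0; apply: leq_trans sH _; rewrite leq_mul2r kS orbT.
- by rewrite hS table_size0.
- by rewrite hS.
- by move=> x; rewrite hE cats0 => /hx[_ []].
- by move=> q e; rewrite hS /= /tbl0 ffunE.
Qed.

Lemma at_scale_cat j (H E : seq (pr_edge n)) :
  at_scale j (H ++ E) = at_scale j H ++ at_scale j E.
Proof. by rewrite /at_scale filter_cat map_cat. Qed.

Lemma at_scale_nil j (E : seq (pr_edge n)) : {in E, forall x, scale_of x != j} -> at_scale j E = [::].
Proof.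
move=> h; rewrite /at_scale (_ : [seq x <- E | _] = [::]) //.
by apply/eqP; rewrite -[_ == _]negbK -has_filter; apply/hasPn => x /h.
Qed.

Lemma at_scale_sub j (H : seq (pr_edge n)) : {subset at_scale j H <= edges_of H}.
Proof.
by move=> e /mapP[x]; rewrite mem_filter => /andP[_ xH] ->; apply: map_f.
Qed.

Lemma hist_sound k H : hist k H -> sound_edges dG (edges_of H).
Proof. by move=> [_ hx _ _] e /mapP[x /hx[_ [_ h _ _]] ->]. Qed.

(** An instance of [scale_hw] over the graph of earlier groups. As [d > 2^k], the additive error of
    33 pieces is at most [eps1 * d], which raises the stretch of the earlier groups by one
    [eps1]. *)
Lemma scale_step k (Hk E : seq (pr_edge n)) (As : nat -> {set 'I_n}) : hist k Hk -> (k < nS)%N ->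
  {in E, forall x, scale_of x = k} -> sound_edges dG (at_scale k E) ->
  As 0%N = [set: 'I_n] -> As T = finset.set0 ->
  (forall j, (j < T)%N -> lvl_cover tau deltaf etaf s k j Hk (As j) E (As j.+1)) ->
  forall x y, (2 ^ k < dG x y <= 2 ^ k.+1)%N ->
  hw (mgraph_union (mgraph_of G) (at_scale k E)) x y hops
     ((1 + ((k %/ tau).+1)%:R * eps1) * (dG x y)%:R).
Proof.
move=> hH kS sE soE A0 AT cov x y /andP[kd dk].
have e0 := eps1_ge0; have ck := c_gt0.
have p0 : 0 < (2 ^ k)%:R :> R by rewrite ltr0n expn_gt0.
have eps01 : 0 <= (k %/ tau)%:R * eps1 <= 1.
  rewrite mulr_ge0 //=; apply: le_trans eps_le1; apply: le_trans eps1_le.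
  by apply: ler_wpM2r => //; rewrite ler_nat ltnW // ltnS leq_div2r // ltnW.
have lam_le i : (i < T)%N -> 2 * lamf k i <= (2 ^ k)%:R.
  by move=> /(lamf_le k); move: p0; lra.
have lower a b : (dG a b)%:R <= (2 ^ k)%:R :> R ->
    hw (mgraph_union (mgraph_of G) (low_edges tau Hk k)) a b lower_hops
      ((1 + (k %/ tau)%:R * eps1) * (dG a b)%:R).
  by rewrite ler_nat => ab; apply: low_hw.
have levels i : (i < T)%N -> level_ok G (mgraph_union (mgraph_of G) (low_edges tau Hk k))
    (at_scale k E) (4 * lamf k i / (c * lower_hops)) (4 * lamf k i) (As i) (As i.+1).
  move=> iT a aA; have use e b (z : R) : e \in E -> (hedge e).1 = (a, b) -> (hedge e).2%:R <= z ->
      hw (mgraph_union (mgraph_of G) (at_scale k E)) a b 1 z.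
    move=> eE eab ez; apply: hw_le ez (hw_edge _ _) => //.
    apply/or3P; constructor 2; apply/mapP; exists e; first by rewrite mem_filter sE ?eqxx.
    by rewrite -eab -surjective_pairing.
  have := cov i iT a aA; case=> [[t tA h]|h]; [left|right].
    exists t => //; case: h => [->|[e eE [e1 e2]]]; last exact: use e2.
    by apply: hw_refl => //; apply: mulr_ge0 => //; apply: deltaf_ge0.
  move=> b p bA wp pd; have wp' : walk (list_graph (s ++ low_edges tau Hk k)) a p b.
    by apply: sub_walk wp => u v w; rewrite list_graph_stream.
  have [->|[e eE [e1 e2]]] := h b p bA wp' pd; last exact: use e2.
  by apply: hw_refl => //; apply: pval_ge0; apply: ltW (etaf_gt0 k i).
have := scale_hw dGP soE eps01 c_ge c_ge84 kk_ge lower_hops_gt0 (lamfS k) (lamf_gt0 k)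
  lam_le lower A0 AT levels x y.
rewrite lamf_last => h; apply: hw_le h.
  rewrite /hops ler_wpM2r //.
    by have h : 0 <= (8 * c) ^+ T.-1; [rewrite exprn_ge0 // mulr_ge0 // ltW|lra].
  have d2 : (dG x y)%:R <= 2 * (2 ^ k)%:R :> R by rewrite -natrM ler_nat -expnS.
  have : (dG x y)%:R / ((2 ^ k)%:R / 16) <= 32 :> R by rewrite ler_pdivrMr; move: p0 d2; lra.
  by lra.
have d2 : (dG x y)%:R <= 2 * (2 ^ k)%:R :> R by rewrite -natrM ler_nat -expnS.
have d1 : (2 ^ k)%:R <= (dG x y)%:R :> R by rewrite ler_nat ltnW.
have h32 : (dG x y)%:R / ((2 ^ k)%:R / 16) + 1 <= 33 :> R.
  have : (dG x y)%:R / ((2 ^ k)%:R / 16) <= 32 :> R by rewrite ler_pdivrMr; move: p0 d2; lra.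
  by lra.
have K0 : 0 <= 2 * kk * T%:R :> R by rewrite mulr_ge0 //; have := kk_ge; lra.
have err0 : 0 <= 2 * kk * T%:R * ((2 ^ k)%:R / 16) / c.
  by apply: divr_ge0; [apply: mulr_ge0 => //; apply: divr_ge0 => //; apply: ltW|apply: ltW].
have e1 : ((dG x y)%:R / ((2 ^ k)%:R / 16) + 1) * (2 * kk * T%:R * ((2 ^ k)%:R / 16) / c)
    <= eps1 * (2 ^ k)%:R.
  apply: (@le_trans _ _ (33 * (2 * kk * T%:R * ((2 ^ k)%:R / 16) / c))); first exact: ler_wpM2r.
  have -> : 33 * (2 * kk * T%:R * ((2 ^ k)%:R / 16) / c) =
      33 * (2 * kk * T%:R / (16 * c)) * (2 ^ k)%:R by field; rewrite gt_eqF.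
  by apply: ler_wpM2r => //; apply: ltW.
have e2 : eps1 * (2 ^ k)%:R <= eps1 * (dG x y)%:R by apply: ler_wpM2l.
have gS : (k %/ tau).+1%:R = (k %/ tau)%:R + 1 :> R by rewrite natr1.
rewrite gS (_ : (1 + ((k %/ tau)%:R + 1) * eps1) * (dG x y)%:R =
  (1 + (k %/ tau)%:R * eps1) * (dG x y)%:R + eps1 * (dG x y)%:R); last by ring.
by rewrite lerD2l; apply: le_trans e1 e2.
Qed.

Lemma scale_end k f d : (k < nS)%N -> level_state k T f d -> scale_state k.+1 f d.
Proof.
move=> kS [Hk [E [As [hH [[hA hE hS hb [ha hf an]] hHd] A0 okE [sE cd cov]]]]].
have [|//|hc hT] := count_ok (a := fun j => #|As j|); first by rewrite A0 finset.cardsT card_ord.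
have AT : As T = finset.set0 by apply/eqP; rewrite -finset.cards_eq0 hT.
have sES : (size E <= S)%N by apply: leq_trans hc.
have sck : {in E, forall x, scale_of x = k} by move=> x /okE[].
have [sH hx sS si] := hH.
have belowS j : {subset below_scale j Hk <= below_scale j (Hk ++ E)}.
  by move=> e; rewrite /below_scale filter_cat map_cat mem_cat => ->.
have atj j : (j < k)%N -> at_scale j (Hk ++ E) = at_scale j Hk.
  move=> jk; rewrite at_scale_cat [X in _ ++ X]at_scale_nil ?cats0 // => x /sck ->.
  by rewrite gtn_eqF.
have atk : at_scale k (Hk ++ E) = at_scale k E.
  by rewrite at_scale_cat at_scale_nil // => x /hx[xk _]; rewrite ltn_eqF.
have atE : at_scale k E = edges_of E.
  by rewrite /at_scale /edges_of; congr map; apply/all_filterP/allP => x /sck ->.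
have low_sound : sound_edges dG (low_edges tau Hk k).
  by move=> e /mapP[x]; rewrite mem_filter => /andP[_ /hx[_ [_ h _ _]]] ->.
have invE x : x \in E -> edge_inv (Hk ++ E) x.
  move=> xE; have [xk x0 fx [p [hp wp px]]] := okE x xE; split=> //.
    rewrite -wp; apply: (union_walk_ge dGP low_sound).
    by move: hp; rewrite is_path_walk => /andP[].
  move=> prT; rewrite px prT wp eqxx andbT xk; apply: sub_is_path hp => a b w.
  apply: union_sub => e /mapP[z]; rewrite mem_filter => /andP[zk zH] ->.
  apply: belowS; apply/mapP; exists z => //; rewrite mem_filter zH andbT.
  exact: leq_trans zk (low_le k).
split=> //; rewrite hHd; split.
- by rewrite size_cat mulSn addnC leq_add.
- move=> x; rewrite mem_cat => /orP[xH|xE]; last by rewrite sck //; split=> //; apply: invE.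
  have [xk [h1 h2 h3 h4]] := hx x xH; split; first by rewrite ltnS ltnW.
  split=> // prT; have /andP[hp ->] := h4 prT; rewrite andbT.
  by apply: sub_is_path hp => a b w; apply: union_sub; apply: belowS.
- move=> j; rewrite ltnS leq_eqVlt => /orP[/eqP ->|jk]; last by rewrite atj // sS.
  by rewrite atk atE size_map.
- move=> j; rewrite ltnS leq_eqVlt => /orP[/eqP ->|jk]; last by rewrite /scale_inv atj //; apply: si.
  rewrite /scale_inv atk; apply: (scale_step hH kS sck _ A0 AT cov).
  by rewrite atE => e /mapP[x /invE[_ h _ _] ->].
Qed.

Lemma levels_progS k i m : levels_prog k i m.+1 =
  level_prog v0 tau J pr deltaf etaf Kf smp k i trials ++ levels_prog k i.+1 m.
Proof. by []. Qed.

Lemma wp_level_state k i f d : (k < nS)%N -> (i < T)%N -> level_state k i f d ->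
  wp s (level_prog v0 tau J pr deltaf etaf Kf smp k i trials) Sz
    (fun d' => exists f', level_state k i.+1 f' d') d.
Proof.
move=> kS iT ls; have [H0 [A [pd l_pos Mge H0f nx]]] := level_prem kS iT ls.
have := wp_level v0 smp l_pos (etaf_gt0 k i) (deltaf_ge0 k i) (Kf_gt0 i) (rounds_ge k i)
  (deltaf_le kS iT) (scale_le kS) Mge H0f tsmall_ge (tbig_ge iT) trials pd.
by apply: wp_mono => d' [f' /nx h]; exists f'.
Qed.

Lemma wp_levels k i m f d : (k < nS)%N -> (i + m <= T)%N -> level_state k i f d ->
  wp s (levels_prog k i m) Sz (fun d' => exists f', level_state k (i + m) f' d') d.
Proof.
move=> kS; elim: m i f d => [|m IH] i f d imT ls; first by rewrite addn0; exists f.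
rewrite levels_progS; apply: wp_cat; apply: wp_mono (wp_level_state kS _ ls).
  by move=> d' [f' ls']; rewrite addnS -addSn; apply: (IH i.+1 f') => //; rewrite addSnnS.
by apply: leq_trans imT; rewrite addnS ltnS leq_addr.
Qed.

Lemma wp_scale k f d : (k < nS)%N -> scale_state k f d ->
  wp s (scale_prog k) Sz (fun d' => exists f', scale_state k.+1 f' d') d.
Proof.
move=> kS ss; apply: (wp_pure_cons (scale_sized (ltnW kS) ss)) => _.
have := wp_levels kS (leqnn T : (0 + T <= T)%N) (scale_start ss).
by apply: wp_mono => d' [f' ls]; exists f'; apply: scale_end.
Qed.

Lemma wp_scales k m f d : (k + m <= nS)%N -> scale_state k f d ->
  wp s (scales_prog k m) Sz (fun d' => exists f', scale_state (k + m) f' d') d.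
Proof.
elim: m k f d => [|m IH] k f d kmS ss; first by rewrite addn0; exists f.
rewrite -[scales_prog _ _]/(scale_prog k ++ scales_prog k.+1 m); apply: wp_cat.
have kS : (k < nS)%N by apply: leq_trans kmS; rewrite addnS ltnS leq_addr.
apply: wp_mono (wp_scale kS ss) => d' [f' ss']; rewrite addnS -addSn.
by apply: (IH k.+1 f') => //; rewrite addSnnS.
Qed.

Lemma scale_state0 : scale_state 0 false data0.
Proof. by []. Qed.

Section Mean.
Variable q : R.
Hypothesis q01 : 0 <= q <= 1.
Hypothesis unlucky : unlucky_le q.

Lemma mean_level_state (g : data n -> R) a k i d : (forall d, g d <= 1) -> 0 <= a ->
  (k < nS)%N -> (i < T)%N -> (forall d', level_state k i.+1 false d' -> g d' <= a) ->
  level_state k i false d ->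
  mean law s g (level_prog v0 tau J pr deltaf etaf Kf smp k i trials) d <= a + q ^+ trials.
Proof.
move=> g1 a0 kS iT ga ls; have [H0 [A [pd l_pos Mge H0f nx]]] := level_prem kS iT ls.
apply: (mean_level law_ge0 law1 v0 l_pos (etaf_gt0 k i) (deltaf_ge0 k i) (Kf_gt0 i) (rounds_ge k i)
  (deltaf_le kS iT) (scale_le kS) Mge H0f tsmall_ge (tbig_ge iT) _ _ a0 q01 _ trials pd).
- by move=> d' f' _.
- by move=> d' /nx; apply: ga.
- exact: unlucky iT (deltaf_ge0 k i).
Qed.

Lemma mean_levels (g : data n -> R) a k i m d : (forall d, g d <= 1) -> 0 <= a ->
  (k < nS)%N -> (i + m <= T)%N -> (forall d', level_state k (i + m) false d' -> g d' <= a) ->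
  level_state k i false d -> mean law s g (levels_prog k i m) d <= a + m%:R * q ^+ trials.
Proof.
have q0 : 0 <= q ^+ trials by rewrite exprn_ge0 //; case/andP: q01.
move=> g1 a0 kS; elim: m i d => [|m IH] i d imT ga ls.
  by rewrite mul0r addr0; apply: ga; rewrite addn0.
rewrite levels_progS mean_cat -natr1 mulrDl mul1r addrA.
apply: mean_level_state kS _ _ ls.
- by move=> d'; apply: mean_le1.
- by rewrite addr_ge0 // mulr_ge0.
- by apply: leq_trans imT; rewrite addnS ltnS leq_addr.
- by move=> d' ls'; apply: IH ls'; [rewrite addSnnS|move=> d''; rewrite addSnnS; apply: ga].
Qed.

(** A union bound: one term [q ^+ trials] for each of the [T] levels of each of the [m] scales. *)
Lemma mean_scales (g : data n -> R) k m d : (forall d, g d <= 1) ->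
  (k + m <= nS)%N -> (forall d', scale_state (k + m) false d' -> g d' <= 0) ->
  scale_state k false d -> mean law s g (scales_prog k m) d <= m%:R * (T%:R * q ^+ trials).
Proof.
have q0 : 0 <= q ^+ trials by rewrite exprn_ge0 //; case/andP: q01.
move=> g1; elim: m k d => [|m IH] k d kmS ga ss.
  by rewrite mul0r; apply: ga; rewrite addn0.
rewrite -[scales_prog _ _]/(scale_prog k ++ scales_prog k.+1 m) mean_cat.
have kS : (k < nS)%N by apply: leq_trans kmS; rewrite addnS ltnS leq_addr.
set g' := mean law s g (scales_prog k.+1 m).
have g'1 d' : g' d' <= 1 by apply: mean_le1.
have h0 : 0 <= m%:R * (T%:R * q ^+ trials) by rewrite !mulr_ge0.
apply: (@le_trans _ _ (m%:R * (T%:R * q ^+ trials) + T%:R * q ^+ trials)); last first.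
  by rewrite -natr1 mulrDl mul1r.
have e d' : pass_end s (pure (fun _ : C => scale_init)) d' =1 fun d => scale_init d.
  by move=> d0; rewrite /pass_end; congr scale_init; elim: s.
rewrite -[leRHS]mul1r -[X in _ <= X * _]law1 mulr_suml; apply: ler_sum => c0 _; apply: ler_wpM2l => //.
rewrite e; apply: (mean_levels (g := g') g'1 h0 kS (leqnn T : (0 + T <= T)%N) _ (scale_start ss)).
move=> d' ls'; apply: IH; first by rewrite addSnnS.
  by move=> d''; rewrite addSnnS; apply: ga.
exact: scale_end.
Qed.

End Mean.
Section Final.
Hypothesis dG_le : forall x y, (dG x y <= L)%N.
Hypothesis distE : forall x y, dist R (mgraph_of G) x y = (dG x y)%:R%:E.
Variable b : nat.
Hypothesis b_ge : hops <= b%:R.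

Lemma upper_of_hw (F : seq (edge n)) x y :
  hw (mgraph_union (mgraph_of G) F) x y hops ((1 + eps) * (dG x y)%:R) ->
  hopset_upper b eps G F x y.
Proof.
move=> h; rewrite /hopset_upper distE -EFinM; apply: hop_dist_hw.
exact: hw_le h.
Qed.

Lemma level_eps_le k : (k < nS)%N -> ((k %/ tau).+1)%:R * eps1 <= eps.
Proof.
move=> kS; apply: le_trans eps1_le; apply: ler_wpM2r; first exact: eps1_ge0.
by rewrite ler_nat ltnS leq_div2r // ltnW.
Qed.

Lemma hist_scale_hopset m H k : hist m H -> (m <= nS)%N -> (k < m)%N || (L <= 2 ^ k)%N ->
  is_scale_hopset b eps G k (at_scale k H).
Proof.
move=> hH mS km x y; split.
  apply: (sound_hopset_lower dGP _ (distE x y)) => e /at_scale_sub.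
  exact: (hist_sound hH).
rewrite distE lte_fin lee_fin ltr_nat ler_nat => dk.
case/orP: km => [km|Lk]; last first.
  by have := dG_le x y; case/andP: dk => d1 _ /(leq_trans (leq_ltn_trans Lk d1)); rewrite ltnn.
have [_ _ _ sc] := hH; apply: upper_of_hw; apply: hw_le (sc k km x y dk) => //.
by apply: ler_wpM2r => //; rewrite lerD2l; apply: level_eps_le; apply: leq_trans mS.
Qed.

Lemma hist_hopset H : hist nS H -> (L <= 2 ^ nS)%N -> 0 <= eps -> is_hopset b eps G (edges_of H).
Proof.
move=> hH LS e0 x y; split.
  by apply: (sound_hopset_lower dGP _ (distE x y)); apply: (hist_sound hH).
apply: upper_of_hw; apply: (hist_hw hH (leqnn nS) e0 level_eps_le).
  by move=> j _; apply: at_scale_sub.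
exact: leq_trans (dG_le x y) LS.
Qed.

Lemma hist_implemented m H : hist m H -> pr -> implemented G H.
Proof. by move=> [_ hx _ _] prT; apply/allP => x /hx[_ [_ _ _]]; apply. Qed.

Lemma hist_size_at m H k : hist m H -> (size (at_scale k H) <= S)%N.
Proof.
move=> [_ hx sc _]; have [km|km] := ltnP k m; first exact: sc.
by rewrite at_scale_nil // => x /hx[xm _]; rewrite ltn_eqF // (leq_trans xm).
Qed.

End Final.

Lemma size_words_hopset (F : seq (edge n)) : size (words_of_hopset F) = (3 * size F)%N.
Proof. by elim: F => //= e F IH; rewrite IH mulnS. Qed.

Lemma hist_words_fit m H : hist m H -> forall F : seq (edge n), {subset F <= edges_of H} ->
  all (word_fits L) (words_of_hopset F).
Proof.
move=> [_ hx _ _]; elim=> //= e F IH FH.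
rewrite IH ?andbT => [|e' e'F]; last by apply: FH; rewrite inE e'F orbT.
have /mapP[x /hx[_ [_ _ /and4P[_ h _ _] _]] ->] := FH e (mem_head _ _).
by rewrite h.
Qed.

Lemma size_words_pr m H : hist m H -> (size (words_of_pr_hopset H) <= (2 * Jp + 4) * size H)%N.
Proof.
move=> [_ hx _ _]; have : {in H, forall x, (size (words_of_pr_edge x) <= 2 * Jp + 4)%N}.
  move=> x /hx[_ [_ _ /and4P[_ _ h _] _]]; rewrite /words_of_pr_edge /=.
  have -> : forall p : seq ('I_n * nat), size (flatten [seq [:: Ident y.1; Weight y.2] | y <- p]) = (2 * size p)%N.
    by elim=> //= y p ->; rewrite mulnS.
  by rewrite addn4 !ltnS leq_mul2l h.
elim: (H) => // x H' IH h.
rewrite -[words_of_pr_hopset _]/(words_of_pr_edge x ++ words_of_pr_hopset H') size_cat.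
rewrite -[size (x :: H')]/(size H').+1 mulnS; apply: leq_add.
  by apply: h; rewrite mem_head.
by apply: IH => y yH; apply: h; rewrite inE yH orbT.
Qed.

Lemma pr_words_fit m H : hist m H -> all (word_fits L) (words_of_pr_hopset H).
Proof.
move=> [_ hx _ _]; have : {in H, forall x, all (word_fits L) (words_of_pr_edge x)}.
  move=> x /hx[_ [_ _ /and4P[h1 h2 _ h3] _]]; rewrite /words_of_pr_edge /= h1 h2 /=.
  exact: words_path_fits.
elim: (H) => // x H' IH h.
rewrite -[words_of_pr_hopset _]/(words_of_pr_edge x ++ words_of_pr_hopset H') all_cat.
rewrite h ?mem_head //=.
by apply: IH => y yH; apply: h; rewrite inE yH orbT.
Qed.

End Graph.

Definition keeps_fail (ins : instr n C (data n)) :=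
  (forall d e, dfail d -> dfail (rd ins d e)) /\ (forall d c0, dfail d -> dfail (fin ins c0 d)).

Lemma keeps_pure f : (forall c0 d, dfail d -> dfail (f c0 d)) -> keeps_fail (pure f).
Proof. by move=> h; split=> // d c0; apply: h. Qed.

Lemma In_cat X (xs ys : seq X) y : List.In y (xs ++ ys) -> List.In y xs \/ List.In y ys.
Proof. exact: (proj1 (List.in_app_iff xs ys y)). Qed.

Lemma In_flatten_map X Y (f : X -> seq Y) xs y : List.In y (flatten [seq f x | x <- xs]) ->
  exists x, List.In y (f x).
Proof. by elim: xs => //= x xs IH /List.in_app_iff[h|/IH//]; exists x. Qed.

Lemma In_nseq X m (x y : X) : List.In y (nseq m x) -> y = x.
Proof. by elim: m => //= m IH [->|/IH]. Qed.

Lemma In_flatten_nseq X m (xs : seq X) y : List.In y (flatten (nseq m xs)) -> List.In y xs.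
Proof. by elim: m => //= m IH /List.in_app_iff[|/IH]. Qed.

Lemma start_fail i B (d : data n) : dfail d -> dfail (start v0 Kf i B d).
Proof. by rewrite /start; case: ifP. Qed.

Lemma keeps_trial k i cap Z ins :
  List.In ins (trial_prog C v0 tau J pr deltaf etaf Kf k i cap Z) -> keeps_fail ins.
Proof.
move=> h; have {h}[h|h] := In_cat h; first by rewrite (In_nseq h).
case: h => [<-|h].
  by apply: keeps_pure => _ d; rewrite /harvest0; case: ifP.
have {h}[h|h] := In_cat h; last first.
  by case: h => // <-; apply: keeps_pure => _ d; rewrite /accept; case: ifP.
have {h}[h|h] := In_cat (In_flatten_nseq h); first by rewrite (In_nseq h).
case: h => // <-.
by apply: keeps_pure => _ d; rewrite /harvestB; case: ifP => // _; case: ifP.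
Qed.

Lemma keeps_level k i ins :
  List.In ins (level_prog v0 tau J pr deltaf etaf Kf smp k i trials) -> keeps_fail ins.
Proof.
move=> h; have {h}[h|h] := In_cat h.
  case: (In_flatten_nseq h) => [<-|]; last exact: keeps_trial.
  by apply: keeps_pure => c0 d; rewrite /sample; case: ifP => // _; apply: start_fail.
have {h}[h|h] := In_cat h; last by case: h => // <-; apply: keeps_pure.
case: h => [<-|h]; first by apply: keeps_pure => _ d; rewrite /det_init; case: ifP.
have {h}[h|h] := In_cat h; first by rewrite (In_nseq h).
case: h => [<-|]; last exact: keeps_trial.
by apply: keeps_pure => _ d; rewrite /det_choose; case: ifP => // _; apply: start_fail.
Qed.

Lemma keeps_scales k m ins : List.In ins (scales_prog k m) -> keeps_fail ins.
Proof.
move=> h; have [j [<-|{}h]] := In_flatten_map h; first exact: keeps_pure.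
by have [i {}h] := In_flatten_map h; apply: keeps_level h.
Qed.

Definition space_bound (pcb : nat) : nat :=
  ((3 * Jp + 6) * M + 8 * tsmall + 12 * n + 2 * pcb + 17)%N.

(** The object is read off the stored hopset after the first [m] scales. [pf] bounds the probability
    of the fallback, either trivially by 1 or by the union bound over levels and scales. *)
Lemma streamable_program (O : Type) (enc : O -> memory n) (size_of : O -> nat)
    (good : wgraph n -> O -> Prop) (obj : seq (pr_edge n) -> O) m maxsize pcb (pf : R) :
  (0 < m <= nS)%N -> (size (scales_prog 0 m) <= 2 ^ pcb)%N -> (0 < L)%N ->
  (forall G dG H, is_nat_dist G dG -> (forall x y, (dG x y <= L)%N) ->
     (forall x y, dist R (mgraph_of G) x y = (dG x y)%:R%:E) -> hist G dG m H ->
     [/\ good G (obj H), (size_of (obj H) <= maxsize)%N,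
         (size (enc (obj H)) <= (3 * Jp + 6) * M)%N & all (word_fits L) (enc (obj H))]) ->
  1 <= pf \/ (exists2 q, 0 <= q <= 1 /\ unlucky_le q & m%:R * (T%:R * q ^+ trials) <= pf) ->
  streamable L enc size_of good maxsize%:R
    ((space_bound pcb)%:R + (8 * tbig)%:R * pf) (size (scales_prog 0 m))%:R.
Proof.
move=> /andP[m0 mS] pcP L0 objP pfP.
pose prog := scales_prog 0 m; pose out (d : data n) := enc (obj (dH d)).
have prog0 : (0 < size prog)%N by rewrite /prog; case: (m) m0.
exists (machine law_ge0 law1 (@enc_data n) out data0 prog), (size prog); split=> //.
move=> G s mind diam sG; have [dG [dGP dL dE]] := nat_dist_exists diam.
pose Q d := exists f, scale_state G dG m f d.
have wpP : wp s prog Sz Q data0.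
  have := wp_scales dGP sG (mS : (0 + m <= nS)%N) (scale_state0 G dG).
  by apply: wp_mono.
have Sz_enc pc d : (pc < size prog)%N -> Sz d ->
    (size (enc_data (pc, d)) <= space_bound pcb + 8 * tbig * dfail d)%N /\
    all (word_fits L) (enc_data (pc, d)).
  move=> pcl [sM ts [an hn] fH fe]; split; last exact: (enc_data_fits L0 _ fH fe).
  apply: leq_trans (size_enc_data (leq_trans pcl pcP) fH sM ts an hn) _.
  exact: space_bound_fail.
have Q_out d : Q d -> (size (out d) <= space_bound pcb)%N /\ all (word_fits L) (out d).
  move=> [f [hH _ _ _]]; have [_ _ h1 h2] := objP G dG (dH d) dGP dL dE hH; split=> //.
  by apply: leq_trans h1 _; rewrite /space_bound -!addnA leq_addr.
have mo := machine_outcome (law_ge0 := law_ge0) (law1 := law1) (d0 := data0) (@enc_data_inj n) (@enc_data_neq0 n)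
  (fun ins d e h => (keeps_scales h).1 d e) (fun ins d c0 h => (keeps_scales h).2 d c0)
  prog0 Sz_enc Q_out wpP.
exists (fun o => obj (dH (exec s prog data0 (val o)))); split.
- move=> o _; have [Qd fE fit _] := mo o; split=> //.
  by have [f [hH _ _ _]] := Qd; have [] := objP G dG _ dGP dL dE hH.
- rewrite /expect; apply: (@le_trans _ _ (\sum_(o : outcome (machine law_ge0 law1 (@enc_data n) out data0 prog) (size prog) s)
    (\prod_(c0 <- o) law c0) * maxsize%:R)).
    apply: ler_sum => o _; apply: ler_wpM2l; first by apply: prodr_ge0.
    have [[f [hH _ _ _]] _ _ _] := mo o; rewrite ler_nat.
    by have [_ h _ _] := objP G dG _ dGP dL dE hH.
  have := sum_tuple law (size (tokens (size prog) s)) (fun=> maxsize%:R).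
  by move=> ->; rewrite (expect_seq_cst law1).
have := machine_peak law_ge0 law1 (d0 := data0) (@enc_data_inj n) (@enc_data_neq0 n)
  (fun ins d e h => (keeps_scales h).1 d e) (fun ins d c0 h => (keeps_scales h).2 d c0)
  prog0 Sz_enc Q_out wpP.
move=> /le_trans; apply; rewrite lerD2l; apply: ler_wpM2l => //.
have fail1 (d : data n) : (dfail d)%:R <= 1 :> R by case: (dfail d).
case: pfP => [pf1|[q [q01 ul] qpf]].
  by apply: le_trans pf1; apply: mean_le1.
apply: le_trans qpf; apply: (mean_scales dGP sG q01 ul fail1 (mS : (0 + m <= nS)%N) _ (scale_state0 G dG)).
by move=> d [_ _ _ [_ _ -> _]].
Qed.

Section Outputs.
Variables (b pcb : nat) (pf : R).
Hypothesis b_ge : hops <= b%:R.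
Hypothesis eps_ge0 : 0 <= eps.
Hypothesis nS_gt0 : (0 < nS)%N.
Hypothesis L_le : (L <= 2 ^ nS)%N.
Hypothesis L_gt0 : (0 < L)%N.
Hypothesis pcb_ge : (size (scales_prog 0 nS) <= 2 ^ pcb)%N.
Hypothesis pf_ge :
  1 <= pf \/ (exists2 q, 0 <= q <= 1 /\ unlucky_le q & nS%:R * (T%:R * q ^+ trials) <= pf).
Let sp := (space_bound pcb)%:R + (8 * tbig)%:R * pf.
Let passes : R := (size (scales_prog 0 nS))%:R.

Lemma size_scales_mono m : (m <= nS)%N -> (size (scales_prog 0 m) <= size (scales_prog 0 nS))%N.
Proof.
move=> mS; rewrite -(subnKC mS) /scales_prog iotaD map_cat flatten_cat size_cat.
exact: leq_addr.
Qed.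

Lemma streamable_prefix (O : Type) (enc : O -> memory n) (size_of : O -> nat)
    (good : wgraph n -> O -> Prop) (obj : seq (pr_edge n) -> O) m maxsize :
  (0 < m <= nS)%N ->
  (forall G dG H, is_nat_dist G dG -> (forall x y, (dG x y <= L)%N) ->
     (forall x y, dist R (mgraph_of G) x y = (dG x y)%:R%:E) -> hist G dG m H ->
     [/\ good G (obj H), (size_of (obj H) <= maxsize)%N,
         (size (enc (obj H)) <= (3 * Jp + 6) * M)%N & all (word_fits L) (enc (obj H))]) ->
  streamable L enc size_of good maxsize%:R sp passes.
Proof.
move=> mS objP; have /andP[_ mS'] := mS.
apply: streamable_le (streamable_program (pf := pf) mS (leq_trans (size_scales_mono mS') pcb_ge) L_gt0 objP _) => //.
  by rewrite /passes ler_nat size_scales_mono.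
case: pf_ge => [|[q qP qpf]]; first by left.
have /andP[q0 _] := qP.1.
right; exists q => //; apply: le_trans qpf; apply: ler_wpM2r; last by rewrite ler_nat.
by rewrite mulr_ge0 ?exprn_ge0.
Qed.

Lemma S_le_M : (S <= M)%N. Proof. by rewrite /M leq_pmull. Qed.

Lemma hist_size_le G dG m H : hist G dG m H -> (m <= nS)%N -> (size H <= M)%N.
Proof. by move=> [h _ _ _] mS; apply: leq_trans h _; rewrite leq_mul2r mS orbT. Qed.

(** A single-scale output stops the program after scale [k]; scales from [nS] on need no run, since
    no distance exceeds [L <= 2 ^ nS]. *)
Let clip k := minn k.+1 nS.

Lemma clip_bounds k : (0 < clip k <= nS)%N.
Proof. by rewrite /clip leq_min /= nS_gt0 geq_minr. Qed.

Lemma clip_case j k : (j <= k)%N -> (j < clip k)%N || (L <= 2 ^ j)%N.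
Proof.
move=> jk; rewrite /clip leq_min ltnS jk /=; case: ltnP => //= Sj.
by apply: leq_trans L_le _; rewrite leq_exp2l.
Qed.

Lemma words_hopset_size (F : seq (edge n)) : (size F <= M)%N ->
  (size (words_of_hopset F) <= (3 * Jp + 6) * M)%N.
Proof. by move=> h; rewrite size_words_hopset; apply: leq_mul => //; apply: leq_trans (leq_addl _ _). Qed.

Lemma pr_words_size G dG m H : hist G dG m H -> (m <= nS)%N ->
  (size (words_of_pr_hopset H) <= (3 * Jp + 6) * M)%N.
Proof.
move=> hH mS; apply: leq_trans (size_words_pr hH) _; apply: leq_mul (hist_size_le hH mS).
by apply: leq_add => //; apply: leq_mul.
Qed.

Lemma plain_outputs : streamable_hopset n L b eps (nS * S)%:R sp passes /\
  forall k, streamable_scale_hopset n L b eps k S%:R sp passes.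
Proof.
split=> [|k].
  apply: (streamable_prefix (obj := @edges_of n) (m := nS)); first by rewrite nS_gt0 leqnn.
  move=> G dG H dGP dL dE hH; have hs := hist_size_le hH (leqnn nS).
  split.
  - exact: (hist_hopset dGP dL dE b_ge hH L_le eps_ge0).
  - by rewrite /edges_of size_map.
  - by apply: words_hopset_size; rewrite /edges_of size_map.
  - by apply: (hist_words_fit hH) => e.
apply: (streamable_prefix (obj := at_scale k) (clip_bounds k)).
move=> G dG H dGP dL dE hH; have /andP[_ cS] := clip_bounds k.
have sk := hist_size_at k hH; split=> //.
- exact: (hist_scale_hopset dGP dL dE b_ge hH cS (clip_case (leqnn k))).
- exact: words_hopset_size (leq_trans sk S_le_M).
- by apply: (hist_words_fit hH); apply: at_scale_sub.
Qed.

Lemma pr_outputs : pr -> streamable_pr_hopset n L b eps (nS * S)%:R sp passes /\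
  forall k, streamable_pr_scale_hopset n L b eps k S%:R sp passes.
Proof.
move=> prT; split=> [|k].
  apply: (streamable_prefix (obj := id) (m := nS)); first by rewrite nS_gt0 leqnn.
  move=> G dG H dGP dL dE hH; have hs := hist_size_le hH (leqnn nS); split=> //.
  - split; first exact: (hist_hopset dGP dL dE b_ge hH L_le eps_ge0).
      move=> k; apply: (hist_scale_hopset dGP dL dE b_ge hH (leqnn nS)).
      by case: ltnP => //= Sk; apply: leq_trans L_le _; rewrite leq_exp2l.
    exact: (hist_implemented hH prT).
  - exact: (pr_words_size hH (leqnn nS)).
  - exact: (pr_words_fit hH).
apply: (streamable_prefix (obj := id) (clip_bounds k)).
move=> G dG H dGP dL dE hH; have /andP[_ cS] := clip_bounds k.
split.
- split; last exact: (hist_implemented hH prT).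
    have [_ hx _ _] := hH; apply/allP => x /hx[xc _].
    by rewrite -ltnS; apply: leq_trans xc (geq_minl _ _).
  by move=> j jk; apply: (hist_scale_hopset dGP dL dE b_ge hH cS (clip_case jk)).
- exact: (hist_size_at k hH).
- exact: (pr_words_size hH cS).
- exact: (pr_words_fit hH).
Qed.

Lemma program_outputs : (streamable_hopset n L b eps (nS * S)%:R sp passes /\
    forall k, streamable_scale_hopset n L b eps k S%:R sp passes) /\
  (pr -> streamable_pr_hopset n L b eps (nS * S)%:R sp passes /\
    forall k, streamable_pr_scale_hopset n L b eps k S%:R sp passes).
Proof. by split; [exact: plain_outputs|exact: pr_outputs]. Qed.

End Outputs.
End Whole.

(** * Logarithms, exponents of the levels and counting of centers *)

Section Logarithm.
Variable R : realType.
Implicit Types x y : R.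

Lemma ln2_gt0 : 0 < ln 2 :> R. Proof. by rewrite ln_gt0 // ltr1n. Qed.

Lemma ln_le_sub1 x : 0 < x -> ln x <= x - 1.
Proof.
move=> x0; have := expR_ge1Dx (ln x); rewrite lnK ?posrE //; lra.
Qed.

Lemma ln2_le1 : ln 2 <= 1 :> R.
Proof. by have := @ln_le_sub1 2 _; rewrite (_ : (2 : R) - 1 = 1); [apply|ring]. Qed.

Lemma log2M x y : 0 < x -> 0 < y -> log2 (x * y) = log2 x + log2 y.
Proof. by move=> x0 y0; rewrite /log2 lnM ?posrE // mulrDl. Qed.

Lemma log2_2 : log2 2 = 1 :> R.
Proof. by rewrite /log2 divff // gt_eqF // ln2_gt0. Qed.

Lemma log2_2X k : log2 (2 ^+ k) = k%:R :> R.
Proof.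
have l2 : ln 2 != 0 :> R by rewrite gt_eqF // ln2_gt0.
by rewrite /log2 lnXn // -[ln 2 *+ k]mulr_natr mulrAC divff ?mul1r.
Qed.

Lemma ler_log2 x y : 0 < x -> x <= y -> log2 x <= log2 y.
Proof.
move=> x0 xy; rewrite /log2 ler_pM2r ?invr_gt0 ?ln2_gt0 // ler_ln ?posrE //.
exact: lt_le_trans xy.
Qed.

Lemma log2_half x : 1 <= x <= 2 -> log2 x <= x / 2.
Proof.
move=> /andP[x1 x2]; have l2 := ln2_gt0; have l1 := ln2_le1.
have x0 : 0 < x by lra.
have -> : x = (x / 2) * 2 by field.
rewrite log2M ?divr_gt0 // log2_2 mulrK ?unitfE //.
have h : 0 < x / 2 by lra.
have := ln_le_sub1 h => h1; rewrite /log2 -lerBrDr ler_pdivrMr //.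
by nra.
Qed.

Lemma log2_le x : 0 < x -> log2 x <= 2 * x.
Proof.
move=> x0; have l2 : 2^-1 <= ln 2 :> R.
  have := @ln_le_sub1 2^-1; rewrite lnV ?posrE // => /(_ _)/wrap[]; lra.
have h1 := ln_le_sub1 x0; rewrite /log2 ler_pdivrMr ?ln2_gt0 //; nra.
Qed.

Lemma powR_log2 x : 0 < x -> 2 `^ log2 x = x.
Proof.
move=> x0; rewrite /powR gt_eqF // /log2 divfK ?lnK ?posrE //.
by rewrite gt_eqF // ln2_gt0.
Qed.

End Logarithm.

Section Exponents.
Variables (R : realType) (kappa rho : R).
Hypothesis kappa_ge2 : 2 <= kappa.
Hypothesis rho_bounds : kappa^-1 <= rho < 2^-1.

(** The exponents double, which keeps the number of edges at [n^(1+1/kappa)], until [rho] caps them,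
    which keeps the tables at [n^(1+rho)]. *)
Definition expo (i : nat) : R := Num.min ((2 ^ i)%:R / kappa) rho.

Lemma rho_gt0 : 0 < rho.
Proof.
have /andP[h _] := rho_bounds; apply: lt_le_trans h; rewrite invr_gt0.
by have := kappa_ge2; lra.
Qed.

Lemma expo_ge0 i : 0 <= expo i.
Proof.
have k2 := kappa_ge2.
by rewrite /expo le_min (ltW rho_gt0) andbT divr_ge0 //; lra.
Qed.

Lemma expo_le i : expo i <= rho.
Proof. by rewrite /expo ge_min lexx orbT. Qed.

Lemma expo_sum_ge i : expo i <= \sum_(j < i) expo j + kappa^-1.
Proof.
elim: i => [|i IH].
  by rewrite big_ord0 add0r /expo expn0 ge_min mul1r lexx.
rewrite big_ord_recr /= addrAC; have r0 := rho_gt0.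
have k0 : 0 < kappa by have := kappa_ge2; lra.
have : expo i.+1 <= expo i + expo i.
  rewrite /expo expnS natrM -mulrA; set z := _ / kappa.
  have z0 : 0 <= z by rewrite divr_ge0 // ltW.
  by case: (leP (2 * z) rho); case: (leP z rho); lra.
by lra.
Qed.

(** Sum the geometric part up to the first index [a] at which [rho] is reached, then [rho] per
    level. If [a = 0] the sum is [T * rho], and [T > log2 kappa + 1/rho - 1 >= 1/rho]. *)
Lemma exponents_suffice : 1 <= \sum_(i < Num.truncn (log2 kappa + rho^-1)) expo i.
Proof.
have r0 := rho_gt0; have k2 := kappa_ge2; have /andP[kr rh] := rho_bounds.
have k0 : 0 < kappa by lra.
have lk : 1 <= log2 kappa by rewrite -(log2_2 R); apply: ler_log2.
have lr : log2 rho <= - 1.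
  have h2 : 0 < rho * 2 by lra.
  have := @ler_log2 R (rho * 2) 1 h2; rewrite log2M // log2_2 {2}/log2 ln1 mul0r; lra.
set X := log2 kappa + rho^-1; set T := Num.truncn X.
have rV : 0 < rho^-1 by rewrite invr_gt0.
have X0 : 0 <= X by rewrite /X; lra.
have XT : X < T%:R + 1 by rewrite natr1; apply: truncnS_gt.
have exa : exists a, rho <= (2 ^ a)%:R / kappa.
  exists (Num.truncn (rho * kappa)).+1; rewrite ler_pdivlMr //.
  apply: le_trans (ltW (truncnS_gt _)) _.
  by rewrite ler_nat ltnW // ltn_expl.
have [a ra amin] := ex_minnP exa.
have small i : (i < a)%N -> expo i = (2 ^ i)%:R / kappa.
  move=> ia; rewrite /expo; case: leP => // /ltW /amin.
  by rewrite leqNgt ia.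
have large i : (a <= i)%N -> expo i = rho.
  move=> ai; rewrite /expo; case: leP => // h; apply/eqP; rewrite eq_le h /=.
  apply: le_trans ra _; rewrite ler_pM2r ?invr_gt0 // ler_nat.
  by rewrite leq_exp2l.
have sum1 m : (m <= a)%N -> \sum_(i < m) expo i = ((2 ^ m)%:R - 1) / kappa.
  elim: m => [|m IH] ma; first by rewrite big_ord0 expn0 subrr mul0r.
  rewrite big_ord_recr /= IH ?(ltnW ma) // small // expnS natrM; field.
  by rewrite gt_eqF.
have sum2 m : \sum_(i < a + m) expo i = ((2 ^ a)%:R - 1) / kappa + m%:R * rho.
  elim: m => [|m IH]; first by rewrite addn0 sum1 // mul0r addr0.
  by rewrite addnS big_ord_recr /= IH large ?leq_addr // -natr1; ring.
have [a0|a0] := posnP a.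
  move: sum2 ra; rewrite a0 expn0 => sum2 ra; rewrite -[T]add0n sum2 subrr mul0r add0r.
  have : 1 <= (T%:R + 1 - log2 kappa) * rho.
    have h : rho^-1 <= T%:R + 1 - log2 kappa by move: XT; rewrite /X; lra.
    by rewrite -{1}(mulVf (lt0r_neq0 r0)); apply: ler_wpM2r => //; apply: ltW.
  have : 0 <= (log2 kappa - 1) * rho by rewrite mulr_ge0; lra.
  lra.
have p0 : 0 < (2 ^ a)%:R :> R by rewrite ltr0n expn_gt0.
have kr0 : 0 < kappa * rho by rewrite mulr_gt0.
(* [y] in [[1, 2]] measures the overshoot of the doubling. From [a = log2 y + log2 kappa + log2 rho]
   and [log2 rho <= -1], [T - a > 1/rho - log2 y]. So the sum is at least
   [1 + y rho - rho log2 y - 1/kappa], and [log2 y <= y/2], [1/kappa <= y rho / 2] finish. *)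
pose y : R := (2 ^ a)%:R / (kappa * rho).
have yE : (2 ^ a)%:R / kappa = y * rho by rewrite /y; field; rewrite !gt_eqF.
have y0 : 0 < y by rewrite divr_gt0.
have y1 : 1 <= y.
  by rewrite -(ler_pM2r r0) mul1r -yE.
have y2 : y <= 2.
  have : (2 ^ a.-1)%:R / kappa <= rho.
    rewrite leNgt; apply/negP => /ltW/amin.
    by rewrite leqNgt ltn_predL a0.
  have e : (2 ^ a)%:R = 2 * (2 ^ a.-1)%:R :> R by rewrite -natrM -expnS prednK.
  by move=> h; rewrite -(ler_pM2r r0) -yE e -mulrA ler_pM2l.
have ly : log2 y <= y / 2 by apply: log2_half; rewrite y1.
have yk0 : 0 < y * kappa by apply: mulr_gt0.
have aE : a%:R = log2 y + log2 kappa + log2 rho.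
  rewrite -log2_2X -natrX (_ : (2 ^ a)%:R = y * kappa * rho).
    by rewrite (log2M yk0 r0) (log2M y0 k0).
  by rewrite /y; field; rewrite !gt_eqF.
have yb : kappa^-1 <= y * rho / 2.
  rewrite -yE mulrAC ler_pMl ?invr_gt0 // ler_pdivlMr // mul1r (ler_nat _ 2).
  by rewrite -{1}(expn1 2) leq_exp2l.
have aT : (a <= T)%N.
  by rewrite /T truncn_ge_nat // aE /X; lra.
rewrite -(subnKC aT) sum2 natrB // mulrBl mul1r yE.
have h1 : 1 + (log2 kappa - 1 - a%:R) * rho <= (T%:R - a%:R) * rho.
  have h : rho^-1 + (log2 kappa - 1 - a%:R) <= T%:R - a%:R by move: XT; rewrite /X; lra.
  rewrite -{1}(mulVf (lt0r_neq0 r0)) -mulrDl; apply: ler_wpM2r => //; exact: ltW.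
have h2 : (- (y / 2)) * rho <= (log2 kappa - 1 - a%:R) * rho.
  by apply: ler_wpM2r; [apply: ltW|rewrite aE; lra].
lra.
Qed.
Variable n : nat.
Hypothesis n_gt0 : (0 < n)%N.

(** The factor 2 makes the contributions of the levels decay like [2^-i]. *)
Definition bucket (i : nat) : nat := (2 * (Num.truncn (n%:R `^ expo i)).+1)%N.

Let n1 : 1 <= n%:R :> R. Proof. by rewrite ler1n. Qed.
Let n0 : 0 < n%:R :> R. Proof. by rewrite ltr0n. Qed.

Lemma powR_nD (x y : R) : n%:R `^ (x + y) = n%:R `^ x * n%:R `^ y.
Proof. by rewrite powRD // (gt_eqF n0) implybT. Qed.

Lemma powR_n_ge1 (x : R) : 0 <= x -> 1 <= n%:R `^ x.
Proof. by move=> x0; rewrite -[leLHS](powRr0 n%:R); apply: ler_powR. Qed.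

Lemma bucket_gt0 i : (0 < bucket i)%N.
Proof. by []. Qed.

Lemma bucket_ge i : 2 * n%:R `^ expo i <= (bucket i)%:R.
Proof. by rewrite /bucket natrM ler_pM2l // ltW // truncnS_gt. Qed.

Lemma bucket_le i : (bucket i)%:R <= 4 * n%:R `^ expo i.
Proof.
have h := powR_n_ge1 (expo_ge0 i); rewrite /bucket natrM -natr1.
have : (Num.truncn (n%:R `^ expo i))%:R <= n%:R `^ expo i by rewrite truncn_le powR_ge0.
lra.
Qed.

Lemma sum_half m : \sum_(i < m) 2^-1 ^+ i <= 2 :> R.
Proof.
suff -> : \sum_(i < m) 2^-1 ^+ i = 2 - 2 * 2^-1 ^+ m :> R.
  by rewrite gerBl mulr_ge0 // exprn_ge0.
elim: m => [|m IH]; first by rewrite big_ord0 expr0; ring.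
by rewrite big_ord_recr /= IH exprS; field.
Qed.

Let T := Num.truncn (log2 kappa + rho^-1).

Lemma levels_gt0 : (0 < T)%N.
Proof.
have /andP[_ rh] := rho_bounds; have r0 := rho_gt0.
rewrite /T truncn_gt0; have : 1 <= log2 kappa by rewrite -(log2_2 R); apply: ler_log2.
by have : 0 < rho^-1; [rewrite invr_gt0|lra].
Qed.

(** Inductively [a i * 2^i * n^(s i) <= n], with [s i] the sum of the earlier exponents. As
    [expo i <= s i + 1/kappa], level [i] contributes at most [129 n^(1+1/kappa) / 2^i], where
    [129 = 1 + 32 * 4]; and [s T >= 1] leaves no room for a center in [A_T]. *)
Lemma level_counts (a : nat -> nat) : a 0%N = n ->
  (forall i, (i < T)%N -> (a i.+1 * bucket i <= a i)%N) ->
  (\sum_(i < T) a i * (1 + 32 * bucket i) <= Num.truncn (258 * n%:R `^ (1 + kappa^-1) : R))%N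
  /\ a T = 0%N.
Proof.
move=> a0 aS; pose s i := \sum_(j < i) expo j.
have bound i : (i <= T)%N -> (a i)%:R * (2 ^+ i * n%:R `^ s i) <= n%:R :> R.
  elim: i => [|i IH] iT; first by rewrite /s big_ord0 powRr0 expr0 !mulr1 a0.
  apply: le_trans (IH (ltnW iT)); rewrite /s big_ord_recr /= powR_nD -/(s i) exprS.
  set z := 2 ^+ i; set u := n%:R `^ s i; set w := n%:R `^ expo i.
  have -> : (a i.+1)%:R * (2 * z * (u * w)) = ((a i.+1)%:R * (2 * w)) * (z * u) by ring.
  apply: ler_wpM2r; first by rewrite mulr_ge0 ?exprn_ge0 ?powR_ge0.
  apply: (@le_trans _ _ ((a i.+1)%:R * (bucket i)%:R)); first by apply: ler_wpM2l (bucket_ge i).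
  by rewrite -natrM ler_nat aS.
split.
  rewrite truncn_ge_nat; last by apply: mulr_ge0; [exact: ler0n|exact: powR_ge0].
  rewrite natr_sum; apply: (@le_trans _ _ (\sum_(i < T) 129 * n%:R `^ (1 + kappa^-1) * 2^-1 ^+ i)).
    apply: ler_sum => i _; have iT := ltn_ord i.
    have hb := bound i (ltnW iT); have h1 := powR_n_ge1 (expo_ge0 i).
    have p2 : 0 < 2 ^+ i :> R by rewrite exprn_gt0.
    rewrite exprVn ler_pdivlMr //.
    apply: (@le_trans _ _ (129 * ((a i)%:R * (2 ^+ i * n%:R `^ s i)) * n%:R `^ kappa^-1)); last first.
      rewrite powR_nD powRr1 // [leRHS]mulrA; apply: ler_wpM2r; first exact: powR_ge0.
      exact: ler_wpM2l.
    rewrite natrM natrD natrM; have hk := bucket_le i.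
    have es : n%:R `^ expo i <= n%:R `^ s i * n%:R `^ kappa^-1.
      by rewrite -powR_nD; apply: ler_powR => //; apply: expo_sum_ge.
    have -> : 129 * ((a i)%:R * (2 ^+ i * n%:R `^ s i)) * n%:R `^ kappa^-1 =
        (a i)%:R * (129 * (n%:R `^ s i * n%:R `^ kappa^-1)) * 2 ^+ i by ring.
    apply: ler_wpM2r; first exact: ltW.
    by apply: ler_wpM2l => //; lra.
  rewrite -mulr_sumr; apply: (@le_trans _ _ (129 * n%:R `^ (1 + kappa^-1) * 2)).
    by apply: ler_wpM2l; [rewrite mulr_ge0 ?powR_ge0|apply: sum_half].
  by have := powR_ge0 n%:R (1 + kappa^-1); lra.
have hT := bound T (leqnn T); apply/eqP; rewrite -leqn0 leqNgt; apply/negP => aT.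
have a1 : 1 <= (a T)%:R :> R by rewrite ler1n.
have s1 : n%:R <= n%:R `^ s T :> R.
  by rewrite -{1}(powRr1 (ltW n0)); apply: ler_powR => //; apply: exponents_suffice.
have t2 : 2 <= 2 ^+ T :> R.
  by rewrite -{1}(expr1 2); apply: ler_weXn2l; [rewrite ler1n|apply: levels_gt0].
have h : 1 * (2 * n%:R) <= (a T)%:R * (2 ^+ T * n%:R `^ s T).
  by apply: ler_pM => //; apply: ler_pM.
by have := le_trans h hT; rewrite mul1r leNgt ltr_pMl ?n0 // ltr1n.
Qed.

End Exponents.

(** * Number of passes *)

Section ProgramSize.
Local Open Scope nat_scope.

Lemma level_size_le J K Km trials : 0 < Km -> K <= Km ->
  trials * (J + (16 * K * (J + 1) + 1)).+2 + (J + (J + (1 * (J + 1) + 1)).+2).+2 <= J.+1 * (19 * Km * trials + 7).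
Proof.
move=> Km0 KKm; have -> : J.+1 * (19 * Km * trials + 7) = trials * (19 * Km * J.+1) + 7 * J.+1 by lia.
apply: leq_add; last lia.
rewrite leq_mul2l; apply/orP; right.
have h : 16 * K * (J + 1) <= 16 * Km * J.+1 by rewrite addn1; apply: leq_mul => //; rewrite leq_mul2l KKm orbT.
have h2 : 3 * J.+1 <= 3 * Km * J.+1 by rewrite leq_mul2r; apply/orP; right; rewrite leq_pmulr.
have -> : 19 * Km * J.+1 = 16 * Km * J.+1 + 3 * Km * J.+1 by rewrite -mulnDl -mulnDl.
lia.
Qed.

Lemma size_flatten_nseq X m (xs : seq X) : size (flatten (nseq m xs)) = m * size xs.
Proof. by rewrite size_flatten /shape map_nseq sumn_nseq mulnC. Qed.

Lemma size_trial (R : realType) n (C : finType) v0 tau J pr (delta eta : nat -> nat -> R) Kf k i cap Z :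
  size (trial_prog (n := n) C v0 tau J pr delta eta Kf k i cap Z) = J + (Z * (J + 1) + 1).+1.
Proof.
by rewrite /trial_prog /block_prog size_cat /= size_nseq size_cat size_flatten_nseq size_cat size_nseq.
Qed.

Lemma size_level (R : realType) n (C : finType) v0 tau J pr (delta eta : nat -> nat -> R) Kf smp k i trials :
  size (level_prog (n := n) (C := C) v0 tau J pr delta eta Kf smp k i trials) =
  trials * (J + (16 * Kf i * (J + 1) + 1)).+2 + (J + (J + (1 * (J + 1) + 1)).+2).+2.
Proof.
have sc X (x : X) l : size (x :: l) = (size l).+1 by [].
rewrite /level_prog /random_prog /det_prog !(sc, size_cat, size_flatten_nseq, size_trial, size_nseq).
rewrite -![size [::]]/0; lia.
Qed.

Lemma size_scales (R : realType) n (C : finType) v0 tau J pr Kf smp T trials (c : R) m Km :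
  0 < Km -> (forall i, i < T -> Kf i <= Km) ->
  size (scales_prog (n := n) (C := C) v0 tau J pr Kf smp T trials c 0 m) <=
  m * (1 + T * (J.+1 * (19 * Km * trials + 7))).
Proof.
move=> Km0 KfKm; rewrite /scales_prog size_flatten /shape -map_comp sumnE big_map.
rewrite -[X in X * _](size_iota 0 m) -sum1_size big_distrl /= mul1n; apply: leq_sum => k _.
rewrite add1n /scale_prog ltnS -/(size _) /levels_prog size_flatten /shape -map_comp sumnE big_map.
rewrite -[X in X * _](size_iota 0 T) -sum1_size big_distrl /= mul1n big_seq [leqRHS]big_seq.
apply: leq_sum => i; rewrite mem_iota => /andP[_ iT].
by rewrite size_level; apply: level_size_le => //; apply: KfKm.
Qed.

End ProgramSize.

(** * One coin space for all sampling rates *)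

Lemma card_multiples d m (Q := (m * d)%N) : (0 < d)%N -> #|[pred x : 'I_Q | (d %| x)%N]| = m.
Proof.
move=> d0; rewrite -sum1_card big_mkcond /=.
have -> : (\sum_(x < Q) (if x \in [pred x : 'I_Q | d %| x] then 1 else 0) = \sum_(0 <= x < Q) (d %| x))%N.
  by rewrite big_mkord; apply: eq_bigr => x _; rewrite inE; case: (d %| x)%N.
rewrite /Q; elim: m {Q} => [|m IH]; first by rewrite mul0n big_geq.
rewrite mulSn addnC (big_cat_nat (n := (m * d)%N)) ?leq_addr //= IH -addn1; congr addn.
rewrite -{1}[(m * d)%N]add0n big_addn addKn; case: d d0 {IH} => // d _.
rewrite big_nat_recl // add0n dvdn_mull // big_nat big1 // => i /andP[_ id].
by rewrite dvdn_addl ?dvdn_mull // gtnNdvd // ltnS.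
Qed.

Lemma card_dvd Q d : (0 < d)%N -> (d %| Q)%N -> (#|[pred x : 'I_Q | (d %| x)%N]| * d)%N = #|'I_Q|.
Proof. by move=> d0 /dvdnP[m ->]; rewrite card_multiples // card_ord. Qed.

Section Coins.
Variables (R : realType) (n : nat) (Kf : nat -> nat) (T : nat).
Hypothesis Kf_gt0 : forall i, (0 < Kf i)%N.

(* A multiple of all the inverse sampling rates, so that one uniform draw in
   ['I_coin_size] serves every level. *)
Definition coin_size : nat := (\prod_(i < T) (4 * Kf i))%N.
Definition coin_space : finType := {ffun 'I_n -> 'I_coin_size}.
Definition coin_law (c : coin_space) : R := (#|coin_space|%:R)^-1.
Definition sampled (i : nat) (c : coin_space) (v : 'I_n) : bool := (4 * Kf i %| c v)%N.

Lemma coin_size_gt0 : (0 < #|'I_coin_size|)%N.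
Proof. by rewrite card_ord; apply: prodn_gt0 => i; rewrite muln_gt0 Kf_gt0. Qed.

Lemma coin_law_ge0 c : 0 <= coin_law c.
Proof. by rewrite invr_ge0. Qed.

Lemma coin_law1 : \sum_c coin_law c = 1.
Proof. exact: (@uniform1 R n _ coin_size_gt0). Qed.

Lemma coins_unlucky : unlucky_le coin_law Kf sampled T (5 / 8).
Proof.
move=> i l et dl A iT dl0.
have cP : (#|[pred x : 'I_coin_size | (4 * Kf i %| x)%N]| * (4 * Kf i))%N = #|'I_coin_size|.
  apply: card_dvd; first by rewrite muln_gt0 Kf_gt0.
  by rewrite /coin_size (bigD1 (Ordinal iT)) //= dvdn_mulr.
exact: (prob_unlucky (Kf_gt0 i) cP coin_size_gt0 l et A dl0).
Qed.

End Coins.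

(** * Choice of the parameters and numeric bounds *)

Lemma log2_ge1_nat (R : realType) m : 1 <= log2 m%:R :> R -> (1 < m)%N.
Proof.
move=> h; have m0 : 0 < m%:R :> R.
  by rewrite ltr0n lt0n; apply/eqP => m0; move: h; rewrite m0 /log2 ln0 // mul0r; lra.
by rewrite -(ler_nat R) -(powR_log2 m0) -{1}(powRr1 (ler0n R 2)) ler_powR // ler1n.
Qed.

Lemma up_log_le (R : realType) m : (1 < m)%N -> (up_log 2 m)%:R <= log2 m%:R + 1 :> R.
Proof.
move=> m1; have /andP[h1 h2] := up_log_bounds (isT : (1 < 2)%N) m1.
have u0 : (0 < up_log 2 m)%N.
  by rewrite lt0n; apply/eqP => u0; move: h2; rewrite u0 expn0 leqNgt m1.
have p0 : 0 < 2 ^+ (up_log 2 m).-1 :> R by apply: exprn_gt0.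
have p1 : 2 ^+ (up_log 2 m).-1 <= m%:R :> R by rewrite -natrX ler_nat ltnW.
by have := ler_log2 p0 p1; rewrite log2_2X -(prednK u0) -natr1 /= lerD2r.
Qed.

Section Constants.
Variables (R : realType) (n L : nat) (kappa rho eps t kk gam C0 : R).
Hypothesis kappa_bounds : 2 <= kappa <= log2 n%:R / 4.
Hypothesis rho_bounds : kappa^-1 <= rho < 2^-1.
Hypothesis eps_bounds : 0 < eps <= 1.
Hypothesis t_bounds : 1 <= t <= log2 L%:R.
Hypothesis kk_ge : 6 * 40 + 4 <= kk.
Hypothesis gam_def : gam = 5 * (33 * (2 * kk) / 16).
Hypothesis C0_ge : 66 * (16 * gam) <= C0.

Definition levels_real : R := log2 kappa + rho^-1.
Definition base : R := levels_real * log2 L%:R / (eps * t).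
(** The ratio [c] of consecutive radii. [gam] is fixed so that [5 * log2 L / t] groups, each adding
    [eps_step], stay within [eps]. *)
Definition growth : R := gam * base.
Definition levels : nat := Num.truncn levels_real.
Definition group : nat := Num.truncn t.
Definition scales : nat := up_log 2 L.
Definition eps_step : R := 33 * (2 * kk * levels%:R / (16 * growth)).
Definition hop_bound : nat := Num.truncn ((C0 * base) `^ levels_real).
Definition rounds : nat := (Num.truncn (5 * (growth * lower_hops group levels growth))).+1.
Definition scale_size : nat := Num.truncn (258 * n%:R `^ (1 + kappa^-1) : R).
Definition max_bucket : nat := Num.truncn (4 * n%:R `^ rho : R).

Lemma kappa_ge2 : 2 <= kappa. Proof. by case/andP: kappa_bounds. Qed.

Lemma log2_n_ge : 8 <= log2 n%:R :> R.
Proof. by have /andP[h1 h2] := kappa_bounds; lra. Qed.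

Lemma n_gt1 : (1 < n)%N.
Proof. by apply: (@log2_ge1_nat R); have := log2_n_ge; lra. Qed.

Lemma log2_L_ge1 : 1 <= log2 L%:R :> R.
Proof. by have /andP[h1 h2] := t_bounds; lra. Qed.

Lemma L_gt1 : (1 < L)%N.
Proof. exact: log2_ge1_nat log2_L_ge1. Qed.

Lemma levels_real_ge3 : 3 <= levels_real.
Proof.
have /andP[_ rh] := rho_bounds; have k2 := kappa_ge2; have r0 := rho_gt0 k2 rho_bounds.
have h1 : 1 <= log2 kappa by rewrite -(log2_2 R); apply: ler_log2.
have h2 : 2 <= rho^-1 by rewrite -[leLHS]invrK lef_pV2 ?posrE ?invr_gt0 // ltW.
by rewrite /levels_real; lra.
Qed.

Lemma levels_pos : (0 < levels)%N.
Proof. by rewrite /levels truncn_gt0; have := levels_real_ge3; lra. Qed.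

Lemma levels_le : levels%:R <= levels_real.
Proof. by rewrite /levels truncn_le; have := levels_real_ge3; lra. Qed.

Lemma base_ge : levels_real <= base.
Proof.
have X3 := levels_real_ge3; have /andP[e0 e1] := eps_bounds; have /andP[t1 tl] := t_bounds.
have et0 : 0 < eps * t by rewrite mulr_gt0 //; lra.
rewrite /base ler_pdivlMr //; apply: ler_wpM2l; first by lra.
apply: le_trans tl; rewrite ler_piMl //; lra.
Qed.

Lemma gam_ge : 28 <= gam.
Proof. by have := kk_ge; rewrite gam_def; lra. Qed.

Lemma growth_ge84 : 84 <= growth.
Proof.
have h1 := levels_real_ge3; have h2 := base_ge; have h3 := gam_ge; rewrite /growth.
have : 28 * 3 <= gam * base by apply: ler_pM => //; lra.
lra.
Qed.

Lemma growth_ge : 4 * levels%:R <= growth.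
Proof.
have h1 := levels_le; have h2 := base_ge; have h3 := gam_ge; rewrite /growth.
by apply: ler_pM => //; lra.
Qed.

Lemma group_bounds : (0 < group)%N /\ group%:R <= t <= 2 * group%:R.
Proof.
have /andP[t1 _] := t_bounds; have g0 : (0 < group)%N by rewrite truncn_gt0.
have g1 : 1 <= group%:R :> R by rewrite ler1n.
split=> //; rewrite truncn_le; apply/andP; split; first lra.
by have := truncnS_gt t; rewrite -natr1 -/group; lra.
Qed.

Lemma scales_bounds : [/\ (0 < scales)%N, (L <= 2 ^ scales)%N,
  forall k, (k < scales)%N -> (2 ^ k < L)%N & scales%:R <= 2 * log2 L%:R :> R].
Proof.
have L1 := L_gt1; have /andP[h1 h2] := up_log_bounds (isT : (1 < 2)%N) L1.
have s0 : (0 < scales)%N.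
  by rewrite lt0n; apply/eqP => s0; move: h2; rewrite -/scales s0 expn0 leqNgt L1.
split=> //.
  move=> k kS; apply: leq_ltn_trans h1; rewrite leq_exp2l // -ltnS prednK //.
have := @ler_log2 R (2 ^+ scales.-1) L%:R; rewrite log2_2X exprn_gt0 // -natrX ler_nat ltnW // => /(_ isT isT).
by have := log2_L_ge1; rewrite -[in scales%:R](prednK s0) -natr1; lra.
Qed.

Lemma eps_step_le : ((scales %/ group).+1)%:R * eps_step <= eps.
Proof.
have [g0 /andP[g1 g2]] := group_bounds; have [s0 _ _ s2] := scales_bounds.
have /andP[e0 e1] := eps_bounds; have /andP[t1 tl] := t_bounds.
have X3 := levels_real_ge3; have TX := levels_le; have l1 := log2_L_ge1.
have k0 : 0 < kk by have := kk_ge; lra.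
have gam0 : 0 < gam by have := gam_ge; lra.
have t0 : 0 < t by lra.
have gr0 : 0 < group%:R :> R by rewrite ltr0n.
have q5 : ((scales %/ group).+1)%:R <= 5 * log2 L%:R / t :> R.
  have q1 : (scales %/ group)%:R * group%:R <= scales%:R :> R by rewrite -natrM ler_nat leq_trunc_div.
  have q2 : (scales %/ group)%:R <= 4 * log2 L%:R / t :> R.
    rewrite ler_pdivlMr //; apply: (@le_trans _ _ ((scales %/ group)%:R * (2 * group%:R))).
      exact: ler_wpM2l.
    lra.
  have q3 : 1 <= log2 L%:R / t by rewrite ler_pdivlMr // mul1r.
  by rewrite -natr1; lra.
have base0 : 0 < base by have := base_ge; lra.
have es : eps_step <= eps * t / (5 * log2 L%:R).
  have E : eps * t / (5 * log2 L%:R) = 33 * (2 * kk * levels_real / (16 * growth)).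
    rewrite /growth /base gam_def; field; rewrite !gt_eqF //=; lra.
  rewrite E /eps_step; apply: ler_wpM2l => //; apply: ler_wpM2r.
    by rewrite invr_ge0 mulr_ge0 //; have := growth_ge84; lra.
  by apply: ler_wpM2l => //; rewrite mulr_ge0 // ltW.
apply: (@le_trans _ _ (5 * log2 L%:R / t * (eps * t / (5 * log2 L%:R)))).
  apply: ler_pM => //; apply: mulr_ge0 => //; apply: divr_ge0.
    by apply: mulr_ge0 => //; lra.
  by have := growth_ge84; lra.
rewrite (_ : _ * _ = eps) //; field; rewrite !gt_eqF //; lra.
Qed.

Lemma base_C0_ge1 : 1 <= C0 * base.
Proof.
have h1 := levels_real_ge3; have h2 := base_ge; have h3 := gam_ge; have h4 := C0_ge.
have : 1 * 1 <= C0 * base by apply: ler_pM => //; lra.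
lra.
Qed.

(** Besides the hops, the hop bound absorbs the factors [levels] and [growth], which the number of
    passes would otherwise contain; [levels <= 2^levels] and a large base make this possible. *)
Lemma hops_real : levels%:R * growth * hops levels growth <= (C0 * base) `^ levels_real.
Proof.
have c84 := growth_ge84; have T0 := levels_pos; have B1 := base_C0_ge1.
have h2 := base_ge; have X3 := levels_real_ge3; have h3 := gam_ge; have h4 := C0_ge.
apply: (@le_trans _ _ ((C0 * base) ^+ levels)); last first.
  by rewrite -powR_mulrn ?ler_powR ?levels_le //; lra.
apply: (@le_trans _ _ ((66 * (16 * growth)) ^+ levels)); last first.
  rewrite lerXn2r ?nnegrE //; [lra|lra|].
  rewrite /growth (_ : 66 * (16 * (gam * base)) = 66 * (16 * gam) * base); last by ring.
  by apply: ler_wpM2r => //; lra.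
have g0 : 0 <= growth by lra.
have g8 : 1 <= 8 * growth by lra.
rewrite -[in leRHS](prednK T0); set m := levels.-1; rewrite /hops -/m.
have p1 : 1 <= (8 * growth) ^+ m by apply: exprn_ege1.
have Tm : levels%:R <= 2 ^+ m * 2 :> R.
  by rewrite -exprSr /m prednK // -natrX ler_nat ltnW // ltn_expl.
have E (f : R) : (f * (16 * growth)) ^+ m.+1 = f ^+ m * (2 ^+ m * 2) * ((8 * growth) ^+ m * growth) * (f * 8).
  rewrite exprS -{2}(_ : f * 2 * (8 * growth) = f * (16 * growth)); last by ring.
  rewrite [(_ * (8 * growth)) ^+ m]exprMn [(f * 2) ^+ m]exprMn.
  move: (f ^+ m) (2 ^+ m) ((8 * growth) ^+ m) => a1 a2 a3; ring.
have u1 : 1 <= 66 ^+ m :> R by apply: exprn_ege1; rewrite ler1n.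
rewrite {}E; move: ((8 * growth) ^+ m) (2 ^+ m * 2) (66 ^+ m) p1 Tm u1 => z w u p1 Tm u1.
clear h4 B1; clearbody m; move: g0 {c84 h2 h3 X3 g8}; move: growth (levels%:R : R) Tm (ler0n R levels) => g T Tm Tg g0.
have z0 : 0 <= z by lra.
have w0 : 0 <= w by lra.
apply: (@le_trans _ _ (w * (z * g) * 66)).
  apply: (@le_trans _ _ (T * (z * g) * 66)).
    have -> : T * g * (33 * (z + 1)) = T * g * 33 * (z + 1) by ring.
    have -> : T * (z * g) * 66 = T * g * 33 * (z * 2) by ring.
    apply: ler_wpM2l; last by lra.
    by apply: mulr_ge0 => //; apply: mulr_ge0.
  by apply: ler_wpM2r => //; apply: ler_wpM2r => //; apply: mulr_ge0.
have wz : 0 <= w * (z * g) by apply: mulr_ge0 => //; apply: mulr_ge0.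
apply: ler_pM => //; last by lra.
by rewrite -mulrA; apply: ler_peMl.
Qed.

Lemma hop_bound_le : hop_bound%:R <= (C0 * base) `^ levels_real.
Proof. by rewrite /hop_bound truncn_le powR_ge0. Qed.

Lemma hops_ge33 : 33 <= hops levels growth.
Proof. exact: hops_ge growth_ge84. Qed.

Lemma hops_le2 : levels%:R * growth * hops levels growth <= 2 * hop_bound%:R.
Proof.
have h := hops_real; have c84 := growth_ge84; have h33 := hops_ge33.
have T1 : 1 <= levels%:R :> R by rewrite ler1n levels_pos.
apply: le_trans h _; rewrite /hop_bound; set x := _ `^ _.
have x1 : 1 <= x by rewrite /x -[leLHS](powRr0 (C0 * base)) ler_powR ?base_C0_ge1 //; have := levels_real_ge3; lra.
have b1 : 1 <= (Num.truncn x)%:R :> R by rewrite ler1n truncn_gt0.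
by have := truncnS_gt x; rewrite -natr1; lra.
Qed.

Lemma hops_le : hops levels growth <= hop_bound%:R.
Proof.
have h := hops_le2; have c84 := growth_ge84; have h33 := hops_ge33.
have T1 : 1 <= levels%:R :> R by rewrite ler1n levels_pos.
have : 1 * 2 * hops levels growth <= levels%:R * growth * hops levels growth.
  by apply: ler_wpM2r; [lra|apply: ler_pM => //; lra].
lra.
Qed.

Lemma levels_le_hop : (levels <= hop_bound)%N.
Proof.
rewrite -(ler_nat R); have h := hops_le2; have c84 := growth_ge84; have h33 := hops_ge33.
have : levels%:R * (1 * 2) <= levels%:R * (growth * hops levels growth).
  by apply: ler_wpM2l => //; apply: ler_pM => //; lra.
by rewrite mulrA in h *; lra.
Qed.

Lemma powR_2t_ge1 : 1 <= 2 `^ t.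
Proof. by rewrite -[leLHS](powRr0 2) ler_powR ?ler1n //; have /andP[] := t_bounds; lra. Qed.

Lemma lower_hops_le : lower_hops group levels growth <= 4 * (2 `^ t * hops levels growth).
Proof.
have h33 := hops_ge33; have t1 := powR_2t_ge1.
have h2 : (2 ^ group)%:R <= 2 `^ t :> R.
  rewrite natrX -powR_mulrn // ler_powR ?ler1n //; have [_ /andP[]] := group_bounds.
  by [].
rewrite /lower_hops (_ : 4 * (2 `^ t * hops levels growth) = (2 * 2 `^ t) * (2 * hops levels growth)); last by ring.
by rewrite natrD; apply: ler_pM => //; lra.
Qed.

Lemma rounds_suffice : 5 * (growth * lower_hops group levels growth) <= rounds%:R.
Proof. by rewrite /rounds ltW // truncnS_gt. Qed.

Lemma rounds_le : rounds.+1%:R <= 22 * (growth * (2 `^ t * hops levels growth)).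
Proof.
have h33 := hops_ge33; have t1 := powR_2t_ge1; have c84 := growth_ge84; have hl := lower_hops_le.
have l0 := lower_hops_gt0 group levels c84.
have tr : (Num.truncn (5 * (growth * lower_hops group levels growth)))%:R <=
    5 * (growth * lower_hops group levels growth).
  by rewrite truncn_le mulr_ge0 // mulr_ge0 // ltW //; lra.
rewrite /rounds -natr1 -natr1.
have h1 : growth * lower_hops group levels growth <= 4 * (growth * (2 `^ t * hops levels growth)).
  by rewrite [leRHS]mulrCA; apply: ler_wpM2l => //; lra.
have : 1 * (1 * 1) <= growth * (2 `^ t * hops levels growth).
  by apply: ler_pM => //; [lra|apply: ler_pM => //; lra].
move: tr h1; set z := growth * lower_hops _ _ _; set w := growth * (_ * _).
by move: (Num.truncn (5 * z)) => m; clearbody z w; lra.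
Qed.

Lemma work_le : levels%:R * rounds.+1%:R <= 44 * (hop_bound%:R * 2 `^ t).
Proof.
have h := hops_le2; have hr := rounds_le; have t1 := powR_2t_ge1.
apply: (@le_trans _ _ (levels%:R * (22 * (growth * (2 `^ t * hops levels growth))))).
  exact: ler_wpM2l.
rewrite (_ : levels%:R * _ = 22 * (levels%:R * growth * hops levels growth) * 2 `^ t); last by ring.
rewrite (_ : 44 * _ = 22 * (2 * hop_bound%:R) * 2 `^ t); last by ring.
by apply: ler_wpM2r; [lra|apply: ler_wpM2l].
Qed.

Let Kb := bucket kappa rho n.

Lemma bucket_max i : (Kb i <= max_bucket)%N.
Proof.
have k2 := kappa_ge2; have n0 := ltnW n_gt1.
rewrite /max_bucket truncn_ge_nat; last by rewrite mulr_ge0 // powR_ge0.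
apply: le_trans (bucket_le k2 rho_bounds n0 i) _; apply: ler_wpM2l => //.
by apply: ler_powR; [rewrite ler1n|apply: expo_le].
Qed.

Lemma max_bucket_le : max_bucket%:R <= 4 * n%:R `^ rho.
Proof. by rewrite /max_bucket truncn_le mulr_ge0 // powR_ge0. Qed.

Lemma scale_size_le : scale_size%:R <= 258 * n%:R `^ (1 + kappa^-1).
Proof. by rewrite /scale_size truncn_le; apply: mulr_ge0; [exact: ler0n|exact: powR_ge0]. Qed.

Let logL : R := log2 L%:R.
Let logn : R := log2 n%:R.
Let N : R := n%:R `^ (1 + kappa^-1).
Let W : R := hop_bound%:R * 2 `^ t * logL.

Hypothesis b_lt_n : (hop_bound < n)%N.

Lemma n_ge1 : 1 <= n%:R :> R.
Proof. by rewrite ler1n ltnW // n_gt1. Qed.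

Lemma rho_range : 0 < rho < 1.
Proof.
have /andP[_ h] := rho_bounds; have k2 := kappa_ge2.
by rewrite (rho_gt0 k2 rho_bounds); lra.
Qed.

Lemma nrho_ge1 : 1 <= n%:R `^ rho.
Proof.
by apply: powR_n_ge1; [rewrite ltnW // n_gt1|case/andP: rho_range => /ltW].
Qed.

Lemma nrho_le : n%:R `^ rho <= n%:R.
Proof.
rewrite -[leRHS](powRr1 (ler0n R n)) ler_powR ?n_ge1 //.
by case/andP: rho_range => _ /ltW.
Qed.

Lemma N_ge : n%:R <= N.
Proof.
rewrite -[leLHS](powRr1 (ler0n R n)) ler_powR ?n_ge1 // lerDl invr_ge0.
by have := kappa_ge2; lra.
Qed.

Lemma logL_ge1 : 1 <= logL. Proof. exact: log2_L_ge1. Qed.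

Lemma logn_ge8 : 8 <= logn. Proof. exact: log2_n_ge. Qed.

Lemma two_t_ge1 : 1 <= 2 `^ t. Proof. exact: powR_2t_ge1. Qed.

Lemma b_ge1 : 1 <= hop_bound%:R :> R.
Proof.
have h := hops_le.
have h33 := hops_ge33.
by move: h h33; move: (hops _ _) (hop_bound%:R) => x y; lra.
Qed.

Lemma W_ge : logL <= W.
Proof.
have l1 := logL_ge1; rewrite /W ler_peMl //; first by lra.
have : 1 * 1 <= hop_bound%:R * 2 `^ t by apply: ler_pM => //; [exact: b_ge1|exact: two_t_ge1].
by rewrite mul1r.
Qed.

Lemma scales_le : scales%:R <= 2 * logL.
Proof. by have [_ _ _] := scales_bounds. Qed.

Lemma max_bucket_gt0 : (0 < max_bucket)%N.
Proof. by rewrite /max_bucket truncn_gt0; have := nrho_ge1; lra. Qed.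

Section Passes.
Variables (C : finType) (v0 : 'I_n) (pr : bool) (smp : nat -> C -> 'I_n -> bool) (trials : nat).
Let prog := scales_prog v0 (group) rounds pr (bucket kappa rho n) smp levels trials growth 0 scales.

Lemma passes_le : (size prog)%:R <= 88 * W * (19 * max_bucket%:R * trials%:R + 8).
Proof.
have h := size_scales v0 (group) rounds pr smp trials growth scales max_bucket_gt0
  (fun i (_ : (i < levels)%N) => bucket_max i).
have {h} : (size prog <= scales * (levels * rounds.+1 * (19 * max_bucket * trials + 8)))%N.
  apply: leq_trans h _; rewrite leq_mul2l; apply/orP; right.
  rewrite [(19 * _ * _ + 8)%N](_ : _ = (1 + (19 * max_bucket * trials + 7))%N); last by rewrite -[8%N]/(7 + 1)%N addnA addnC.
  rewrite [leqRHS]mulnDr muln1 -[X in (_ <= _ + X)%N]mulnA leq_add2r muln_gt0 andbT.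
  by rewrite levels_pos.
rewrite -(ler_nat R) => /le_trans; apply.
have wl := work_le.
have sl := scales_le; have l1 := logL_ge1.
rewrite !natrM natrD !natrM; set z := (_ + _).
have z0 : 0 <= z by rewrite addr_ge0.
rewrite mulrA; apply: ler_wpM2r => //.
have -> : 88 * W = (2 * logL) * (44 * (hop_bound%:R * 2 `^ t)).
  by rewrite /W; move: (hop_bound%:R) (2 `^ t) logL => u v w; ring.
by apply: ler_pM => //; apply: mulr_ge0.
Qed.

Let A : R := 88 * (76 * 8 + 8).

Hypothesis trials_le : trials%:R <= 8 * logn.

Lemma passes_le_all : (size prog)%:R <= A * (W * (n%:R `^ rho * logn)).
Proof.
have W0 : 0 <= W by apply: le_trans W_ge; have := logL_ge1; lra.
have l8 := logn_ge8; have r1 := nrho_ge1.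
apply: le_trans passes_le _.
have -> : A * (W * (n%:R `^ rho * logn)) = 88 * W * ((76 * 8 + 8) * (n%:R `^ rho * logn)).
  by rewrite /A; move: W logn (n%:R `^ rho) => u v w; ring.
apply: ler_wpM2l; first exact: mulr_ge0.
have kb := max_bucket_le.
have h1 : 19 * max_bucket%:R * trials%:R <= 76 * 8 * (n%:R `^ rho * logn).
  have -> : 76 * 8 * (n%:R `^ rho * logn) = (19 * (4 * n%:R `^ rho)) * (8 * logn).
    by move: logn (n%:R `^ rho) => u v; ring.
  by apply: ler_pM => //; exact: ler_wpM2l.
have h2 : 1 * 1 <= n%:R `^ rho * logn by apply: ler_pM => //; lra.
rewrite [leRHS]mulrDl; apply: lerD => //.
by move: h2; move: (n%:R `^ rho * logn) => u; lra.
Qed.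

(** The bits of the program counter: the logarithm of the number of passes splits into terms that
    are linear in [n] or in [log2 L]; [hop_bound < n] takes care of the hop bound. *)
Lemma counter_le : (up_log 2 (size prog))%:R <= (2 * A + 12) * (n%:R * logL).
Proof.
have n1 := n_ge1; have l1 := logL_ge1; have l8 := logn_ge8; have r1 := nrho_ge1.
have b1 := b_ge1; have t1 := two_t_ge1.
have n0 : 0 < n%:R :> R by lra.
have A0 : 0 < A by apply: mulr_gt0 => //; apply: addr_gt0 => //; apply: mulr_gt0.
have nl : 1 * 1 <= n%:R * logL by apply: ler_pM => //; lra.
have n_nl : n%:R <= n%:R * logL by rewrite ler_peMr //; lra.
have l_nl : logL <= n%:R * logL by rewrite ler_peMl //; lra.
have [s1|s1] := leqP (size prog) 1.
  have -> : up_log 2 (size prog) = 0%N by apply/eqP; rewrite up_log_eq0 s1 ?orbT.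
  by apply: mulr_ge0; [apply: addr_ge0 => //; apply: mulr_ge0 => //; apply: ltW|lra].
apply: le_trans (up_log_le R s1) _.
have s0 : 0 < (size prog)%:R :> R by rewrite ltr0n ltnW.
have := ler_log2 s0 passes_le_all => h.
have W0 : 0 < W by apply: lt_le_trans W_ge; lra.
have bt0 : 0 < hop_bound%:R * 2 `^ t by apply: mulr_gt0; lra.
have e1 : log2 (A * (W * (n%:R `^ rho * logn))) =
    log2 A + (log2 hop_bound%:R + log2 (2 `^ t) + log2 logL + (log2 (n%:R `^ rho) + log2 logn)).
  rewrite log2M //; last by apply: mulr_gt0 => //; apply: mulr_gt0; lra.
  rewrite log2M //; last by apply: mulr_gt0; lra.
  rewrite (@log2M _ (n%:R `^ rho)); [|lra|lra].
  rewrite /W (@log2M _ (hop_bound%:R * 2 `^ t)) //; last by lra.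
  by rewrite (@log2M _ hop_bound%:R) //; lra.
have a1 := log2_le A0.
have a2 : log2 hop_bound%:R <= 2 * n%:R :> R.
  apply: le_trans (log2_le _) _; first by lra.
  by apply: ler_wpM2l => //; rewrite ler_nat ltnW.
have a3 : log2 (2 `^ t) <= logL.
  have e : log2 (2 `^ t) = t.
    by rewrite /log2 ln_powR mulfK // gt_eqF // ln2_gt0.
  by rewrite e; case/andP: t_bounds.
have a4 : log2 logL <= 2 * logL by apply: log2_le; lra.
have a6 : logn <= 2 * n%:R by apply: log2_le.
have a5 : log2 (n%:R `^ rho) <= 2 * n%:R.
  apply: le_trans (log2_le _) _; first by lra.
  by apply: ler_wpM2l => //; apply: nrho_le.
have a7 : log2 logn <= 2 * logn by apply: log2_le; lra.
have a8 : 2 * A <= 2 * A * (n%:R * logL).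
  by rewrite ler_peMr //; [lra|rewrite mul1r in nl].
rewrite e1 in h; rewrite [leRHS]mulrDl; move: h a1 a8.
move: (2 * A * (n%:R * logL)) => v; move: (2 * A) (log2 A) => u0 u.
move: n_nl l_nl nl a2 a3 a4 a5 a6 a7; move: (n%:R * logL) (log2 hop_bound%:R) (log2 (2 `^ t)) (log2 logL) (log2 (n%:R `^ rho)) (log2 logn) => u1 u2 u3 u4 u5 u6.
lra.
Qed.

End Passes.
Lemma hopset_size_le : (scales * scale_size)%:R <= 2 * 258 * (N * logL).
Proof.
have sl := scales_le; have hS := scale_size_le; rewrite natrM.
have -> : 2 * 258 * (N * logL) = (2 * logL) * (258 * N).
  by move: N logL => u v; rewrite [RHS]mulrACA [v * u]mulrC.
exact: ler_pM.
Qed.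

Lemma tables_le : (n + n * max_bucket)%:R <= 5 * (n%:R * n%:R `^ rho).
Proof.
have n1 := n_ge1; have r1 := nrho_ge1; have kb := max_bucket_le; rewrite natrD natrM.
have h1 : n%:R <= n%:R * n%:R `^ rho by rewrite ler_peMr //; lra.
have h2 : n%:R * max_bucket%:R <= n%:R * (4 * n%:R `^ rho) by apply: ler_wpM2l kb; lra.
move: h1 h2; rewrite mulrCA; move: (n%:R * n%:R `^ rho) (n%:R * max_bucket%:R) => u v; lra.
Qed.

Lemma tables_le_time : (8 * (n + n * max_bucket))%:R * 1 <= 40 * (t * n%:R `^ (1 + rho) / rho).
Proof.
have n1 := n_ge1; have r1 := nrho_ge1; have tl := tables_le.
have /andP[r0 r2] := rho_range; have /andP[t1 _] := t_bounds.
rewrite mulr1 natrM.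
have e : n%:R `^ (1 + rho) = n%:R * n%:R `^ rho.
  by rewrite powR_nD ?powRr1 //; exact: ltnW n_gt1.
have h : n%:R * n%:R `^ rho <= t * n%:R `^ (1 + rho) / rho.
  rewrite e ler_pdivlMr //.
  have z0 : 0 <= n%:R * n%:R `^ rho by apply: mulr_ge0 => //; lra.
  apply: (@le_trans _ _ (n%:R * n%:R `^ rho)); first by rewrite ler_piMr // ltW.
  by rewrite ler_peMl.
by move: tl h; move: ((n + n * max_bucket)%N%:R) (n%:R * _) (t * _ / _) => u v w; lra.
Qed.

(** Since [(5/8)^4 <= 1/4], all [4 u] trials of a level fail with probability at most [1/n^2]. There
    are at most [2 log2 L * n] levels in all, and the fallback needs [O(n^2)] words. *)
Lemma fail_le (u := up_log 2 n) :
  (8 * (n + n * max_bucket))%:R * (scales%:R * (levels%:R * (5 / 8) ^+ (4 * u))) <= 80 * (n%:R * logL).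
Proof.
have n1 := n_ge1; have tl := tables_le; have sl := scales_le; have l1 := logL_ge1.
have Tn : levels%:R <= n%:R :> R.
  rewrite ler_nat; apply: leq_trans (ltnW b_lt_n).
  exact: (levels_le_hop).
have q1 : n%:R * n%:R * (5 / 8) ^+ (4 * u) <= 1 :> R.
  have nu : n%:R <= 2 ^+ u :> R by rewrite -natrX ler_nat up_logP.
  have q0 : 0 <= 5 / 8 :> R by lra.
  have q4 : (5 / 8) ^+ 4 <= 4^-1 :> R by rewrite !exprS expr0; lra.
  apply: (@le_trans _ _ (2 ^+ u * 2 ^+ u * 4^-1 ^+ u)).
    have z1 : 0 <= (5 / 8) ^+ (4 * u) :> R by apply: exprn_ge0.
    have z2 : n%:R * n%:R <= 2 ^+ u * 2 ^+ u :> R by apply: ler_pM.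
    have z3 : (5 / 8) ^+ (4 * u) <= 4^-1 ^+ u :> R.
      by rewrite exprM; apply: lerXn2r => //; rewrite nnegrE ?exprn_ge0 ?invr_ge0.
    by apply: ler_pM => //; apply: mulr_ge0.
  by rewrite -!exprMn (_ : 2 * 2 / 4 = 1 :> R) ?expr1n //; lra.
have q0 : 0 <= (5 / 8) ^+ (4 * u) :> R by apply: exprn_ge0; lra.
move: q1 q0; move: ((5 / 8) ^+ (4 * u)) => q q1 q0.
rewrite natrM; apply: (@le_trans _ _ (8 * (5 * (n%:R * n%:R)) * ((2 * logL) * (n%:R * q)))).
  apply: ler_pM.
  - exact: mulr_ge0.
  - by apply: mulr_ge0 => //; apply: mulr_ge0.
  - apply: ler_wpM2l => //; apply: le_trans tl _; apply: ler_wpM2l => //.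
    by apply: ler_wpM2l nrho_le; lra.
  - apply: ler_pM => //; first exact: mulr_ge0.
    exact: ler_wpM2r.
have -> : 8 * (5 * (n%:R * n%:R)) * ((2 * logL) * (n%:R * q)) = 80 * (n%:R * logL) * (n%:R * n%:R * q).
  by move: (n%:R : R) logL => x y; ring.
by rewrite ler_piMr //; apply: mulr_ge0 => //; apply: mulr_ge0; lra.
Qed.

Lemma trials_le_log : (4 * up_log 2 n)%:R <= 8 * logn.
Proof.
have := up_log_le R n_gt1; have := logn_ge8.
by rewrite natrM -/logn; lra.
Qed.

Section Space.
Variables (pcb : nat) (A : R).
Hypothesis A_ge0 : 0 <= A.
Hypothesis pcb_le : pcb%:R <= (2 * A + 12) * (n%:R * logL).

Let rest_le : (8 * (2 * n) + 12 * n + 2 * pcb + 17)%:R <= (4 * A + 69) * (n%:R * logL).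
Proof.
have n1 := n_ge1; have l1 := logL_ge1.
have nl : 1 * 1 <= n%:R * logL by apply: ler_pM.
have n_nl : n%:R <= n%:R * logL by rewrite ler_peMr //; lra.
rewrite mulnA -mulnDl natrD natrD (natrM _ (8 * 2 + 12)) (natrM _ 2).
rewrite -[(8 * 2 + 12)%N]/28%N; move: pcb_le nl n_nl.
have -> : (4 * A + 69) * (n%:R * logL) = 2 * ((2 * A + 12) * (n%:R * logL)) + 45 * (n%:R * logL).
  by move: (n%:R * logL) => x; ring.
by move: ((2 * A + 12) * (n%:R * logL)) => x; move: (n%:R * logL) => y; lra.
Qed.

Let NlogL_ge : n%:R * logL <= N * logL.
Proof. by apply: ler_wpM2r N_ge; have := logL_ge1; lra. Qed.

Lemma space_plain : (space_bound n rounds false scales scale_size (2 * n) pcb)%:R <= (12 * 258 + (4 * A + 69)) * (N * logL).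
Proof.
have sl := hopset_size_le.
have -> : space_bound n rounds false scales scale_size (2 * n) pcb =
    (6 * (scales * scale_size) + (8 * (2 * n) + 12 * n + 2 * pcb + 17))%N.
  by rewrite /space_bound muln0 add0n !addnA.
rewrite natrD [leRHS]mulrDl; apply: lerD.
  rewrite natrM; apply: le_trans (ler_wpM2l _ sl) _ => //.
  have e (w x : R) : 6 * (2 * w * x) = 12 * w * x by ring.
  by rewrite e.
apply: le_trans rest_le _; apply: ler_wpM2l NlogL_ge.
by apply: addr_ge0 => //; apply: mulr_ge0.
Qed.

Lemma space_pr : (space_bound n rounds true scales scale_size (2 * n) pcb)%:R <=
  (264 * (2 * 258) + (4 * A + 69)) * (N * hop_bound%:R * 2 `^ t * logL).
Proof.
have sl := hopset_size_le; have wl := work_le.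
have T0 := levels_pos.
have n1 := n_ge1; have l1 := logL_ge1; have b1 := b_ge1; have t1 := two_t_ge1.
have bt : 1 <= hop_bound%:R * 2 `^ t.
  by rewrite -[leLHS]mulr1; apply: ler_pM.
have N0 : 0 <= N by exact: powR_ge0.
have -> : N * hop_bound%:R * 2 `^ t * logL = (hop_bound%:R * 2 `^ t) * (N * logL).
  by move: N (2 `^ t) logL => x z w; ring.
have -> : space_bound n rounds true scales scale_size (2 * n) pcb =
    ((3 * rounds + 6) * (scales * scale_size) + (8 * (2 * n) + 12 * n + 2 * pcb + 17))%N.
  by rewrite /space_bound !addnA.
have j6 : (3 * rounds + 6)%:R <= 264 * (hop_bound%:R * 2 `^ t) :> R.
  have : rounds.+1%:R <= 44 * (hop_bound%:R * 2 `^ t).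
    by apply: le_trans wl; rewrite ler_peMl // ler1n.
  rewrite natrD natrM -natr1; have : 0 <= rounds%:R :> R by [].
  by move: (hop_bound%:R * 2 `^ t) => x; lra.
rewrite natrD natrM [leRHS]mulrDl; apply: lerD.
  apply: le_trans (ler_pM _ _ j6 sl) _ => //.
  by rewrite mulrACA.
apply: le_trans rest_le _; apply: ler_wpM2l; first by apply: addr_ge0 => //; apply: mulr_ge0.
apply: le_trans NlogL_ge _; rewrite ler_peMl //.
by apply: mulr_ge0 => //; lra.
Qed.

End Space.
Let A : R := 88 * (76 * 8 + 8).
Section FewHops.
Variables (trials : nat) (pf : R).
Hypothesis pf_ge : 1 <= pf \/ scales%:R * (levels%:R * (5 / 8) ^+ trials) <= pf.
Hypothesis trials_le : trials%:R <= 8 * logn.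

Let v0 : 'I_n := Ordinal (ltnW n_gt1).
Let prog pr := scales_prog v0 (group) rounds pr Kb (@sampled n Kb levels) levels trials growth 0 scales.
Let pcb pr := up_log 2 (size (prog pr)).

Let pf_ge' : 1 <= pf \/ (exists2 q, 0 <= q <= 1 /\ unlucky_le (@coin_law R n Kb levels) Kb (@sampled n Kb levels) levels q
  & scales%:R * (levels%:R * q ^+ trials) <= pf).
Proof.
case: pf_ge => [|h]; [by left|right; exists (5 / 8) => //; split; first lra].
exact: (@coins_unlucky R n Kb levels (bucket_gt0 kappa rho n)).
Qed.

Let n0 : (0 < n)%N := ltnW n_gt1.

Lemma few_hops_program pr (sp := (space_bound n rounds pr scales scale_size (2 * n) (pcb pr))%:R +
    (8 * (n + n * max_bucket))%:R * pf) (passes := (size (prog pr))%:R) :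
  (streamable_hopset n L hop_bound eps (scales * scale_size)%:R sp passes /\
   forall k, streamable_scale_hopset n L hop_bound eps k scale_size%:R sp passes) /\
  (pr -> streamable_pr_hopset n L hop_bound eps (scales * scale_size)%:R sp passes /\
   forall k, streamable_pr_scale_hopset n L hop_bound eps k scale_size%:R sp passes).
Proof.
have k2 := kappa_ge2; have [s1 s2 s3 _] := scales_bounds.
have /andP[e0 e1] := eps_bounds; have [g0 _] := group_bounds.
apply: (program_outputs (@coin_law_ge0 R n Kb levels)
  (coin_law1 R n levels (bucket_gt0 kappa rho n)) (v0 := v0) (tau := group) (J := rounds) (pr := pr)
  (eps1 := eps_step) (kk := kk)) => //.
- exact: levels_pos.
- exact: growth_ge.
- exact: growth_ge84.
- exact: rounds_suffice.
- exact: eps_step_le.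
- by move=> a; apply: (level_counts k2 rho_bounds n0).
- by move=> i iT; rewrite leq_add2l leq_mul2l bucket_max orbT.
- exact: hops_le.
- exact: ltW.
- exact: ltnW L_gt1.
- exact: up_logP.
Qed.

Lemma few_hops_outputs (size1 size2 space prspace passes : R) :
  2 * 258 * (N * logL) <= size1 -> 258 * N <= size2 ->
  (12 * 258 + (4 * A + 69)) * (N * logL) + (8 * (n + n * max_bucket))%:R * pf <= space ->
  (264 * (2 * 258) + (4 * A + 69)) * (N * hop_bound%:R * 2 `^ t * logL) + (8 * (n + n * max_bucket))%:R * pf <= prspace ->
  (forall pr, (size (prog pr))%:R <= passes) ->
  [/\ streamable_hopset n L hop_bound eps size1 space passes,
      streamable_pr_hopset n L hop_bound eps size1 prspace passes,
      forall k, streamable_scale_hopset n L hop_bound eps k size2 space passes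
    & forall k, streamable_pr_scale_hopset n L hop_bound eps k size2 prspace passes].
Proof.
move=> s1 s2 sp prsp pas.
have A0 : 0 <= A by apply: mulr_ge0 => //; apply: addr_ge0 => //; apply: mulr_ge0.
have z1 : (scales * scale_size)%:R <= size1 by apply: le_trans s1; apply: (hopset_size_le).
have z2 : scale_size%:R <= size2 by apply: le_trans s2; apply: scale_size_le.
have cnt pr : (pcb pr)%:R <= (2 * A + 12) * (n%:R * logL).
  exact: (counter_le v0 pr _ trials_le).
have z3 := le_trans (lerD (space_plain A0 (cnt false)) (lexx _)) sp.
have z4 := le_trans (lerD (space_pr A0 (cnt true)) (lexx _)) prsp.
have [[p1 p2] _] := few_hops_program false.
have [_ /(_ isT)[p3 p4]] := few_hops_program true.
split=> [||k|k].
- exact: streamable_le z1 z3 (pas false) p1.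
- exact: streamable_le z1 z4 (pas true) p3.
- exact: streamable_le z2 z3 (pas false) (p2 k).
- exact: streamable_le z2 z4 (pas true) (p4 k).
Qed.

End FewHops.

End Constants.

(** * Hop bounds of at least n *)

Section ManyHops.
Variables (R : realType) (n L b : nat) (eps : R).
Hypothesis n_le : (n <= b)%N.
Hypothesis eps_ge0 : 0 <= eps.

Lemma union_nil (G : wgraph n) u v w : mgraph_union (mgraph_of G) [::] u v w = mgraph_of G u v w.
Proof. by rewrite /mgraph_union !in_nil !orbF. Qed.

Lemma dist_ge0 (E : mgraph n) u v : (0 <= dist R E u v)%E.
Proof. by apply: le_ereal_inf_tmp => d [p _ ->]; rewrite lee_fin. Qed.

(** A simple path has fewer than [n <= b] edges, so the hop limit excludes none. *)
Lemma nil_hopset (G : wgraph n) : is_hopset b eps G [::].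
Proof.
move=> u v; split.
  apply: le_ereal_inf_tmp => d [p [hp _] ->]; apply: dist_path.
  by apply: sub_is_path hp => a c w; rewrite union_nil.
apply: (@le_trans _ _ (dist R (mgraph_of G) u v)).
  apply: le_ereal_inf_tmp => d [p hp ->]; apply: ereal_inf_lbound; exists p => //; split.
    by apply: sub_is_path hp => a c w; rewrite union_nil.
  have /and3P[_ up _] := hp; have := uniq_leq_size up (fun x _ => mem_enum 'I_n x).
  rewrite /= size_map size_enum_ord => /ltnW/leq_trans; exact.
have := dist_ge0 (mgraph_of G) u v; case: (dist _ _ _ _) => [r| |] //=.
- by rewrite -EFinM !lee_fin => r0; rewrite ler_peMl // lerDl.
- by move=> _; rewrite gt0_muley ?leey // lte_fin; have := eps_ge0; lra.
Qed.

Lemma nil_scale_hopset (G : wgraph n) k : is_scale_hopset b eps G k [::].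
Proof. by move=> u v; have [h1 h2] := nil_hopset G u v; split. Qed.

Lemma streamable_nil (O : Type) (enc : O -> memory n) size_of good (x : O)
    (max_size max_space max_passes : R) : enc x = [::] -> size_of x = 0%N ->
  (forall G, good G x) -> 0 <= max_size -> 0 <= max_space -> 0 <= max_passes ->
  streamable L enc size_of good max_size max_space max_passes.
Proof.
move=> encx szx gx s0 sp0 p0.
have law0 (c : unit) : 0 <= (1 : R) by [].
have law1 : \sum_(c : unit) (1 : R) = 1 by rewrite big_const card_unit /= addr0.
exists (StreamingAlg law0 law1 (fun _ m _ => m)), 0%N; split=> // G s _ _ _.
exists (fun=> x).
have runE (o : outcome (StreamingAlg law0 law1 (fun _ m _ => m)) 0 s) : run o = [::].
  by rewrite /run; case: (val o).
split.
- by move=> o _; rewrite /final_memory runE encx.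
- by rewrite /expect big1 // => o _; rewrite szx mulr0.
- by rewrite /expect big1 // => o _; rewrite /peak_space runE big_nil mulr0.
Qed.

Lemma many_hops_outputs (size1 size2 space prspace passes : R) :
  0 <= size1 -> 0 <= size2 -> 0 <= space -> 0 <= prspace -> 0 <= passes ->
  [/\ streamable_hopset n L b eps size1 space passes,
      streamable_pr_hopset n L b eps size1 prspace passes,
      forall k, streamable_scale_hopset n L b eps k size2 space passes
    & forall k, streamable_pr_scale_hopset n L b eps k size2 prspace passes].
Proof.
move=> h1 h2 h3 h4 h5; split=> [||k|k].
- by apply: (streamable_nil (x := [::])) => // G; apply: nil_hopset.
- apply: (streamable_nil (x := [::])) => // G; split=> //; first exact: nil_hopset.
  by move=> k; apply: nil_scale_hopset.
- by apply: (streamable_nil (x := [::])) => // G; apply: nil_scale_hopset.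
- apply: (streamable_nil (x := [::])) => // G; split=> // j _; exact: nil_scale_hopset.
Qed.

End ManyHops.

(** * Assembling the constants *)

Lemma upper_bound_exists (R : realType) (s : seq R) : exists2 C, 0 < C & all (fun x => x <= C) s.
Proof.
elim: s => [|x s [C C0 sC]]; first by exists 1.
exists (Num.max x C) => /=; first by rewrite lt_max C0 orbT.
rewrite le_max lexx /=; apply: sub_all sC => y yC; by rewrite le_max yC orbT.
Qed.

Theorem theorem3p16 (R : realType) :
  exists2 C : R, 0 < C &
  forall c : nat, exists2 C' : R, 0 < C' &
  forall (n L : nat) (kappa rho eps t : R),
    2 <= kappa <= log2 n%:R / 4 ->
    kappa^-1 <= rho < 2^-1 ->
    0 < eps <= 1 ->
    1 <= t <= log2 L%:R ->
  exists2 b : nat,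
    b%:R <= (C * ((log2 kappa + rho^-1) * log2 L%:R / (eps * t)))
              `^ (log2 kappa + rho^-1) &
    let N := n%:R `^ (1 + kappa^-1) in
    let logL := log2 L%:R in
    (let sp := C * (t * n%:R `^ (1 + rho) / rho + N * logL) in
     let pr_sp :=
       C * (t * n%:R `^ (1 + rho) / rho + N * b%:R * 2 `^ t * logL) in
     let passes := C * (b%:R * logL * 2 `^ t) in
     [/\ streamable_hopset n L b eps (C * (N * logL)) sp passes,
         streamable_pr_hopset n L b eps (C * (N * logL)) pr_sp passes,
         forall k : nat,
           streamable_scale_hopset n L b eps k (C * N) sp passes
       & forall k : nat,
           streamable_pr_scale_hopset n L b eps k (C * N) pr_sp passes])
    /\
    ((L <= 2 ^ (n ^ c))%N ->
     let sp := C' * (N * logL) in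
     let pr_sp := C' * (N * b%:R * 2 `^ t * logL) in
     let passes := C' * (n%:R `^ rho * b%:R * log2 n%:R * logL * 2 `^ t) in
     [/\ streamable_hopset n L b eps (C * (N * logL)) sp passes,
         streamable_pr_hopset n L b eps (C * (N * logL)) pr_sp passes,
         forall k : nat,
           streamable_scale_hopset n L b eps k (C * N) sp passes
       & forall k : nat,
           streamable_pr_scale_hopset n L b eps k (C * N) pr_sp passes]).
Proof.
pose kk : R := 6 * 40 + 4; pose gam : R := 5 * (33 * (2 * kk) / 16).
pose A : R := 88 * (76 * 8 + 8); pose c1 : R := 12 * 258 + (4 * A + 69).
pose c2 : R := 264 * (2 * 258) + (4 * A + 69).
(* One constant dominates the base of the hop bound and the coefficients of size, space and passes
   in both regimes. *)
have [C C0] := upper_bound_exists [:: 66 * (16 * gam); 2 * 258; 258; 40; c1; c2; 88 * 8; c1 + 80; c2 + 80; A].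
rewrite /= => /andP[C_gam /andP[C_size /andP[C_scale /andP[C_tab /andP[C_plain /andP[C_pr]]]]]].
move=> /andP[C_pass /andP[C_plain' /andP[C_pr' /andP[C_pass' _]]]].
exists C => // c; exists C => // n L kappa rho eps t kb rb eb tb.
exists (hop_bound L kappa rho eps t C); first exact: hop_bound_le.
set b := hop_bound _ _ _ _ _ _; set N := n%:R `^ (1 + kappa^-1); set logL := log2 L%:R.
have l1 : 1 <= logL := logL_ge1 tb.
have N0 : 0 <= N by exact: powR_ge0.
have t1 : 1 <= 2 `^ t := two_t_ge1 tb.
have n1 : 1 <= n%:R :> R := n_ge1 kb.
have l8 : 8 <= log2 n%:R :> R := logn_ge8 kb.
have r1 : 1 <= n%:R `^ rho := nrho_ge1 kb rb.
have r01 := rho_range kb rb.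
have b0 : 0 <= b%:R :> R by [].
have t0 : 0 <= 2 `^ t by exact: powR_ge0.
have l0 : 0 <= logL by apply: le_trans l1.
have ln0 : 0 <= log2 n%:R :> R by apply: le_trans l8.
have nl0 := mulr_ge0 N0 l0.
have prl0 := mulr_ge0 (mulr_ge0 (mulr_ge0 N0 b0) t0) l0.
have time0 : 0 <= t * n%:R `^ (1 + rho) / rho.
  apply: divr_ge0; last by case/andP: r01 => /ltW.
  by apply: mulr_ge0; [case/andP: tb; lra|exact: powR_ge0].
have p0 := mulr_ge0 (mulr_ge0 b0 l0) t0.
have p0' := mulr_ge0 (mulr_ge0 (mulr_ge0 (mulr_ge0 (powR_ge0 n%:R rho) b0) ln0) l0) t0.
have Cge0 := ltW C0.
(* For [n <= b] the empty hopset is output without any pass; below, [b < n] is available to the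
   bounds on the counter and on the failure probability. *)
have [nb|bn] := leqP n b.
  by have /andP[/ltW e0 _] := eb; split=> [|_]; apply: many_hops_outputs => //;
    apply: mulr_ge0 => //; apply: addr_ge0.
have coef (x y z : R) : 0 <= z -> x <= C -> y <= x * z -> y <= C * z.
  by move=> z0 xC yx; apply: le_trans yx _; apply: ler_wpM2r.
have size1 : 2 * 258 * (N * logL) <= C * (N * logL) by apply: ler_wpM2r.
have size2 : 258 * N <= C * N by apply: ler_wpM2r.
split=> [|_].
  (* First resource bound: no random trials, so every level uses the deterministic choice, and its
     tables account for the term [t * n^(1+rho) / rho]. *)
  refine (few_hops_outputs (kappa_bounds := kb) rb eb tb (lexx kk) (erefl gam) C_gam bn (trials := 0) (pf := 1) _ _ size1 size2 _ _ _) => //.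
  - by left.
  - by apply: mulr_ge0 => //; lra.
  - rewrite [leLHS]addrC [leRHS]mulrDr; apply: lerD; last by apply: ler_wpM2r.
    exact: coef time0 C_tab (tables_le_time kb rb tb).
  - rewrite [leLHS]addrC [leRHS]mulrDr; apply: lerD; last by apply: ler_wpM2r.
    exact: coef time0 C_tab (tables_le_time kb rb tb).
  move=> pr; apply: (coef (88 * 8)) => //.
  apply: le_trans (passes_le kb rb eb tb (lexx kk) (erefl gam) C_gam _ pr _ 0) _.
  have e (x y z : R) : 88 * (x * z * y) * 8 = 88 * 8 * (x * y * z) by ring.
  by rewrite mulr0 add0r e.
have fl := fail_le kb rb eb tb (lexx kk) (erefl gam) C_gam bn.
have fl' : (8 * (n + n * max_bucket n rho))%:R *
    ((scales L)%:R * ((levels kappa rho)%:R * (5 / 8) ^+ (4 * up_log 2 n))) <= 80 * (N * logL).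
  apply: le_trans fl _; apply: ler_wpM2l => //; apply: ler_wpM2r (N_ge kb); lra.
(* Second resource bound: [4 * up_log 2 n] random trials per level, which bring the factor
   [n^rho * log n] into the passes and make the expected cost of the fallback [O(n * log L)]. *)
refine (few_hops_outputs (kappa_bounds := kb) rb eb tb (lexx kk) (erefl gam) C_gam bn (trials := (4 * up_log 2 n)%N)
  (pf := (scales L)%:R * ((levels kappa rho)%:R * (5 / 8) ^+ (4 * up_log 2 n))) _ _ size1 size2 _ _ _) => //.
- by right.
- exact: (trials_le_log kb).
- apply: le_trans (lerD (lexx _) fl') _; rewrite -[leLHS]mulrDl; exact: ler_wpM2r.
- apply: (@le_trans _ _ ((c2 + 80) * (N * b%:R * 2 `^ t * logL))); last exact: ler_wpM2r.
  rewrite [leRHS]mulrDl; apply: lerD => //; apply: le_trans fl' _; apply: ler_wpM2l => //.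
  apply: ler_wpM2r => //; rewrite -mulrA ler_peMr //.
  have b1 : 1 <= b%:R :> R := b_ge1 kb rb eb tb (lexx kk) (erefl gam) C_gam.
  by rewrite -[leLHS]mulr1; apply: ler_pM.
move=> pr; apply: (coef A) => //.
apply: le_trans (passes_le_all kb rb eb tb (lexx kk) (erefl gam) C_gam _ pr _ (trials_le_log kb)) _.
have e (x y z u v : R) : A * (x * z * y * (u * v)) = A * (u * x * v * y * z) by ring.
by rewrite e.
Qed.
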